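(* For every integer $n\ge0$, $\chi_h(GL_3(\mathbb{Z}),S^nV_3)=\chi_h(GL_2(\mathbb{Z}),S^nV_2)$. Explicitly, writing $n=12q+k$ with $0\le k<12$, this common value is $-q+1$ for $k=0$, $-q$ for $k\in\{2,4,6,8\}$, $-q-1$ for $k=10$, and $0$ for $k$ odd.
   Context: $V_m=\mathbb{Q}^m$ is the standard representation of $GL_m(\mathbb{Z})$, $S^n$ denotes the $n$-th symmetric power, and $\chi_h(\Gamma,V)=\sum_i(-1)^i\dim_{\mathbb{Q}}H^i(\Gamma,V)$. *)

(* Defs.v *)
From mathcomp Require Import all_boot all_order all_algebra.
From mathcomp Require Import mpoly.

Import Order.TTheory GRing.Theory Num.Theory.
Local Open Scope ring_scope.

Definition GLZ (m : nat) := {A : 'M[int]_m | A \in unitmx}.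

Lemma GLZmul_proof m (g h : GLZ m) : val g *m val h \in unitmx.
Proof. by rewrite unitmx_mul (valP g) (valP h). Qed.

Definition GLZmul m (g h : GLZ m) : GLZ m := Sub (val g *m val h) (GLZmul_proof m g h).

(* S^n V_m, V_m = Q^m with basis e_1..e_m (the variables 'X_i):
   homogeneous polynomials of degree n in m variables over Q.
   g acts on e_j by e_j |-> \sum_i g_ij e_i, extended multiplicatively. *)
Definition SymPow (m n : nat) (p : {mpoly rat[m]}) : Prop := p \is n.-homog.

Definition act m (g : GLZ m) (p : {mpoly rat[m]}) : {mpoly rat[m]} :=
  p \mPo [tuple \sum_(i < m) ((val g) i j)%:~R *: 'X_i | j < m].

(* Homogeneous (standard resolution) cochains of degree i:
   functions f : Gamma^(i+1) -> S^n V that are Gamma-equivariant. *)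
Definition cochain m n i (f : ('I_i.+1 -> GLZ m) -> {mpoly rat[m]}) : Prop :=
  (forall x, SymPow m n (f x)) /\
  (forall g x, f (fun k => GLZmul m g (x k)) = act m g (f x)).

Definition cobound m i (f : ('I_i.+1 -> GLZ m) -> {mpoly rat[m]})
  : ('I_i.+2 -> GLZ m) -> {mpoly rat[m]} :=
  fun x => \sum_(j < i.+2) (-1) ^+ j * f (fun k => x (lift j k)).

Definition is_cocycle m n i f : Prop := cochain m n i f /\ cobound m i f = (fun _ => 0).

Definition is_coboundary m n (i : nat) : (('I_i.+1 -> GLZ m) -> {mpoly rat[m]}) -> Prop :=
  match i with
  | 0 => fun f => f = (fun _ => 0)
  | i'.+1 => fun f => exists h, cochain m n i' h /\ f = cobound m i' h
  end.

Definition hdim (m n i r : nat) : Prop :=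
  exists z : 'I_r -> (('I_i.+1 -> GLZ m) -> {mpoly rat[m]}),
    (forall k, is_cocycle m n i (z k)) /\
    (forall f, is_cocycle m n i f ->
       exists c : 'I_r -> rat,
         is_coboundary m n i (fun x => f x - \sum_(k < r) c k *: z k x)) /\
    (forall c : 'I_r -> rat,
       is_coboundary m n i (fun x => \sum_(k < r) c k *: z k x) -> forall k, c k = 0).

Definition chi_h (m n : nat) (c : int) : Prop :=
  exists (N : nat) (d : nat -> nat),
    (forall i, hdim m n i (d i)) /\
    (forall i, (N <= i)%N -> d i = 0%N) /\
    \sum_(i < N) (-1) ^+ i * (d i)%:Z = c.

Definition chi_value (n : nat) : int :=
  let q := (n %/ 12)%N in
  let k := (n %% 12)%N in
  if odd k then 0
  else if k == 0%N then 1 - q%:Z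
  else if k == 10%N then - q%:Z - 1
  else - q%:Z.

(* Main.v *)
(* Let m = 2 or 3. The unimodular lists of vectors up to sign (those occurring as minimal vectors of well-rounded
   forms) span a complex of alternating cochains with a discrete Morse matching: a list S has a unique minimal basis b,
   and S is matched by toggling one further vector, chosen by a finite table depending only on which 0, +-1 combinations
   of b beat the members of b. Only one cell is left, so the complex resolves the orientation character. Lists have
   finite stabilisers, so comparing with the standard complex through a double complex shows that S^n V-valued
   equivariant cochains on the cells compute group cohomology. The Euler characteristic is then the alternating sum over
   orbits of cells of the dimension of the twisted invariants of the stabiliser H in S^n V, that is, of
   |H|^-1 times the sum over H of a sign times the trace on S^n V. An element of order dividing 12 is diagonalisable, so
   this trace is the complete symmetric polynomial of its eigenvalues, a linear recurrent sequence in n with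
   characteristic roots of order dividing 12; the sums are therefore quasi-polynomials of period 12, compared with the
   announced value on finitely many coefficients. *)
Require Import Defs.
From mathcomp Require Import all_boot all_order all_algebra.
From mathcomp Require Import mpoly.
From mathcomp Require Import all_fingroup all_field.
From mathcomp Require Import zify ring lra.
From Stdlib Require Import ClassicalEpsilon FunctionalExtensionality Wellfounded.
Set Implicit Arguments. Unset Strict Implicit. Unset Printing Implicit Defensive.
Import Order.TTheory GRing.Theory Num.Theory.
Local Notation funext := functional_extensionality.

(** * Lines and unimodular lists *)

Section Lines.
Local Open Scope ring_scope.

(** Two obstacles shape the proof. There are infinitely many cells, so a geometric retraction has to
    be replaced by something finite and checkable. Weights do this: the vector of squared
    coordinates, compared lexicographically, is the value at a line of the form x_1^2 + t x_2^2 +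
    t^2 x_3^2 with t infinitely small. Around a basis only finitely many comparisons matter, and the
    order is well founded on nonnegative integer vectors, so cochains of arbitrary support can be
    solved for by descent. The second obstacle is orientation. A list with N - p members stands for
    a cell of dimension p of the retract, but alternation in the list orients the cone spanned by
    the forms v v^T and not the dual cell. The two orientations differ by that of the space of
    quadratic forms. Hence a sign character enters every equivariance condition on cells, and the
    degree 0 class [orient], which transforms by the same character, removes it when the cells are
    compared with the standard complex. The constant 48 is a common multiple of the orders of all
    stabilisers that occur. *)

Lemma unit_int (x : int) : (x \is a GRing.unit) = (`|x| == 1).
Proof.
apply/idP/idP; last by move=> H; have [] : x = 1 \/ x = -1; [lia|move=> ->|move=> ->].
by move=> ux; have : x * x^-1 = 1; [exact: mulrV|nia].
Qed.

Variable m : nat.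
Implicit Types (v w : 'cV[int]_m) (g h : GLZ m).

Definition lpos v : bool :=
  [exists i, (0 < v i 0) && [forall j : 'I_m, (j < i)%N ==> (v j 0 == 0)]].

Lemma lposP v : reflect (exists2 i, 0 < v i 0 & forall j : 'I_m, (j < i)%N -> v j 0 = 0)
  (lpos v).
Proof.
apply: (iffP existsP) => [[i /andP[h /forallP H]]|[i h H]]; exists i => //.
  by move=> j ji; apply/eqP; move: (H j); rewrite ji.
by rewrite h /=; apply/forallP => j; apply/implyP => ji; apply/eqP/H.
Qed.

Lemma lpos_neq0 v : lpos v -> v != 0.
Proof. by case/lposP => i h _; apply: contraTneq h => ->; rewrite mxE ltxx. Qed.

Lemma lposN v : v != 0 -> lpos (- v) = ~~ lpos v.
Proof.
move=> v0.
have [i vi H] : exists2 i, v i 0 != 0 & forall j : 'I_m, (j < i)%N -> v j 0 = 0.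
  have /existsP[i0 hi0] : [exists i, v i 0 != 0].
    apply: contraR v0 => /existsPn H; apply/eqP/matrixP => i j.
    by rewrite (ord1 j) mxE; apply/eqP; move: (H i); rewrite negbK.
  case: (@arg_minnP _ i0 (fun i => v i 0 != 0) (@nat_of_ord m) hi0) => i hi Hi.
  exists i => // j ji; apply/eqP/negPn/negP => /Hi; lia.
have key (u : 'cV[int]_m) : u i 0 != 0 -> (forall j : 'I_m, (j < i)%N -> u j 0 = 0) -> lpos u = (0 < u i 0).
  move=> ui Hu; apply/lposP/idP => [[k uk Hk]|]; last by exists i.
  case: (ltngtP k i) => [/Hu E|/Hk E|/val_inj <- //].
    by rewrite E ltxx in uk.
  by rewrite E eqxx in ui.
rewrite !key // ?mxE ?oppr_eq0 //; last by move=> j /H E; rewrite mxE E oppr0.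
by rewrite oppr_gt0 -leNgt le_eqVlt (negbTE vi).
Qed.

Definition lnorm v := if lpos v then v else - v.

Lemma lpos_lnorm v : v != 0 -> lpos (lnorm v).
Proof. by move=> v0; rewrite /lnorm; case: ifP => // E; rewrite lposN // E. Qed.

Lemma lnormK v : lpos v -> lnorm v = v.
Proof. by rewrite /lnorm => ->. Qed.

Lemma lnorm_sign v : exists b : bool, lnorm v = (-1) ^+ b *: v.
Proof.
by rewrite /lnorm; case: (lpos v); [exists false; rewrite scale1r|exists true; rewrite scaleN1r].
Qed.

(* A vector up to sign, represented by the one whose first nonzero entry is positive. *)
Definition line := {v : 'cV[int]_m | lpos v}.

(** The default [l0] is reached only at v = 0. *)
Definition toline (l0 : line) v : line := insubd l0 (lnorm v).

Lemma val_toline l0 v : v != 0 -> val (toline l0 v) = lnorm v.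
Proof. by move=> v0; rewrite val_insubd lpos_lnorm. Qed.

Lemma line_neq0 (l : line) : val l != 0.
Proof. exact: lpos_neq0 (valP l). Qed.

Lemma line_inj_sign (l l' : line) (b : bool) : val l = (-1) ^+ b *: val l' -> l = l'.
Proof.
case: b; last by rewrite expr0 scale1r => /val_inj.
rewrite expr1 scaleN1r => E; have : lpos (val l) by exact: valP.
have P : lpos (val l') by exact: valP.
by rewrite E lposN ?line_neq0 // P.
Qed.

Definition GL1 : GLZ m := Sub 1%:M (unitmx1 int m).
Lemma GLinv_proof g : invmx (val g) \in unitmx.
Proof. by rewrite unitmx_inv (valP g). Qed.
Definition GLinv g : GLZ m := Sub (invmx (val g)) (GLinv_proof g).

Lemma val_GLinv g : val (GLinv g) = invmx (val g). Proof. by []. Qed.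
Lemma GLmulA g h k : GLZmul m g (GLZmul m h k) = GLZmul m (GLZmul m g h) k.
Proof. by apply/val_inj; rewrite /= mulmxA. Qed.
Lemma GLmul1 g : GLZmul m GL1 g = g.
Proof. by apply/val_inj; rewrite /= mul1mx. Qed.
Lemma GLmulV g : GLZmul m (GLinv g) g = GL1.
Proof. by apply/val_inj; rewrite /= mulVmx ?(valP g). Qed.
Lemma GLmulrV g : GLZmul m g (GLinv g) = GL1.
Proof. by apply/val_inj; rewrite /= mulmxV ?(valP g). Qed.
Lemma GLmulK g h : GLZmul m (GLinv g) (GLZmul m g h) = h.
Proof. by rewrite GLmulA GLmulV GLmul1. Qed.
Lemma GLmulVK g h : GLZmul m g (GLZmul m (GLinv g) h) = h.
Proof. by rewrite GLmulA GLmulrV GLmul1. Qed.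
Lemma GLmul_inj g : injective (GLZmul m g).
Proof. exact: can_inj (GLmulK g). Qed.

Lemma GL_neq0 g v : v != 0 -> val g *m v != 0.
Proof.
apply: contraNneq => E.
by rewrite -(mulKmx (valP g) v) E mulmx0.
Qed.

Definition lact g (l : line) : line := toline l (val g *m val l).

Lemma val_lact g l : val (lact g l) = lnorm (val g *m val l).
Proof. by rewrite val_toline // GL_neq0 // line_neq0. Qed.

Lemma lact_sign g l : exists b : bool, val (lact g l) = (-1) ^+ b *: (val g *m val l).
Proof. by rewrite val_lact; apply: lnorm_sign. Qed.

Lemma lact_eq g l l' (b : bool) : val l' = (-1) ^+ b *: (val g *m val l) -> lact g l = l'.
Proof.
have [c E] := lact_sign g l => E'.
apply: (@line_inj_sign _ _ (c (+) b)).
by rewrite E E' scalerA signr_addb -mulrA -signr_addb addbb mulr1.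
Qed.

Lemma lactM g h l : lact (GLZmul m g h) l = lact g (lact h l).
Proof.
have [b E] := lact_sign h l; have [c E'] := lact_sign g (lact h l).
apply: (@lact_eq _ _ _ (c (+) b)).
by rewrite E' E -scalemxAr scalerA signr_addb /= mulmxA.
Qed.

Lemma lact1 l : lact GL1 l = l.
Proof. by apply: (@lact_eq _ _ _ false); rewrite scale1r /= mul1mx. Qed.

Lemma lactK g : cancel (lact g) (lact (GLinv g)).
Proof. by move=> l; rewrite -lactM GLmulV lact1. Qed.
Lemma lactVK g : cancel (lact (GLinv g)) (lact g).
Proof. by move=> l; rewrite -lactM GLmulrV lact1. Qed.
Lemma lact_inj g : injective (lact g).
Proof. exact: can_inj (lactK g). Qed.

Definition lmx (b : 'I_m -> line) : 'M[int]_m := \matrix_(i, j) (val (b j)) i 0.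

(** Each new column is, up to sign, g times the old one, and det g is itself 1 or -1. So minors keep
    their absolute value, and being unimodular is invariant. *)
Lemma lmx_act g b : exists c : int, `|c| = 1 /\ \det (lmx (fun j => lact g (b j))) = c * \det (lmx b).
Proof.
have /fin_all_exists[e He] j : exists e : bool, val (lact g (b j)) = (-1) ^+ e *: (val g *m val (b j)).
  exact: lact_sign.
have -> : lmx (fun j => lact g (b j)) = val g *m lmx b *m diag_mx (\row_j (-1) ^+ e j).
  apply/matrixP => i j; rewrite mul_mx_diag !mxE He !mxE mulrC; congr (_ * _).
  by apply: eq_bigr => k _; rewrite !mxE.
exists (\det (val g) * \prod_j (-1) ^+ e j); split; last first.
  by rewrite !det_mulmx det_diag mulrAC; congr (_ * _ * _); apply: eq_bigr => j _; rewrite mxE.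
rewrite normrM normr_prod big1 ?mulr1 => [|j _]; last by rewrite normrX normrN1 expr1n.
by move: (valP g); rewrite unitmxE unit_int => /eqP.
Qed.

(* The codes of the cones of the well-rounded retract: lists containing a basis, all of whose m x m minors are 0 or +-1. *)
Definition uni (s : seq line) : Prop :=
  [/\ uniq s,
      exists2 b : 'I_m -> line, (forall i, b i \in s) & `|\det (lmx b)| = 1
    & forall b : 'I_m -> line, (forall i, b i \in s) -> `|\det (lmx b)| <= 1].

Lemma uni_uniq s : uni s -> uniq s. Proof. by case. Qed.

Lemma uni_perm s t : perm_eq s t -> uni s -> uni t.
Proof.
move=> st [us [b bs d] H]; split.
- by rewrite -(perm_uniq st).
- by exists b => // i; rewrite -(perm_mem st).
by move=> c cs; apply: H => i; rewrite (perm_mem st).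
Qed.

Lemma uni_act g s : uni (map (lact g) s) <-> uni s.
Proof.
suff H g' t : uni t -> uni (map (lact g') t).
  split; last exact: H.
  by move=> /(H (GLinv g)); rewrite -map_comp (eq_map (lactK g)) map_id.
case=> us [b bs d] H; split.
- by rewrite map_inj_uniq //; apply: lact_inj.
- exists (fun j => lact g' (b j)); first by move=> i; apply: map_f.
  by have [c [c1 ->]] := lmx_act g' b; rewrite normrM c1 d mulr1.
move=> c cs.
have E j : c j = lact g' (lact (GLinv g') (c j)) by rewrite lactVK.
have [a [a1 Ea]] := lmx_act (GLinv g') c.
have : `|\det (lmx (fun j => lact (GLinv g') (c j)))| <= 1.
  by apply: H => i; have /mapP[x xt ->] := cs i; rewrite lactK.
by rewrite Ea normrM a1 mul1r.
Qed.

(* Cramer's rule *)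
Lemma det_replace (A : 'M[int]_m) (i : 'I_m) v :
  \det (\matrix_(k, j) if j == i then v k 0 else A k j) = (\adj A *m v) i 0.
Proof.
rewrite (expand_det_col _ i) mxE; apply: eq_bigr => k _.
rewrite !mxE eqxx mulrC; congr (_ * _); rewrite /cofactor; congr (_ * \det _).
apply/matrixP => a b; rewrite !mxE.
by rewrite [lift i b == i]eq_sym (negbTE (neq_lift i b)).
Qed.

Definition upd (b : 'I_m -> line) (i : 'I_m) (l : line) : 'I_m -> line :=
  fun j => if j == i then l else b j.

(** Cramer's rule read both ways: it bounds by 1 the coordinates of the members of a unimodular
    list, and it recognises the possible exchanges of a basis member by a nonzero coordinate. *)
Lemma coord_upd (b : 'I_m -> line) l i : `|\det (lmx b)| = 1 ->
  `|(invmx (lmx b) *m val l) i 0| = `|\det (lmx (upd b i l))|.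
Proof.
move=> d; have u : lmx b \in unitmx by rewrite unitmxE unit_int d.
have -> : (invmx (lmx b) *m val l) i 0 = (\det (lmx b))^-1 * (\adj (lmx b) *m val l) i 0.
  by rewrite /invmx u -scalemxAl mxE.
rewrite -det_replace normrM.
have -> : `|(\det (lmx b))^-1| = 1.
  by have [] : \det (lmx b) = 1 \/ \det (lmx b) = -1; [lia|move=> ->|move=> ->].
rewrite mul1r; congr `|\det _|.
by apply/matrixP => k j; rewrite !mxE /upd; case: ifP.
Qed.

Lemma uni_coord s (b : 'I_m -> line) l : uni s -> (forall i, b i \in s) ->
  `|\det (lmx b)| = 1 -> l \in s -> forall i, `|(invmx (lmx b) *m val l) i 0| <= 1.
Proof.
move=> [_ _ H] bs d ls i; rewrite coord_upd //.
by apply: H => j; rewrite /upd; case: ifP.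
Qed.

End Lines.

(** * Signs of orderings of a finite list *)

Section Signs.
Local Open Scope ring_scope.

Section Eps.
Variable A : countType.
Implicit Types (s t : seq A) (x y : A).

(* Signs are taken relative to the arbitrary order given by [pickle]; only the products [eps s * eps t] matter. *)
Fixpoint inversions s : nat :=
  if s is x :: s' then (count (fun y => (pickle y < pickle x)%N) s' + inversions s')%N else 0%N.

Definition eps s : rat := (-1) ^+ inversions s.

Lemma eps_cons x s : eps (x :: s) = (-1) ^+ count (fun y => (pickle y < pickle x)%N) s * eps s.
Proof. by rewrite /eps /= exprD. Qed.

Lemma epsK s : eps s * eps s = 1.
Proof. by rewrite /eps -exprD addnn -signr_odd odd_double. Qed.

Lemma eps_cons2 x s t : perm_eq s t -> eps (x :: s) * eps (x :: t) = eps s * eps t.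
Proof.
move=> st; rewrite !eps_cons (seq.permP st) mulrACA -exprD addnn -signr_odd odd_double.
by rewrite mul1r.
Qed.

Lemma eps_swap x y s : x != y -> eps (x :: y :: s) = - eps (y :: x :: s).
Proof.
move=> xy; rewrite !eps_cons /= !exprD.
have := inj_eq (pcan_inj (@pickleK A)) x y.
rewrite (negbTE xy); case: ltngtP => // _ _; rewrite !expr1 !expr0; ring.
Qed.

Lemma eps_move x s t : x \notin s -> eps (s ++ x :: t) = (-1) ^+ size s * eps (x :: s ++ t).
Proof.
elim: s => [|y s IH] /=; first by rewrite mul1r.
rewrite inE negb_or => /andP[xy xs].
have P : perm_eq (s ++ x :: t) (x :: s ++ t) by rewrite -cat1s perm_catCA.
rewrite eps_swap // eps_cons (seq.permP P) IH // [eps (y :: x :: _)]eps_cons exprS.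
ring.
Qed.

End Eps.

(** The product of the two signs is that of the permutation from s to t, which an injection
    preserves. The induction moves the head of s to its place in t, at the same cost on both
    sides. *)
Lemma eps_map_in (A B : countType) (f : A -> B) s t : {in s &, injective f} -> uniq s -> perm_eq s t ->
  eps (map f s) * eps (map f t) = eps s * eps t.
Proof.
elim: s t => [|x s IH] t fi us st.
  by move: st; rewrite perm_sym => /perm_nilP ->; rewrite !epsK.
have xt : x \in t by rewrite -(perm_mem st) mem_head.
case/splitPr: xt st => a b st.
have ut : uniq (a ++ x :: b) by rewrite -(perm_uniq st).
have xa : x \notin a.
  by move: ut; rewrite cat_uniq /= => /and3P[_ /norP[]].
have fxa : f x \notin map f a.
  apply/mapP => -[y ya E]; case/negP: xa.
  by rewrite (fi x y) ?mem_head // (perm_mem st) mem_cat ya.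
have st' : perm_eq s (a ++ b).
  by rewrite -(perm_cons x) (perm_trans st) // -cat1s perm_catCA.
rewrite map_cat /= !eps_move // size_map.
rewrite [LHS]mulrCA [RHS]mulrCA -map_cat; congr (_ * _).
rewrite !eps_cons2 //; last exact: perm_map.
apply: IH => //; last by case/andP: us.
by move=> y z ys zs; apply: fi; rewrite inE ?ys ?zs orbT.
Qed.

Lemma eps_map (A B : countType) (f : A -> B) s t : injective f -> uniq s -> perm_eq s t ->
  eps (map f s) * eps (map f t) = eps s * eps t.
Proof. by move=> fi; apply: eps_map_in => x y _ _; apply: fi. Qed.

End Signs.

(** * Finite sets attached equivariantly to a unimodular list *)

Section Finiteness.
Local Open Scope ring_scope.
Variable m : nat.
Implicit Types (s t : seq (line m)) (g h : GLZ m).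

Definition asb (P : Prop) : bool := if excluded_middle_informative P then true else false.
Lemma asbP (P : Prop) : reflect P (asb P).
Proof. by rewrite /asb; case: excluded_middle_informative => H; constructor. Qed.

Lemma lpos_delta (j : 'I_m) : lpos (delta_mx j 0 : 'cV[int]_m).
Proof.
apply/lposP; exists j; first by rewrite mxE !eqxx.
by move=> k kj; rewrite mxE andbT; case: eqP => // E; rewrite E ltnn in kj.
Qed.
Definition lstd (j : 'I_m) : line m := Sub (delta_mx j 0) (lpos_delta j).

Lemma val_lact_std g j : exists b : bool, val (lact g (lstd j)) = (-1) ^+ b *: col j (val g).
Proof. by have [b ->] := lact_sign g (lstd j); exists b; rewrite /= colE. Qed.

(** A vector that completes s has coordinates 0, 1 or -1 in a basis contained in s, so 3^m
    candidates are enough; ['I_3] shifted by 1 encodes the three values. *)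
Lemma ext_exists s : exists e : seq (line m),
  uniq e /\ forall v, v \in e <-> uni s /\ uni (v :: s).
Proof.
have [us|nus] := excluded_middle_informative (uni s); last first.
  by exists [::]; split => // v; split => // -[].
have [uqs [b bs d] _] := us.
pose L := pmap insub [seq lmx b *m (\col_i ((f i)%:Z - 1)) | f : {ffun 'I_m -> 'I_3}] : seq (line m).
exists (undup [seq v <- L | asb (uni (v :: s))]); split; first exact: undup_uniq.
move=> v; rewrite mem_undup mem_filter; split; first by case/andP => /asbP.
move=> [_ uv]; apply/andP; split; first exact/asbP.
rewrite mem_pmap_sub; apply/imageP.
have C i : `|(invmx (lmx b) *m val v) i 0| <= 1.
  by apply: (uni_coord uv) => [k||]; rewrite ?mem_head // inE bs orbT.
have u : lmx b \in unitmx by rewrite unitmxE unit_int d.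
have F i : exists k : 'I_3, (invmx (lmx b) *m val v) i 0 = k%:Z - 1.
  have := C i; set x := (_ *m _) _ _ => Hx.
  have lt : (absz (x + 1)%R < 3)%N by lia.
  exists (Ordinal lt) => /=; lia.
have /fin_all_exists[f Hf] := F.
exists (finfun f) => //.
rewrite -[LHS](mulKVmx u); congr (_ *m _); apply/matrixP => i j.
by rewrite (ord1 j) Hf mxE ffunE.
Qed.

Definition ext s : seq (line m) := projT1 (constructive_indefinite_description _ (ext_exists s)).
Lemma ext_uniq s : uniq (ext s).
Proof. by rewrite /ext; case: constructive_indefinite_description => e []. Qed.
Lemma extP s v : v \in ext s <-> uni s /\ uni (v :: s).
Proof. by rewrite /ext; case: constructive_indefinite_description => e []. Qed.

Lemma ext_perm s t : perm_eq s t -> perm_eq (ext s) (ext t).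
Proof.
move=> st; apply: uniq_perm; rewrite ?ext_uniq // => v; apply/idP/idP; rewrite !extP => -[a b]; split;
  try (by apply: uni_perm a; rewrite // perm_sym);
  by apply: uni_perm b; rewrite // perm_cons // perm_sym.
Qed.

Lemma ext_act g s : perm_eq (ext (map (lact g) s)) (map (lact g) (ext s)).
Proof.
apply: uniq_perm; rewrite ?map_inj_uniq ?ext_uniq //; try exact: lact_inj.
move=> v; apply/idP/mapP => [/extP[a b]|[w /extP[a b] ->]].
  exists (lact (GLinv g) v); last by rewrite lactVK.
  by apply/extP; split; [apply/(uni_act g)|apply/(uni_act g); rewrite /= lactVK].
by apply/extP; split; [apply/uni_act|apply/(uni_act g (w :: s))].
Qed.

(** A frame of s is a matrix whose columns belong to s up to sign, so there are finitely many. The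
    group permutes frames along with lists: averages are taken over them, and stabilisers are
    searched among them. *)
Lemma frames_exists s : exists t : seq (GLZ m),
  uniq t /\ forall g, g \in t <-> forall j, lact g (lstd j) \in s.
Proof.
pose L := pmap insub [seq \matrix_(i, j) ((-1) ^+ (f j).2 * (val (tnth (in_tuple s) (f j).1)) i 0)
  | f : {ffun 'I_m -> 'I_(size s) * bool}] : seq (GLZ m).
exists (undup [seq g <- L | [forall j, lact g (lstd j) \in s]]); split; first exact: undup_uniq.
move=> g; rewrite mem_undup mem_filter; split; first by case/andP => /forallP.
move=> H; apply/andP; split; first exact/forallP.
rewrite mem_pmap_sub; apply/imageP.
have F j : exists p : 'I_(size s) * bool,
    forall i, (val g) i j = (-1) ^+ p.2 * (val (tnth (in_tuple s) p.1)) i 0.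
  have [b E] := val_lact_std g j.
  have /tnthP[k Hk] : lact g (lstd j) \in in_tuple s by exact: H.
  exists (k, b) => i /=; rewrite -Hk E !mxE mulrA -exprD addnn.
  by rewrite -signr_odd odd_double mul1r.
have /fin_all_exists[f Hf] := F.
by exists (finfun f) => //; apply/matrixP => i j; rewrite mxE ffunE.
Qed.

Definition frames s : seq (GLZ m) :=
  projT1 (constructive_indefinite_description _ (frames_exists s)).
Lemma frames_uniq s : uniq (frames s).
Proof. by rewrite /frames; case: constructive_indefinite_description => e []. Qed.
Lemma framesP s g : g \in frames s <-> forall j, lact g (lstd j) \in s.
Proof. by rewrite /frames; case: constructive_indefinite_description => e []. Qed.

Lemma frames_perm s t : perm_eq s t -> perm_eq (frames s) (frames t).
Proof.
move=> st; apply: uniq_perm; rewrite ?frames_uniq // => g; apply/idP/idP; rewrite !framesP => H j;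
  by have := H j; rewrite (perm_mem st).
Qed.

Lemma frames_act g s : perm_eq (frames (map (lact g) s)) (map (GLZmul m g) (frames s)).
Proof.
apply: uniq_perm; rewrite ?map_inj_uniq ?frames_uniq //; try exact: GLmul_inj.
move=> h; apply/idP/mapP => [/framesP H|[k /framesP H ->]].
  exists (GLZmul m (GLinv g) h); last by rewrite GLmulVK.
  by apply/framesP => j; rewrite lactM; have /mapP[x xs ->] := H j; rewrite lactK.
by apply/framesP => j; rewrite lactM map_f.
Qed.

Lemma frames_uni s : uni s -> frames s != [::].
Proof.
move=> [_ [b bs d] _]; apply/eqP => E.
have u : lmx b \in unitmx by rewrite unitmxE unit_int d.
have : (Sub (lmx b) u : GLZ m) \in frames s.
  apply/framesP => j; rewrite (_ : lact _ _ = b j) //.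
  apply: (@lact_eq _ _ _ _ false); rewrite scale1r -colE.
  by apply/matrixP => i k; rewrite !mxE (ord1 k).
by rewrite E.
Qed.

End Finiteness.

(** * The complex of alternating cochains *)

Lemma perm_cons_swap (T : eqType) (x y : T) s : perm_eq [:: x, y & s] [:: y, x & s].
Proof. by have := perm_catCA [:: x] [:: y] s; rewrite /= => /(_ [:: y, x & s]) ->. Qed.

Section Alternating.
Local Open Scope ring_scope.
Variables (m N : nat) (V : lmodType rat).
Implicit Types (s t : seq (line m)) (f : seq (line m) -> V).

(* Degree p is codimension: the cells are the unimodular lists with N - p members, where N = m (m + 1) / 2. *)
Definition alt (p : nat) f : Prop :=
  (forall s, f s != 0 -> uni s /\ (size s + p = N)%N) /\
  (forall s t, perm_eq s t -> f t = (eps s * eps t) *: f s).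

(** Degree being codimension, a coboundary at s collects the values at the cells with one more
    member. There are finitely many of these, so no condition on supports is required. *)
Definition dd f : seq (line m) -> V := fun s => \sum_(v <- ext s) f (v :: s).

Lemma uni_sub s v : (exists2 b : 'I_m -> line m, (forall i, b i \in s) & `|\det (lmx b)| = 1) ->
  uni (v :: s) -> uni s.
Proof.
by move=> hb [/andP[_ us] _ H]; split => // b bs; apply: H => i; rewrite inE bs orbT.
Qed.

Lemma alt0 p : alt p (fun _ => 0).
Proof. by split=> [s|s t _]; rewrite ?eqxx // scaler0. Qed.

Lemma altB p f f' : alt p f -> alt p f' -> alt p (fun s => f s - f' s).
Proof.
move=> [f1 f2] [g1 g2]; split=> [s|s t st]; last by rewrite (f2 _ _ st) (g2 _ _ st) scalerBr.
have [E|/f1 //] := eqVneq (f s) 0; have [E'|/g1 //] := eqVneq (f' s) 0.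
by rewrite E E' subrr eqxx.
Qed.

Lemma alt_dd p f : alt p f -> alt p.+1 (dd f).
Proof.
move=> [f1 f2]; split=> [s ds|s t st].
  have /hasP[v /extP[us _] /f1[_ E]] : has (fun v => f (v :: s) != 0) (ext s).
    apply: contraNT ds => /hasPn H; rewrite /dd big_seq big1 // => v /H.
    by rewrite negbK => /eqP.
  by split => //; rewrite -E /= addnS.
rewrite /dd -(perm_big _ (ext_perm st)) scaler_sumr; apply: eq_bigr => v _.
have P : perm_eq (v :: s) (v :: t) by rewrite perm_cons.
by rewrite (f2 _ _ P) eps_cons2.
Qed.

Lemma dd_dd p f : alt p f -> dd (dd f) = fun _ => 0.
Proof.
move=> [f1 f2]; apply: funext => s.
have [us|nus] := excluded_middle_informative (uni s); last first.
  by rewrite /dd big_seq big1 // => v /extP[].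
(* A completion of v :: s also completes s, and f vanishes at the pairs that are not unimodular. So
   both sums may run over [ext s], a square on which f is antisymmetric. *)
have E : dd (dd f) s = \sum_(v <- ext s) \sum_(u <- ext s) f [:: u, v & s].
  rewrite /dd big_seq [RHS]big_seq; apply: eq_bigr => v vs.
  have P : perm_eq (ext (v :: s)) (filter (mem (ext (v :: s))) (ext s)).
    apply: uniq_perm; rewrite ?filter_uniq ?ext_uniq // => u; rewrite mem_filter /=.
    case: (boolP (u \in ext (v :: s))) => //= /extP[_ uvs]; symmetry; apply/extP; split => //.
    apply: (uni_sub _ (uni_perm (perm_cons_swap _ _ _) uvs)).
    by case: us => _ [b bs d] _; exists b => // i; rewrite inE bs orbT.
  rewrite (perm_big _ P) big_filter big_mkcond /=; apply: eq_bigr => u _.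
  case: (boolP (u \in _)) => // H; apply/eqP; rewrite eq_sym; apply: contraNT H => /f1[H _].
  by apply/extP; split => //; case/extP: vs.
rewrite E; apply/eqP.
have sw u v : f [:: u, v & s] = - f [:: v, u & s].
  have P := perm_cons_swap v u s.
  have [->|uv] := eqVneq u v.
    suff -> : f [:: v, v & s] = 0 by rewrite oppr0.
    by apply/eqP; apply: contraT => /f1[[/=]]; rewrite inE eqxx.
  by rewrite (f2 _ _ P) eps_swap 1?eq_sym // mulNr epsK scaleN1r.
set S := (X in X == 0).
have : S = - S.
  rewrite {1}/S exchange_big /= -sumrN; apply: eq_bigr => u _.
  by rewrite -sumrN; apply: eq_bigr => v _; apply: sw.
move=> /eqP; rewrite -subr_eq0 opprK -mulr2n -scaler_nat scaler_eq0 pnatr_eq0 /=.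
by [].
Qed.

End Alternating.

(** * Discrete Morse matchings *)

(* [low s u] pairs the cell [s] with the cell [u :: s]; [s0] is the only unpaired cell and has degree 0. *)
Section Morse.
Local Open Scope ring_scope.
Variables (m N : nat).
Implicit Types (s t : seq (line m)) (u v : line m).
Variables (low : seq (line m) -> line m -> Prop) (s0 : seq (line m)).
Variables (A : Type) (ltA : A -> A -> Prop) (wfA : well_founded ltA) (rk : seq (line m) -> A).
Hypothesis low_uni : forall s u, low s u -> uni (u :: s) /\ uni s.
Hypothesis low_perm : forall s t u, perm_eq s t -> low s u -> low t u.
Hypothesis low_fun : forall s u v, low s u -> low s v -> u = v.
Hypothesis up_fun : forall s t u v, perm_eq (u :: s) (v :: t) -> low s u -> low t v -> u = v.
Hypothesis low_cover : forall t, uni t ->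
  (exists u, low t u) \/ (exists u s, perm_eq t (u :: s) /\ low s u) \/ perm_eq t s0.
Hypothesis rk_dec : forall s t u v u', low s u -> v <> u -> perm_eq (v :: s) (u' :: t) -> low t u' ->
  ltA (rk t) (rk s).
Hypothesis uni_size : forall s, uni s -> (size s <= N)%N.
Hypothesis s0_size : size s0 = N.

Definition srt s := sort (fun u v => (pickle u <= pickle v)%N) s.
Lemma perm_srt s : perm_eq s (srt s). Proof. by rewrite perm_sym; apply/permPl/perm_sort. Qed.
Lemma srt_perm s t : perm_eq s t -> srt s = srt t.
Proof.
move=> st; apply/perm_sortP => //.
- by move=> x y; apply: leq_total.
- by move=> x y z; apply: leq_trans.
by move=> x y; rewrite -eqn_leq => /eqP /(pcan_inj (@pickleK _)).
Qed.

Variable V : lmodType rat.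
Implicit Types (f : seq (line m) -> V).

(** At a matched cell s the equation df = 0 gives the value at its partner from the other
    completions of s. Those are lower cells, the critical cell, or partners of cells of smaller
    rank, so all vanish by induction. *)
Lemma morse_zero p f : alt N p f -> dd f = (fun _ => 0) -> (forall s u, low s u -> f s = 0) ->
  f s0 = 0 -> f = fun _ => 0.
Proof.
move=> [f1 f2] df fl fs0.
have cov t : (forall u s, perm_eq t (u :: s) -> low s u -> f t = 0) -> f t = 0.
  move=> H; have [//|/f1[ut _]] := eqVneq (f t) 0.
  have [[u /fl //]|[[u [s [ts ls]]]|ts]] := low_cover ut; first exact: H ts ls.
  by rewrite perm_sym in ts; rewrite (f2 _ _ ts) fs0 scaler0.
suff up : forall a s u, rk s = a -> low s u -> f (u :: s) = 0.
  apply: funext => t; apply: cov => u s ts ls.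
  by rewrite perm_sym in ts; rewrite (f2 _ _ ts) (up _ _ _ erefl ls) scaler0.
move=> a; elim/(well_founded_ind wfA): a => a IH s u sa ls.
have us : u \in ext s by apply/extP; split; case: (low_uni ls).
have := congr1 (fun F => F s) df; rewrite /dd (bigD1_seq u) ?ext_uniq //=.
rewrite big_seq_cond big1 ?addr0 // => v /andP[_ /eqP vu]; apply: cov => u' s' P ls'.
rewrite perm_sym in P; rewrite (f2 _ _ P) (IH (rk s') _ s' u') ?scaler0 //.
by rewrite -sa; rewrite perm_sym in P; apply: rk_dec ls vu P ls'.
Qed.

(** Cells of degree 0 have the maximal size N, so none of them can be the lower member of a pair. *)
Lemma morse_H0 f : alt N 0 f -> dd f = (fun _ => 0) -> f s0 = 0 -> f = fun _ => 0.
Proof.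
move=> af df f0; apply: (morse_zero af df _ f0) => s u /low_uni[/uni_size us _].
apply/eqP; apply: contraT => /(proj1 af)[_]; move: us => /=; lia.
Qed.

Definition is_up t u := u \in t /\ low (rem u t) u.
Definition upo t : option (line m) :=
  match excluded_middle_informative (exists u, is_up t u) with
  | left H => Some (projT1 (constructive_indefinite_description _ H))
  | right _ => None
  end.

Lemma rem_permE t t' u : perm_eq t t' -> perm_eq (rem u t) (rem u t').
Proof.
move=> tt; have [ut|nut] := boolP (u \in t); last by rewrite !rem_id // -?(perm_mem tt).
have ut' : u \in t' by rewrite -(perm_mem tt).
rewrite -(perm_cons u); apply: perm_trans (perm_to_rem ut').
by rewrite perm_sym; apply: perm_trans (perm_to_rem ut); rewrite perm_sym.
Qed.

Lemma upo_eq t u : is_up t u -> upo t = Some u.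
Proof.
move=> H; rewrite /upo; case: excluded_middle_informative => [E|[]]; last by exists u.
case: constructive_indefinite_description => v [vt lv] /=; congr Some.
case: H => ut lu; apply: up_fun lv lu.
by apply: perm_trans (perm_to_rem ut); rewrite perm_sym; apply: perm_to_rem.
Qed.

Lemma upoP t u : upo t = Some u -> is_up t u.
Proof.
rewrite /upo; case: excluded_middle_informative => [E|//].
by case: constructive_indefinite_description => v H /= [<-].
Qed.

Lemma is_up_perm t t' u : perm_eq t t' -> is_up t u -> is_up t' u.
Proof.
move=> tt [ut lu]; split; first by rewrite -(perm_mem tt).
exact: low_perm (rem_permE u tt) lu.
Qed.

Lemma upo_perm t t' : perm_eq t t' -> upo t = upo t'.
Proof.
move=> tt; case E : (upo t) => [u|]; first by rewrite (upo_eq (is_up_perm tt (upoP E))).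
case E' : (upo t') => [u|] //.
by rewrite perm_sym in tt; rewrite (upo_eq (is_up_perm tt (upoP E'))) in E.
Qed.

Section Solve.
Variables (p : nat) (f : seq (line m) -> V).
Hypothesis af : alt N p.+1 f.
Hypothesis df : dd f = fun _ => 0.

(** The cochain supported on upper cells with the values F at their partners. Only the sorted list
    of a partner carries a value; the sign accounts for every other ordering. *)
Definition lift_val (F : seq (line m) -> V) t : V :=
  match upo t with
  | Some u => if (size t + p == N)%N
     then (eps t * eps (u :: srt (rem u t))) *: F (srt (rem u t)) else 0
  | None => 0
  end.

(* Solving [dd F = f] on the pairs by descent: all terms of [dd F s] but the one of the partner have smaller rank. *)
Definition solve_step s (rec : forall s', ltA (rk s') (rk s) -> V) : V :=
  f s - \sum_(v <- ext s | asb (~ low s v)) lift_val (fun s' =>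
     match excluded_middle_informative (ltA (rk s') (rk s)) with
     | left h => rec s' h
     | right _ => 0
     end) (v :: s).

Definition solve : seq (line m) -> V :=
  Fix (wf_inverse_image _ _ _ rk wfA) (fun _ => V) solve_step.

Lemma solveE s u : low s u ->
  solve s = f s - \sum_(v <- ext s | v != u) lift_val solve (v :: s).
Proof.
move=> ls; rewrite /solve Fix_eq; last first.
  move=> x F G FG; rewrite /solve_step; congr (_ - _); apply: eq_bigr => v _.
  rewrite /lift_val; case: upo => // w; case: ifP => // _; congr (_ *: _).
  by case: excluded_middle_informative.
rewrite /solve_step -/solve; congr (_ - _).
have E v : asb (~ low s v) = (v != u).
  apply/asbP/idP => [H|/eqP H /(low_fun ls) E]; last by rewrite E in H.
  by apply/eqP => E; rewrite E in H.
rewrite (eq_bigl _ _ E); apply: eq_bigr => v /eqP vu.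
rewrite /lift_val; case Ew : upo => [w|] //; case: ifP => // _; congr (_ *: _).
case: excluded_middle_informative => // -[].
have [wv lw] := upoP Ew.
have P : perm_eq (v :: s) (w :: srt (rem w (v :: s))).
  by apply: perm_trans (perm_to_rem wv) _; rewrite perm_cons perm_srt.
by apply: rk_dec ls vu P _; apply: low_perm lw; apply: perm_srt.
Qed.

Lemma alt_lift : alt N p (lift_val solve).
Proof.
split=> [t|s t st].
  rewrite /lift_val; case E : upo => [u|]; last by rewrite eqxx.
  case: ifP => [/eqP sz _|]; last by rewrite eqxx.
  split => //.
  have [ut lu] := upoP E; apply: uni_perm (proj1 (low_uni lu)).
  by rewrite perm_sym; apply: perm_to_rem.
rewrite /lift_val (upo_perm st); case: upo => [u|]; last by rewrite scaler0.
rewrite (perm_size st) (srt_perm (rem_permE u st)).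
case: ifP => _; last by rewrite scaler0.
by rewrite scalerA -!mulrA [eps t * (eps s * _)]mulrCA (mulrA (eps s)) epsK mul1r.
Qed.

(** The defect is a cocycle. It vanishes at lower cells by the recursive equation of [solve], and at
    [s0] because its degree is positive, so [morse_zero] applies to it. *)
Lemma solve_dd : dd (lift_val solve) = f.
Proof.
have ae : alt N p.+1 (fun s => dd (lift_val solve) s - f s).
  by apply: altB af; apply: alt_dd alt_lift.
suff E : (fun s => dd (lift_val solve) s - f s) = fun _ => 0.
  apply: funext => s; have /eqP := congr1 (fun F => F s) E.
  by rewrite subr_eq0 => /eqP.
apply: (morse_zero ae).
- apply: funext => s; rewrite /dd.
  rewrite (eq_bigr (fun v => dd (lift_val solve) (v :: s) + (-1) *: f (v :: s))); last first.
    by move=> v _; rewrite scaleN1r.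
  rewrite big_split /= -scaler_sumr -[X in X + _]/(dd (dd (lift_val solve)) s).
  by rewrite -[X in _ *: X]/(dd f s) (dd_dd alt_lift) df scaler0 addr0.
- suff sorted s u : low s u -> srt s = s -> dd (lift_val solve) s - f s = 0.
    move=> s u ls.
    have P : perm_eq (srt s) s by rewrite perm_sym perm_srt.
    rewrite (proj2 ae _ _ P) (sorted _ u) ?scaler0 //.
      by apply: low_perm ls; apply: perm_srt.
    exact: srt_perm.
  move=> ls ss; have [sz|sz] := eqVneq (size s + p.+1)%N N; last first.
    apply/eqP; apply: contraT => /(proj1 ae)[_ E]; by rewrite E eqxx in sz.
  have us : u \in ext s by apply/extP; split; case: (low_uni ls).
  rewrite {1}/dd (bigD1_seq u) ?ext_uniq //=.
  have -> : lift_val solve (u :: s) = solve s.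
    have iu : is_up (u :: s) u by split; rewrite /= ?mem_head // eqxx.
    rewrite /lift_val (upo_eq iu) /= addSnnS sz !eqxx ss.
    by rewrite epsK scale1r.
  by rewrite (solveE ls) subrK subrr.
apply/eqP; apply: contraT => /(proj1 ae)[_]; rewrite s0_size; lia.
Qed.
End Solve.

Lemma morse_exact p f : alt N p.+1 f -> dd f = (fun _ => 0) ->
  exists f', alt N p f' /\ dd f' = f.
Proof. by move=> af df; exists (lift_val p (solve p f)); split; [apply: alt_lift|apply: solve_dd]. Qed.

End Morse.

(** * Minimal bases *)

Section LexWeights.
Local Open Scope ring_scope.
Variable m : nat.
Implicit Types (v w : 'cV[int]_m) (l : line m) (b : 'I_m -> line m) (s : seq (line m)).

Lemma lposD v w : lpos v -> lpos w -> lpos (v + w).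
Proof.
move=> /lposP[i vi Hi] /lposP[j wj Hj]; apply/lposP.
case: (ltngtP i j) => [ij|ji|/val_inj E].
- exists i => [|k ki]; first by rewrite mxE (Hj _ ij) addr0.
  by rewrite mxE Hi // Hj ?addr0 //; apply: ltn_trans ij.
- exists j => [|k kj]; first by rewrite mxE (Hi _ ji) add0r.
  by rewrite mxE Hj // Hi ?addr0 //; apply: ltn_trans ji.
exists i => [|k ki]; first by rewrite mxE addr_gt0 // E.
by rewrite mxE Hi // Hj ?addr0 // -E.
Qed.

Lemma lpos0 : lpos (0 : 'cV[int]_m) = false.
Proof. by apply/negbTE/negP => /lpos_neq0; rewrite eqxx. Qed.

Definition ltv v w : bool := lpos (w - v).

Lemma ltvv v : ltv v v = false. Proof. by rewrite /ltv subrr lpos0. Qed.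
Lemma ltv_trans : transitive ltv.
Proof. by move=> w v u vw wu; rewrite /ltv -(subrKA w) lposD. Qed.
Lemma ltvNge v w : v != w -> ltv w v = ~~ ltv v w.
Proof. by move=> vw; rewrite /ltv -lposN ?opprB // subr_eq0 eq_sym. Qed.
Lemma ltv_asym v w : ltv v w -> ltv w v = false.
Proof. by move=> H; apply/negbTE/negP => K; have := ltv_trans H K; rewrite ltvv. Qed.

Lemma lpos_sum (I : eqType) (r : seq I) (f : I -> 'cV[int]_m) :
  (forall i, i \in r -> f i = 0 \/ lpos (f i)) ->
  (forall i, i \in r -> f i = 0) \/ lpos (\sum_(i <- r) f i).
Proof.
elim: r => [|i r IH] H; first by left.
have [|z|p] := IH; first by move=> j jr; apply: H; rewrite inE jr orbT.
  have S : \sum_(j <- r) f j = 0 by rewrite big_seq big1.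
  rewrite big_cons S addr0; have [E|E] := H i (mem_head _ _); last by right.
  by left=> j; rewrite inE => /orP[/eqP ->|/z].
right; rewrite big_cons; have [->|E] := H i (mem_head _ _); first by rewrite add0r.
exact: lposD.
Qed.

(* The lexicographic order is well founded on vectors with nonnegative entries. *)
Lemma lex_min (P : 'cV[int]_m -> Prop) : (forall v, P v -> forall i, 0 <= v i 0) ->
  (exists v, P v) -> exists2 v, P v & forall w, P w -> ~~ ltv w v.
Proof.
move=> nn [v0 Pv0].
(* Coordinates are minimised one after the other: at stage k, all smaller vectors satisfying P share
   the first k coordinates of the current one. *)
suff H : forall k, (k <= m)%N -> exists2 v, P v & forall w, P w -> ltv w v ->
    forall i : 'I_m, (i < k)%N -> w i 0 = v i 0.
  have [v Pv Hv] := H m (leqnn m); exists v => // w Pw; apply/negP => lt.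
  have E : w = v by apply/matrixP => i j; rewrite (ord1 j); apply: Hv.
  by rewrite E ltvv in lt.
elim=> [|k IH] km; first by exists v0.
have [v Pv Hv] := IH (ltnW km).
pose ik := Ordinal km.
have [n] : exists n : nat, exists2 w, P w & (w = v \/ ltv w v) /\ w ik 0 = n%:Z.
  by exists (absz (v ik 0)), v => //; split; [left|have := nn v Pv ik; lia].
elim/ltn_ind: n => n IHn [u Pu [uv En]].
have tr w : ltv w u -> w = v \/ ltv w v.
  by case: uv => [->|uv] wu; right => //; apply: ltv_trans wu uv.
have [[w [Pw wu neq]]|no] := excluded_middle_informative
   (exists w, [/\ P w, ltv w u & w ik 0 <> u ik 0]).
  apply: (IHn (absz (w ik 0))); last first.
    by exists w => //; split; [apply: tr|have := nn w Pw ik; lia].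
  have pre x : P x -> (x = v \/ ltv x v) -> forall i : 'I_m, (i < k)%N -> x i 0 = v i 0.
    by move=> Px [->|xv] i ik'; [|apply: Hv].
  have [j wj Hj] := lposP _ wu; have := nn w Pw ik.
  have jk : (k <= j)%N.
    rewrite leqNgt; apply/negP => jk; move: wj; rewrite !mxE (pre u) // (pre w) //; last exact: tr.
    by rewrite subrr ltxx.
  have := nn u Pu ik; move: jk; rewrite leq_eqVlt => /orP[/eqP E|kj].
    have Ej : j = ik by apply: val_inj.
    move: wj En; rewrite Ej !mxE; clear; move: (u ik 0) (w ik 0) => x y; lia.
  have := Hj ik kj; rewrite !mxE; move: neq; clear; move: (u ik 0) (w ik 0) => x y; lia.
exists u => // w Pw wu i; rewrite ltnS leq_eqVlt => /orP[/eqP E|ik'].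
  have -> : i = ik by apply: val_inj.
  by have [//|ne] := eqVneq (w ik 0) (u ik 0); case: no; exists w; split => //; apply/eqP.
by have [E|uv'] := uv; [rewrite E; apply: Hv => //; rewrite -E|
   rewrite (Hv _ Pu uv' _ ik'); apply: Hv => //; apply: ltv_trans wu uv'].
Qed.

(** The lexicographic order on all integer vectors has infinite descents, so nonnegativity of the
    smaller vector is made part of the relation. The natural number separates cells with the same
    minimal basis. *)
Definition ltA (a c : 'cV[int]_m * nat) : Prop :=
  (forall i, 0 <= a.1 i 0) /\ (ltv a.1 c.1 \/ (a.1 = c.1 /\ (a.2 < c.2)%N)).

Lemma wf_ltA : well_founded ltA.
Proof.
suff H (a : 'cV[int]_m * nat) : (forall i, 0 <= a.1 i 0) -> Acc ltA a.
  by move=> a; constructor => c [nn _]; apply: H.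
move=> nna; case: (excluded_middle_informative (Acc ltA a)) => [acc|nacc]; first exact: acc.
have [||v [n [nn nv]] Hv] := @lex_min (fun v : 'cV[int]_m => exists n : nat, (forall i, 0 <= v i 0) /\ ~ Acc ltA (v, n)).
- by move=> v [n []].
- by exists a.1, a.2; rewrite -surjective_pairing.
case: nv; elim/ltn_ind: n => n IH; constructor => -[w k] [nnw /= [wv|[-> kn]]]; last exact: IH.
case: (excluded_middle_informative (Acc ltA (w, k))) => [acc|nacc']; first exact: acc.
by have := Hv w (ex_intro _ k (conj nnw nacc')); rewrite wv.
Qed.

Definition sqv v : 'cV[int]_m := \col_i (v i 0) ^+ 2.
(* Weights are compared lexicographically, by [ltv]. *)
Definition wt l := sqv (val l).

Lemma sqvN v : sqv (- v) = sqv v.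
Proof. by apply/matrixP => i j; rewrite !mxE sqrrN. Qed.
Lemma sqv_sign v (c : bool) : sqv ((-1) ^+ c *: v) = sqv v.
Proof. by case: c; rewrite ?expr1 ?expr0 ?scaleN1r ?scale1r ?sqvN. Qed.

(** Entries with equal squares agree up to sign, hence modulo 2. This congruence is what excludes
    ties between weights. *)
Lemma sqv_eq v w : sqv v = sqv w -> exists z, v - w = z *+ 2.
Proof.
move=> E; exists (\col_i (if v i 0 == w i 0 then 0 else v i 0)).
apply/matrixP => i j; rewrite (ord1 j) mulr2n !mxE.
have := congr1 (fun u : 'cV[int]_m => u i 0) E; rewrite !mxE => /eqP.
rewrite eqf_sqr; case: eqVneq => [->|ne] /=; first by rewrite subrr addr0.
by clear; move: (v i 0) (w i 0) => x y /eqP; lia.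
Qed.

Definition sumwt b := \sum_j wt (b j).

Lemma sumwt_ge0 b i : 0 <= sumwt b i 0.
Proof. by rewrite summxE sumr_ge0 // => j _; rewrite mxE sqr_ge0. Qed.

Lemma sumwt_perm b (q : 'S_m) : sumwt (fun j => b (q j)) = sumwt b.
Proof. by rewrite /sumwt [RHS](reindex_inj (@perm_inj _ q)). Qed.

Definition basis_in b s := (forall i, b i \in s) /\ `|\det (lmx b)| = 1.

Lemma basis_unit b s : basis_in b s -> lmx b \in unitmx.
Proof. by move=> [_ d]; rewrite unitmxE unit_int d. Qed.

(** Only exchanges of one member are tested; [minbasis_lt] shows that such a local minimum is
    global, as for matroids. *)
Definition minbasis b s := basis_in b s /\
  forall v : line m, v \in s -> forall j, \det (lmx (upd b j v)) != 0 -> ~~ ltv (wt v) (wt (b j)).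

Lemma coord_self b s (i j : 'I_m) : basis_in b s -> (invmx (lmx b) *m val (b i)) j 0 = (j == i)%:R.
Proof.
move=> bs; have -> : val (b i) = lmx b *m delta_mx i 0.
  by rewrite -colE; apply/matrixP => k c; rewrite !mxE (ord1 c).
by rewrite mulKmx ?(basis_unit bs) // mxE andbT.
Qed.

Lemma coordK b s v : basis_in b s -> v = lmx b *m (invmx (lmx b) *m v).
Proof. by move=> /basis_unit u; rewrite mulKVmx. Qed.

Lemma coordB (A : 'M[int]_m) v w i : (A *m (v - w)) i 0 = (A *m v) i 0 - (A *m w) i 0.
Proof. by rewrite mulmxBr [LHS]mxE [X in _ + X]mxE. Qed.
Lemma coord_double (A : 'M[int]_m) v i : (A *m (v *+ 2)) i 0 = (A *m v) i 0 *+ 2.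
Proof. by rewrite mulr2n mulmxDr [LHS]mxE. Qed.

Lemma wt_basis_inj b s i j : basis_in b s -> wt (b i) = wt (b j) -> i = j.
Proof.
move=> bs /sqv_eq[z E]; have := congr1 (fun u => (invmx (lmx b) *m u) i 0) E.
rewrite coordB coord_double !(coord_self _ _ bs) eqxx; case: eqP => //= _.
set x := (_ *m _) _ _; lia.
Qed.

(** Equal weights make v and b_j congruent modulo 2. The coordinates of v are at most 1 in absolute
    value, so the even ones, all but the j-th, are 0. *)
Lemma no_tie b s (v : line m) j : uni s -> basis_in b s -> v \in s -> \det (lmx (upd b j v)) != 0 ->
  wt v = wt (b j) -> v = b j.
Proof.
move=> us bs vs d /sqv_eq[z E]; have [bin db] := bs.
pose c := invmx (lmx b) *m val v; pose y := invmx (lmx b) *m z.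
have Ec k : c k 0 = (k == j)%:R + y k 0 *+ 2.
  by rewrite -(coord_self j k bs) -coord_double -E coordB addrC subrK.
have Hc k : `|c k 0| <= 1 by apply: uni_coord vs k.
have cj : c j 0 = 1 \/ c j 0 = -1.
  have : `|c j 0| != 0 by rewrite coord_upd // normr_eq0.
  have := Hc j; lia.
have ck k : k != j -> c k 0 = 0.
  by move=> kj; have := Ec k; rewrite (negbTE kj); have := Hc k; lia.
have Ev (x : int) : c j 0 = x -> val v = x *: val (b j).
  move=> cjx; rewrite [LHS](coordK _ bs) -/c.
  have -> : c = x *: delta_mx j 0.
    apply/matrixP => k q; rewrite (ord1 q) [RHS]mxE [delta_mx _ _ _ _]mxE andbT.
    case: eqP => [->|/eqP /ck ->]; first by rewrite mulr1.
    by rewrite mulr0.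
  by rewrite -scalemxAr -colE; congr (_ *: _); apply/matrixP => k q; rewrite !mxE (ord1 q).
by case: cj => /Ev E'; [apply: (@line_inj_sign _ _ _ false)|apply: (@line_inj_sign _ _ _ true)].
Qed.

(* A nonzero determinant has a nonzero term: every member of [b'] can be charged to a member of its support in [b]. *)
Lemma minbasis_lt b b' s : uni s -> minbasis b s -> basis_in b' s ->
  ltv (sumwt b) (sumwt b') \/ exists q : 'S_m, forall j, b' j = b (q j).
Proof.
move=> us [bs lm] bs'.
have : \det (invmx (lmx b) *m lmx b') != 0.
  have : invmx (lmx b) *m lmx b' \in unitmx.
    by rewrite unitmx_mul unitmx_inv (basis_unit bs) (basis_unit bs').
  by rewrite unitmxE; apply: contraTneq => ->; rewrite unitr0.
rewrite -det_tr; set M := (_ *m _)^T => dM.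
have /existsP[q Hq] : [exists q : 'S_m, \prod_i M i (q i) != 0].
  apply: contraNT dM => /existsPn H; rewrite /determinant big1 // => q _.
  by have := H q; rewrite negbK => /eqP ->; rewrite mulr0.
have Dq j : \det (lmx (upd b (q j) (b' j))) != 0.
  rewrite -normr_eq0 -coord_upd ?(proj2 bs) // normr_eq0.
  move/prodf_neq0: Hq => /(_ j isT); rewrite mxE; congr (_ != 0).
  by rewrite !mxE; apply: eq_bigr => k _; rewrite !mxE.
have Hle j : wt (b' j) - wt (b (q j)) = 0 \/ lpos (wt (b' j) - wt (b (q j))).
  have [E|ne] := eqVneq (wt (b' j)) (wt (b (q j))); first by left; rewrite E subrr.
  have := lm _ (proj1 bs' j) _ (Dq j).
  by right; rewrite -/(ltv _ _) ltvNge.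
have [||] := @lpos_sum _ (index_enum 'I_m) (fun j => wt (b' j) - wt (b (q j))).
- by move=> j _; apply: Hle.
- move=> H; right; exists q => j; apply: (no_tie us bs (proj1 bs' j) (Dq j)).
  by have /eqP := H j (mem_index_enum j); rewrite subr_eq0 => /eqP.
by rewrite sumrB -[X in lpos (_ - X)]/(sumwt (fun j => b (q j))) sumwt_perm => H; left.
Qed.

Lemma sumwt_upd b j (v : line m) : sumwt (upd b j v) = sumwt b - wt (b j) + wt v.
Proof.
rewrite /sumwt (bigD1 j) //= [in RHS](bigD1 j) //= /upd eqxx [in RHS](addrC (wt (b j))) addrK addrC.
by congr (_ + _); apply: eq_bigr => i /negbTE ->.
Qed.

(** A basis of least total weight will do: in a unimodular list an exchange with nonzero determinant
    gives a basis again, and an improving one would lower the total. *)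
Lemma minbasis_exists s : uni s -> exists b, minbasis b s.
Proof.
move=> us; have [_ [b0 b0s d0] H0] := us.
have [||w [b bs Eb] Hw] := @lex_min (fun w => exists2 b, basis_in b s & sumwt b = w).
- by move=> v [b _ <-] i; apply: sumwt_ge0.
- by exists (sumwt b0), b0.
exists b; split => // v vs j dj; apply/negP => lt.
have : ~~ ltv (sumwt (upd b j v)) w.
  apply: Hw; exists (upd b j v) => //.
  have U i : upd b j v i \in s by rewrite /upd; case: ifP => // _; apply: (proj1 bs).
  split => //; have := H0 _ U; move: dj; set x := \det _; lia.
by rewrite -Eb sumwt_upd /ltv opprD addrA opprB addrCA subrr addr0 -/(ltv _ _) lt.
Qed.

Definition sortedb b := sorted (fun l l' => ltv (wt l) (wt l')) (codom b).

Lemma sortedbP b (i j : 'I_m) : sortedb b -> (i < j)%N -> ltv (wt (b i)) (wt (b j)).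
Proof.
move=> sb ij; have tr : transitive (fun l l' : line m => ltv (wt l) (wt l')).
  by move=> x y z; apply: ltv_trans.
have E (k : 'I_m) : nth (b i) (codom b) k = b k.
  by rewrite codomE (nth_map i) ?size_enum_ord // nth_ord_enum.
have := sorted_ltn_nth tr (b i) sb; move/(_ i j); rewrite !inE size_codom card_ord !E.
by rewrite !ltn_ord => /(_ isT isT ij).
Qed.

Definition good b s := minbasis b s /\ sortedb b.

Lemma minbasis_perm b s (q : 'S_m) : minbasis b s -> minbasis (fun j => b (q j)) s.
Proof.
move=> [[bs d] lm].
have D c : `|\det (lmx (fun j => c (q j)))| = `|\det (lmx c)|.
  have -> : lmx (fun j => c (q j)) = col_perm q (lmx c) by apply/matrixP => i j; rewrite !mxE.
  by rewrite col_permE det_mulmx det_perm normrM normrX normrN1 expr1n mulr1.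
split; first by split; [move=> i; apply: bs|rewrite D].
move=> v vs j dj; apply: lm => //; move: dj; rewrite -!(normr_eq0 (\det _)) -(D (upd b (q j) v)).
suff -> : (fun i => upd b (q j) v (q i)) = upd (fun i => b (q i)) j v by [].
by apply: funext => i; rewrite /upd (inj_eq perm_inj).
Qed.

Lemma good_exists s : uni s -> exists b, good b s.
Proof.
move=> us; have [b mb] := minbasis_exists us.
pose le l l' := (wt l == wt l') || ltv (wt l) (wt l').
have le_tot : total le.
  move=> x y; rewrite /le eq_sym; case: eqVneq => //= ne.
  by rewrite (ltvNge ne); case: ltv.
have P : perm_eq (sort le (codom b)) [tuple b i | i < m].
  by rewrite perm_sort /= codomE.
have /tuple_permP[q Eq] := P.
exists (fun j => b (q j)); split; first exact: minbasis_perm.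
have E : codom (fun j => b (q j)) = sort le (codom b).
  by rewrite Eq /= codomE; apply: eq_map => i; rewrite tnth_mktuple.
have st := sort_sorted le_tot (codom b); rewrite -E in st.
have [bs _] := minbasis_perm q mb.
rewrite /sortedb; move: st; rewrite !codomE.
have : uniq (enum 'I_m) by apply: enum_uniq.
elim: (enum 'I_m) => //= i [|j r] IH //= /andP[]; rewrite inE negb_or => /andP[ij _] ur /andP[le1 pr].
have := IH ur pr; rewrite /= => ->; rewrite andbT; case/orP: le1 => // /eqP /(wt_basis_inj bs) E'.
by rewrite E' eqxx in ij.
Qed.

Lemma sortedb_eq b b' (q : 'S_m) : sortedb b -> sortedb b' -> (forall j, b' j = b (q j)) -> b' = b.
Proof.
move=> sb sb' E; suff : codom b' = codom b.
  rewrite !codomE => /eq_in_map H; apply: funext => j; apply: H.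
  by rewrite mem_enum.
apply: (irr_sorted_eq _ _ sb' sb).
- by move=> x y z; apply: ltv_trans.
- by move=> x; apply: ltvv.
move=> x; apply/codomP/codomP => [[j ->]|[j ->]]; first by exists (q j).
by exists (q^-1 j)%g; rewrite E permKV.
Qed.

Lemma good_lt b b' s : uni s -> good b s -> basis_in b' s -> sortedb b' ->
  b' = b \/ ltv (sumwt b) (sumwt b').
Proof.
move=> us [mb sb] bs' sb'; have [H|[q Hq]] := minbasis_lt us mb bs'; first by right.
by left; apply: sortedb_eq Hq.
Qed.

Lemma good_uniq b b' s : uni s -> good b s -> good b' s -> b = b'.
Proof.
move=> us g g'; have [//|H] := good_lt us g (proj1 (proj1 g')) (proj2 g').
have [//|H'] := good_lt us g' (proj1 (proj1 g)) (proj2 g).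
by rewrite (ltv_asym H) in H'.
Qed.

Lemma good_perm b s t : perm_eq s t -> good b s -> good b t.
Proof.
move=> st [[[bs d] lm] sb]; split => //; split; first by split => // i; rewrite -(perm_mem st).
by move=> v; rewrite -(perm_mem st); apply: lm.
Qed.

End LexWeights.

(** * Integer codes of lines, and determinants that compute *)

Section Lists.
Local Open Scope ring_scope.

Fixpoint sublists (T : Type) (s : seq T) : seq (seq T) :=
  if s is x :: s' then let r := sublists s' in r ++ map (cons x) r else [:: [::]].

Lemma filter_sublists (T : eqType) (P : pred T) s : filter P s \in sublists s.
Proof.
elim: s => //= x s IH; rewrite mem_cat; case: (P x); last by rewrite IH.
by rewrite map_f ?orbT.
Qed.

Fixpoint lists_of (T : Type) (n : nat) (L : seq T) : seq (seq T) :=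
  if n is n'.+1 then [seq x :: t | x <- L, t <- lists_of n' L] else [:: [::]].

Lemma lists_ofP (T : eqType) n (L : seq T) t :
  reflect (size t = n /\ {subset t <= L}) (t \in lists_of n L).
Proof.
elim: n t => [|n IH] t /=.
  rewrite inE; apply: (iffP eqP) => [->|[/size0nil -> //]]; by split.
apply: (iffP allpairsP) => [[[x u] /= [xL /IH[<- uL] ->]]|[]].
  by split=> // y; rewrite inE => /orP[/eqP ->|/uL].
case: t => //= x u [su] H; exists (x, u); split => //=; first by apply: H; rewrite mem_head.
by apply/IH; split => // y yu; apply: H; rewrite inE yu orbT.
Qed.

Fixpoint lposl (c : seq int) : bool :=
  if c is x :: c' then (0 < x) || (x == 0) && lposl c' else false.

Lemma lposlP c : reflect (exists2 i, (i < size c)%N & 0 < c`_i /\ forall j, (j < i)%N -> c`_j = 0)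
  (lposl c).
Proof.
elim: c => [|x c IH]; first by constructor => -[].
have -> : lposl (x :: c) = (0 < x) || ((x == 0) && lposl c) by [].
rewrite [size _]/=; apply: (iffP orP) => [[x0|/andP[/eqP -> /IH[i ic [ci H]]]]|[[|i] ic /= [ci H]]].
- by exists 0%N.
- by exists i.+1 => //; split => // -[|j] //= /H.
- by left.
right; rewrite [x](H 0%N) // eqxx /=; apply/IH; exists i => //; split => // j ji.
exact: (H j.+1).
Qed.

Definition skip (T : Type) j (r : seq T) := take j r ++ drop j.+1 r.

Lemma nth_skip (T : Type) (x : T) j r k : (j < size r)%N -> nth x (skip j r) k = nth x r (bump j k).
Proof.
move=> jr; rewrite nth_cat size_take jr /bump (leqNgt j k); case: ltnP => kj /=.
  by rewrite nth_take.
by rewrite nth_drop; congr nth; lia.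
Qed.

Fixpoint detl (n : nat) (M : seq (seq int)) : int :=
  if n is n'.+1 then
    \sum_(j <- iota 0 n) (-1) ^+ j * (nth [::] M 0)`_j * detl n' (map (skip j) (behead M))
  else 1.

(** The expansion of [detl] written with [foldr] and a test of parity, because big operators are
    locked and do not evaluate. *)
Fixpoint detr (n : nat) (M : seq (seq int)) : int :=
  if n is n'.+1 then
    foldr (fun j acc => (if odd j then - (nth [::] M 0)`_j else (nth [::] M 0)`_j)
             * detr n' (map (skip j) (behead M)) + acc) 0 (iota 0 n)
  else 1.

Lemma detrE n M : detr n M = detl n M.
Proof.
elim: n M => [//|n IH] M.
rewrite -[LHS]/(foldr (fun j acc => (if odd j then - (nth [::] M 0)`_j else (nth [::] M 0)`_j) *
    detr n (map (skip j) (behead M)) + acc) 0 (iota 0 n.+1)).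
rewrite -[RHS]/(\sum_(j <- iota 0 n.+1) (-1) ^+ j * (nth [::] M 0)`_j * detl n (map (skip j) (behead M))).
elim: (iota 0 n.+1) => [|j r IHr]; first by rewrite big_nil.
rewrite big_cons -IHr [foldr _ _ (j :: r)]/= -IH -signr_odd; congr (_ * _ + _).
by case: odd; rewrite ?expr1 ?mulN1r ?expr0 ?mul1r.
Qed.

Lemma det_list n (M : seq (seq int)) : size M = n -> (forall i, (i < n)%N -> size (nth [::] M i) = n) ->
  \det (\matrix_(i < n, j < n) (nth [::] M i)`_j) = detr n M.
Proof.
rewrite detrE; elim: n M => [|n IH] M sM sr; first by rewrite det_mx00.
rewrite (expand_det_row _ ord0) /= -[0%N :: iota 1 n]/(iota 0 n.+1) -[n.+1 in RHS]subn0 -/(index_iota _ _) big_mkord.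
apply: eq_bigr => j _; rewrite mxE mulrC /cofactor add0n [RHS]mulrAC; congr (_ * _ * _).
case: M sM sr => // r M [sM] sr.
have sk i : (i < n)%N -> nth [::] (map (skip j) M) i = skip j (nth [::] M i).
  by move=> ip; rewrite (nth_map [::]) ?sM.
rewrite /= -IH ?size_map // => [|i ip]; last first.
  rewrite sk // size_cat size_take size_drop (sr i.+1) // ltn_ord.
  have := ltn_ord j; lia.
congr (\det _); apply/matrixP => a b; rewrite !mxE sk ?ltn_ord // nth_skip //=.
by rewrite (sr a.+1) // ltnS.
Qed.

End Lists.

(* Nested conditionals, so that evaluation by value stops at the first hit. *)
Fixpoint search (T : Type) (a b : pred T) (s : seq T) : bool :=
  if s is x :: s' then if (if a x then b x else false) then true else search a b s' else false.

Lemma searchE (T : Type) (a b : pred T) s : search a b s = has (fun x => a x && b x) s.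
Proof. by elim: s => //= x s ->; case: (a x); case: (b x). Qed.

Section Codes.
Local Open Scope ring_scope.
Variable k : nat.
Notation m := k.+1.
Implicit Types (c : seq int) (l : line m) (b : 'I_m -> line m) (S : seq (line m)).

Definition colof c : 'cV[int]_m := \col_i c`_i.
Definition lineof c : line m := toline (lstd ord0) (colof c).
Definition codeok c : bool := (size c == m) && lposl c.

Lemma val_lineof c : codeok c -> val (lineof c) = colof c.
Proof.
move=> /andP[/eqP sc /lposlP[i ic [ci H]]].
have P : lpos (colof c).
  rewrite sc in ic; apply/lposP; exists (Ordinal ic); first by rewrite mxE.
  by move=> j ji; rewrite mxE H.
by rewrite val_toline ?lnormK // lpos_neq0.
Qed.

Definition codeof l : seq int := [seq (val l) i 0 | i <- enum 'I_m].

Lemma nth_codeof l (i : 'I_m) : (codeof l)`_i = (val l) i 0.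
Proof. by rewrite (nth_map i) ?size_enum_ord // nth_ord_enum. Qed.

Lemma codeof_ok l : codeok (codeof l).
Proof.
rewrite /codeok size_map size_enum_ord eqxx /=.
have /lposP[i li H] : lpos (val l) by exact: valP.
apply/lposlP; exists i; first by rewrite size_map size_enum_ord.
rewrite nth_codeof; split => // j ji.
by rewrite (nth_codeof l (Ordinal (ltn_trans ji (ltn_ord i)))) H.
Qed.

Lemma codeofK l : lineof (codeof l) = l.
Proof.
apply: val_inj; rewrite val_lineof ?codeof_ok //.
by apply/matrixP => i j; rewrite (ord1 j) mxE nth_codeof.
Qed.

Lemma lineof_inj c c' : codeok c -> codeok c' -> lineof c = lineof c' -> c = c'.
Proof.
move=> ok ok' /(congr1 val); rewrite !val_lineof // => E.
case/andP: ok => /eqP s _; case/andP: ok' => /eqP s' _.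
apply: (@eq_from_nth _ 0); rewrite s // => i im.
by have := congr1 (fun u : 'cV[int]_m => u (Ordinal im) 0) E; rewrite !mxE.
Qed.

Lemma det_codes (b : 'I_m -> line m) (t : seq (seq int)) : size t = m ->
  (forall i : 'I_m, codeok (nth [::] t i) /\ b i = lineof (nth [::] t i)) ->
  \det (lmx b) = detr m t.
Proof.
move=> st H; rewrite -det_tr -det_list //; last first.
  by move=> i im; have [/andP[/eqP]] := H (Ordinal im).
congr (\det _); apply/matrixP => i j; rewrite !mxE.
by have [ok ->] := H i; rewrite val_lineof // mxE.
Qed.

Definition stdc : seq (seq int) := [seq [seq (i == j)%:R | j <- iota 0 m] | i <- iota 0 m].

Lemma size_stdc : size stdc = m. Proof. by rewrite size_map size_iota. Qed.

Lemma nth_stdc (i : 'I_m) : nth [::] stdc i = [seq (nat_of_ord i == j)%:R | j <- iota 0 m].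
Proof. by rewrite (nth_map 0%N) ?size_iota // nth_iota. Qed.

Lemma nth_stdc2 (i j : 'I_m) : (nth [::] stdc i)`_j = (i == j)%:R.
Proof. by rewrite nth_stdc (nth_map 0%N) ?size_iota // nth_iota. Qed.

Lemma stdc_std (i : 'I_m) : nth [::] stdc i = codeof (lstd i).
Proof.
apply: (@eq_from_nth _ 0); first by rewrite nth_stdc size_map size_iota size_map size_enum_ord.
move=> j; rewrite {1}nth_stdc size_map size_iota => jm.
rewrite (nth_stdc2 i (Ordinal jm)) (nth_codeof _ (Ordinal jm)).
by rewrite /= mxE andbT eq_sym.
Qed.

Lemma lineof_stdc (i : 'I_m) : lineof (nth [::] stdc i) = lstd i.
Proof. by rewrite stdc_std codeofK. Qed.

Lemma stdc_ok c : c \in stdc -> codeok c.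
Proof.
move=> /(nthP [::])[i]; rewrite size_stdc => im <-.
by rewrite (stdc_std (Ordinal im)) codeof_ok.
Qed.

Definition codes_ok (L : seq (seq int)) : bool := all codeok L && uniq L.

Definition uniL (L : seq (seq int)) : bool := ~~ search (fun t => 1 < absz (detr m t))%N xpredT (lists_of m L).

Lemma uniLE L : uniL L = all (fun t => absz (detr m t) <= 1)%N (lists_of m L).
Proof.
rewrite /uniL searchE -all_predC; apply: eq_all => t /=.
by rewrite andbT -leqNgt.
Qed.

Lemma uniL_P L : codes_ok L -> {subset stdc <= L} -> uni (map lineof L) <-> uniL L.
Proof.
move=> /andP[/allP ok uL] sub; rewrite uniLE.
have fam b : (forall i, b i \in map lineof L) ->
    exists t, [/\ t \in lists_of m L & \det (lmx b) = detr m t].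
  move=> bL; have F i : exists c, c \in L /\ b i = lineof c by have /mapP[c cL ->] := bL i; exists c.
  have /fin_all_exists[f Hf] := F.
  pose t := [seq f i | i <- enum 'I_m].
  have nt i : nth [::] t (nat_of_ord i) = f i by rewrite (nth_map i) ?size_enum_ord // nth_ord_enum.
  exists t; split; first apply/lists_ofP; first split.
  - by rewrite size_map size_enum_ord.
  - by move=> c /mapP[i _ ->]; case: (Hf i).
  apply: det_codes => [|i]; first by rewrite size_map size_enum_ord.
  by rewrite nt; have [fL ->] := Hf i; split => //; apply: ok.
split=> [[_ _ H]|/allP H].
  apply/allP => t /lists_ofP[st tL].
  have tn (i : 'I_m) : nth [::] t i \in L by apply: tL; rewrite mem_nth // st.
  have := H (fun i => lineof (nth [::] t i)) (fun i => map_f lineof (tn i)).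
  rewrite (@det_codes _ t st); first lia.
  by move=> i; split => //; apply: ok.
split.
- by rewrite map_inj_in_uniq // => c c' cL c'L; apply: lineof_inj; apply: ok.
- exists (@lstd m).
    by move=> i; rewrite -lineof_stdc map_f // sub // mem_nth // size_stdc.
  have -> : lmx (@lstd m) = 1%:M by apply/matrixP => i j; rewrite !mxE andbT.
  by rewrite det1.
move=> b /fam[t [tL ->]]; have := H t tL; lia.
Qed.

End Codes.

(** * The matching in coordinates of a minimal basis *)

Section Chart.
Local Open Scope ring_scope.
Variable k : nat.
Notation m := k.+1.
Implicit Types (c : seq int) (l v : line m) (b : 'I_m -> line m) (S : seq (line m)) (T D : seq nat).

Lemma sublists_subseq (A : eqType) (s t : seq A) : t \in sublists s -> subseq t s.
Proof.
elim: s t => [|x s IH] t /=; first by rewrite inE => /eqP ->.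
rewrite mem_cat => /orP[/IH H|/mapP[u /IH H ->]]; last by rewrite /= eqxx.
exact: subseq_trans H (subseq_cons _ _).
Qed.

Lemma sublists_filter n T : T \in sublists (iota 0 n) -> T = [seq i <- iota 0 n | i \in T].
Proof. by move=> /sublists_subseq /(subseq_uniqP (iota_uniq 0 n)). Qed.

Variable vs : seq (seq int).
Notation n := (size vs).
Hypothesis vs_ok : codes_ok k (stdc k ++ vs).
Hypothesis vs_cover : all (fun c => lposl c ==> (c \in stdc k ++ vs)) (lists_of m [:: -1; 0; 1]).

(* A unimodular list containing the basis b consists of b and of images under [GLb b] of vectors of [vs]: in the
   coordinates of b the entries are 0 or +-1. [Tb b S] records which ones; those in [Db b] would make b non-minimal. *)
Definition vl (i : nat) : line m := lineof k (nth [::] vs i).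
Definition GLb b : GLZ m := insubd (GL1 m) (lmx b).
Definition vert b i : line m := lact (GLb b) (vl i).
Definition Tb b S : seq nat := [seq i <- iota 0 n | vert b i \in S].
Definition Db b : seq nat :=
  [seq i <- iota 0 n | [exists j : 'I_m, ((nth [::] vs i)`_j != 0) && ltv (wt (vert b i)) (wt (b j))]].
Definition ins (i : nat) T : seq nat := [seq j <- iota 0 n | (j == i) || (j \in T)].
Definition codesT T : seq (seq int) := stdc k ++ map (nth [::] vs) T.
Definition faces : seq (seq nat) := [seq T <- sublists (iota 0 n) | uniL k (codesT T)].

Lemma vs_codeok i : (i < n)%N -> codeok k (nth [::] vs i).
Proof.
by move=> iln; case/andP: vs_ok => /allP H _; apply: H; rewrite mem_cat mem_nth ?orbT.
Qed.

Lemma vl_inj i j : (i < n)%N -> (j < n)%N -> vl i = vl j -> i = j.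
Proof.
move=> iln jln /lineof_inj E; apply/eqP; rewrite -(nth_uniq [::] iln jln).
  by rewrite E ?vs_codeok.
by case/andP: vs_ok => _; rewrite cat_uniq => /and3P[].
Qed.

Lemma vl_std i j : (i < n)%N -> vl i <> lstd j.
Proof.
move=> iln; rewrite -lineof_stdc => /lineof_inj E.
case/andP: vs_ok => _; rewrite cat_uniq => /and3P[_ /hasPn H _].
have jm : nth [::] (stdc k) j \in stdc k by rewrite mem_nth // size_stdc.
have := H (nth [::] vs i) (mem_nth _ iln); rewrite /= E ?jm //; first exact: vs_codeok.
exact: stdc_ok.
Qed.

Lemma line_cover l : (forall i, `|(val l) i 0| <= 1) ->
  (exists j, l = lstd j) \/ exists2 i, (i < n)%N & l = vl i.
Proof.
move=> H; have /allP/(_ (codeof l)) := vs_cover.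
have -> : codeof l \in lists_of m [:: -1; 0; 1].
  apply/lists_ofP; split; first by rewrite size_map size_enum_ord.
  by move=> x /mapP[i _ ->]; rewrite !inE; have := H i; lia.
have /andP[_ ->] := codeof_ok l.
move=> /(_ isT); rewrite mem_cat => /orP[|] /(nthP [::])[i].
  rewrite size_stdc => im E; left; exists (Ordinal im).
  by rewrite -[l]codeofK -E (lineof_stdc (Ordinal im)).
by move=> iln E; right; exists i => //; rewrite /vl E codeofK.
Qed.

Section Basis.
Variables (b : 'I_m -> line m) (db : `|\det (lmx b)| = 1).

Lemma val_GLb : val (GLb b) = lmx b.
Proof. by rewrite val_insubd unitmxE unit_int db. Qed.

Lemma GLb_std j : lact (GLb b) (lstd j) = b j.
Proof.
apply: (@lact_eq _ _ _ _ false); rewrite scale1r val_GLb -colE.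
by apply/matrixP => i q; rewrite !mxE (ord1 q).
Qed.

Lemma vert_inj i j : (i < n)%N -> (j < n)%N -> vert b i = vert b j -> i = j.
Proof. by move=> iln jln /(@lact_inj _ _ _ _); apply: vl_inj. Qed.

Lemma vert_std i j : (i < n)%N -> vert b i <> b j.
Proof. by move=> iln; rewrite -GLb_std => /(@lact_inj _ _ _ _); apply: vl_std. Qed.

Lemma mem_Tb S i : (i < n)%N -> (i \in Tb b S) = (vert b i \in S).
Proof. by move=> iln; rewrite mem_filter mem_iota /= add0n iln andbT. Qed.

Lemma Tb_lt S i : i \in Tb b S -> (i < n)%N.
Proof. by rewrite mem_filter mem_iota => /andP[_]. Qed.

Lemma chart_codes T : codom b ++ map (vert b) T = map (lact (GLb b)) (map (lineof k) (codesT T)).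
Proof.
rewrite /codesT !map_cat; congr (_ ++ _); last by rewrite -!map_comp.
have -> : stdc k = [seq codeof (lstd i) | i <- enum 'I_m].
  apply: (@eq_from_nth _ [::]); first by rewrite size_stdc size_map size_enum_ord.
  move=> i; rewrite size_stdc => im; rewrite (stdc_std (Ordinal im)).
  by rewrite (nth_map (Ordinal im)) ?size_enum_ord // (nth_ord_enum _ (Ordinal im)).
rewrite codomE -[RHS]map_comp -[RHS]map_comp; apply: eq_map => i /=.
by rewrite codeofK GLb_std.
Qed.

Lemma uni_coverb S v : uni S -> basis_in b S -> v \in S ->
  (exists j, v = b j) \/ exists2 i, (i < n)%N & v = vert b i.
Proof.
move=> us [bs _] vS; set l := lact (GLinv (GLb b)) v.
have E : v = lact (GLb b) l by rewrite lactVK.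
have [e El] := lact_sign (GLinv (GLb b)) v.
have [] := @line_cover l.
- move=> i; rewrite El mxE normrM normrX normrN1 expr1n mul1r val_GLinv val_GLb.
  exact: uni_coord us bs db vS i.
- by move=> [j lj]; left; exists j; rewrite E lj GLb_std.
by move=> [i iln li]; right; exists i => //; rewrite E li.
Qed.

Lemma basis_codom S : basis_in b S -> uniq (codom b).
Proof.
move=> bs; rewrite codomE map_inj_uniq ?enum_uniq // => i j E.
by apply: (wt_basis_inj bs); rewrite E.
Qed.

Lemma chart S : uni S -> basis_in b S -> perm_eq S (codom b ++ map (vert b) (Tb b S)).
Proof.
move=> us bs; apply: uniq_perm.
- exact: uni_uniq us.
- rewrite cat_uniq (basis_codom bs) /=; apply/andP; split.
    apply/hasPn => v /mapP[i /Tb_lt iln ->]; apply/negP => /codomP[j].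
    exact: vert_std.
  rewrite map_inj_in_uniq ?filter_uniq ?iota_uniq // => i j /Tb_lt ? /Tb_lt ?.
  exact: vert_inj.
move=> v; rewrite mem_cat; apply/idP/orP => [vS|[/codomP[j ->]|/mapP[i iT ->]]].
- have [[j ->]|[i iln E]] := uni_coverb us bs vS; first by left; apply: codom_f.
  by right; rewrite E map_f // mem_Tb // -E.
- exact: (proj1 bs).
by rewrite -mem_Tb // (Tb_lt iT).
Qed.

Lemma codesT_ok T : T \in sublists (iota 0 n) -> codes_ok k (codesT T).
Proof.
move=> /sublists_filter ET; case/andP: vs_ok => /allP H; rewrite cat_uniq => /and3P[u1 /hasPn u2 u3].
have Tlt i : i \in T -> (i < n)%N by rewrite ET mem_filter mem_iota => /andP[].
apply/andP; split.
  apply/allP => c; rewrite mem_cat => /orP[cs|/mapP[i /Tlt iT ->]]; last exact: vs_codeok.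
  by apply: H; rewrite mem_cat cs.
rewrite cat_uniq u1 /=; apply/andP; split.
  by apply/hasPn => c /mapP[i /Tlt iT ->]; apply: u2; apply: mem_nth.
rewrite map_inj_in_uniq => [|i j /Tlt ilt /Tlt jlt /eqP]; first by rewrite ET filter_uniq ?iota_uniq.
by rewrite nth_uniq // => /eqP.
Qed.

Lemma uni_faces T : T \in sublists (iota 0 n) ->
  uni (codom b ++ map (vert b) T) <-> T \in faces.
Proof.
move=> TL; rewrite chart_codes uni_act mem_filter TL andbT; apply: uniL_P; first exact: codesT_ok.
by move=> c cs; rewrite mem_cat cs.
Qed.

Lemma Tb_sub S : Tb b S \in sublists (iota 0 n).
Proof. exact: filter_sublists. Qed.

Lemma Tb_faces S : uni S -> basis_in b S -> Tb b S \in faces.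
Proof. by move=> us bs; apply/(uni_faces (Tb_sub S)); exact: (uni_perm (chart us bs) us). Qed.

Lemma coord_vert i j : (i < n)%N -> (\det (lmx (upd b j (vert b i))) != 0) = ((nth [::] vs i)`_j != 0).
Proof.
move=> iln; rewrite -normr_eq0 -coord_upd // normr_eq0; congr (~~ _).
have [e ->] := lact_sign (GLb b) (vl i).
rewrite val_GLb -scalemxAr mulKmx ?unitmxE ?unit_int ?db // mxE mulf_eq0 signr_eq0 /=.
by rewrite val_lineof ?vs_codeok // mxE.
Qed.

(** Minimality of b for S depends only on two sets of indices. This reduces the matching on
    infinitely many cells to tables indexed by the possible [Db b]. *)
Lemma good_Tb S : uni S -> basis_in b S -> sortedb b ->
  good b S <-> all (fun i => i \notin Db b) (Tb b S).
Proof.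
move=> us bs sb; split=> [[[_ H] _]|/allP H].
  apply/allP => i iT; have iln := Tb_lt iT; rewrite mem_filter negb_and; apply/orP; left.
  apply/existsPn => j; rewrite negb_and -implybE; apply/implyP => vj.
  by apply: H; [rewrite -mem_Tb|rewrite coord_vert].
split => //; split => // v vS j.
have [[i ->]|[i iln E]] := uni_coverb us bs vS.
  (* A member of b other than b_j has j-th coordinate 0, so the only exchange within b is
     trivial. *)
  rewrite -normr_eq0 -coord_upd // (coord_self i j bs); case: (eqVneq j i) => [->|_]; last by rewrite normr0 eqxx.
  by rewrite ltvv.
rewrite E coord_vert // => vj; have /H : i \in Tb b S by rewrite mem_Tb // -E.
rewrite mem_filter mem_iota /= iln andbT; apply: contraNN => lt.
by apply/existsP; exists j; rewrite vj.
Qed.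

Lemma Tb_cons S i : (i < n)%N -> Tb b (vert b i :: S) = ins i (Tb b S).
Proof.
move=> iln; apply: eq_in_filter => j; rewrite mem_iota => /= jln.
rewrite inE mem_Tb //; congr (_ || _); apply/eqP/eqP => [|-> //]; exact: vert_inj.
Qed.

Lemma Tb_rem S i T : uniq S -> Tb b S = ins i T -> (i < n)%N -> i \notin T ->
  T \in sublists (iota 0 n) -> Tb b (rem (vert b i) S) = T.
Proof.
move=> us E iln iT /sublists_filter ->; apply: eq_in_filter => j; rewrite mem_iota => /= jln.
rewrite mem_rem_uniq // inE -mem_Tb // E mem_filter mem_iota /= jln andbT.
have -> : (vert b j != vert b i) = (j != i).
  by congr (~~ _); apply/eqP/eqP => [|-> //]; apply: vert_inj.
by case: eqVneq => //= ->; rewrite (negbTE iT).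
Qed.

End Basis.

Lemma Tb_perm b S S' : perm_eq S S' -> Tb b S = Tb b S'.
Proof. by move=> SS; apply: eq_filter => i; rewrite (perm_mem SS). Qed.

Variables (tab : seq nat -> seq (seq nat * nat)) (crit : seq nat) (N : nat) (b0 : 'I_m -> line m).

Definition facesD (F : seq (seq nat)) D := [seq T <- F | all (fun i => i \notin D) T].
Definition lows D := [seq p.1 | p <- tab D].
Definition ups D := [seq ins p.2 p.1 | p <- tab D].

(* [tab D] lists pairs (T, i), meaning that T is matched with [ins i T]. *)
Definition check_table (F : seq (seq nat)) D : bool :=
  let FD := facesD F D in
  let tb := tab D in let lo := [seq p.1 | p <- tb] in let up := [seq ins p.2 p.1 | p <- tb] in
  [&& all (fun p => [&& p.1 \in FD, (p.2 < n)%N, p.2 \notin p.1 & ins p.2 p.1 \in FD]) tb,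
      uniq (lo ++ up),
      all (fun T => [|| T \in lo, T \in up | (D == [::]) && (T == crit)]) FD &
      all (fun p => all (fun i => [|| i == p.2, i \in p.1, ins i p.1 \notin up |
         (index (ins i p.1) up < index p.1 lo)%N]) (iota 0 n)) tb].

Hypothesis tab_ok : forall b, `|\det (lmx b)| = 1 -> sortedb b -> check_table faces (Db b).
Hypothesis Db_nil : forall b, `|\det (lmx b)| = 1 -> sortedb b -> Db b = [::] -> b = b0.
Hypothesis faces_size : all (fun T => (m + size T <= N)%N) faces.
Hypothesis crit_size : (m + size crit = N)%N.

Definition low S u := uni S /\
  exists2 b, good b S & exists p, [/\ p \in tab (Db b), Tb b S = p.1 & u = vert b p.2].
Definition critical_cell : seq (line m) := codom b0 ++ map (vert b0) crit.

Definition rank S : 'cV[int]_m * nat :=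
  match excluded_middle_informative (uni S) with
  | left us => let b := projT1 (constructive_indefinite_description _ (good_exists us)) in
      (sumwt b, index (Tb b S) (lows (Db b)))
  | right _ => (0, 0%N)
  end.

Lemma rankE S b : uni S -> good b S -> rank S = (sumwt b, index (Tb b S) (lows (Db b))).
Proof.
move=> us gb; rewrite /rank; case: excluded_middle_informative => [us'|nus]; last by case: nus.
case: constructive_indefinite_description => b' gb' /=.
by rewrite (good_uniq us gb gb').
Qed.

Lemma good_det b S : good b S -> `|\det (lmx b)| = 1.
Proof. by case=> [[[_ d] _] _]. Qed.
Lemma good_basis b S : good b S -> basis_in b S.
Proof. by case=> [[]]. Qed.
Lemma good_check b S : good b S -> check_table faces (Db b).
Proof. by move=> g; apply: tab_ok; [apply: good_det g|case: g]. Qed.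

Lemma low_perm S S' u : perm_eq S S' -> low S u -> low S' u.
Proof.
move=> SS [us [b gb [p [pt ET Eu]]]]; split; first exact: uni_perm us.
exists b; first exact: good_perm gb.
by exists p; rewrite -(Tb_perm _ SS).
Qed.

(* Adding the partner of [S] keeps the minimal basis. *)
Lemma low_good S u b p : uni S -> good b S -> p \in tab (Db b) -> Tb b S = p.1 -> u = vert b p.2 ->
  [/\ uni (u :: S), good b (u :: S), Tb b (u :: S) = ins p.2 p.1 & (p.2 < n)%N].
Proof.
move=> us gb pt ET ->; have db := good_det gb; have [bs _] := good_basis gb.
have /and4P[/allP/(_ p pt)/and4P[pF pn pp]] := good_check gb.
rewrite mem_filter => /andP[nD insF] _ _ _.
have TT : Tb b (vert b p.2 :: S) = ins p.2 p.1 by rewrite Tb_cons // ET.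
have U : uni (vert b p.2 :: S).
  have : ins p.2 p.1 \in sublists (iota 0 n) by apply: filter_sublists.
  move/(uni_faces db) => [_ /(_ insF)]; apply: uni_perm; apply: uniq_perm.
  - rewrite cat_uniq (basis_codom (conj bs db)) /=; apply/andP; split.
      apply/hasPn => v /mapP[i]; rewrite mem_filter mem_iota => /andP[_ iln] ->.
      by apply/negP => /codomP[j]; apply: vert_std.
    rewrite map_inj_in_uniq ?filter_uniq ?iota_uniq // => i j.
    by rewrite !mem_filter !mem_iota => /andP[_ ?] /andP[_ ?]; apply: vert_inj.
  - by rewrite /= uni_uniq // andbT -mem_Tb // ET.
  move=> v; rewrite mem_cat (perm_mem (_ : perm_eq (vert b p.2 :: S) (vert b p.2 :: (codom b ++ map (vert b) (Tb b S))))); last first.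
    by rewrite perm_cons; apply: chart.
  rewrite inE mem_cat ET; apply/orP/or3P => [[cv|/mapP[i]]|[/eqP ->|cv|/mapP[i ip ->]]].
  - by apply: Or32.
  - rewrite mem_filter => /andP[/orP[/eqP ->|ip] _] ->; first by apply: Or31.
    by apply: Or33; apply: map_f.
  - by right; apply: map_f; rewrite mem_filter eqxx mem_iota.
  - by left.
  right; apply: map_f; rewrite mem_filter ip orbT mem_iota /=.
  by move: ip; rewrite -ET => /Tb_lt.
split => //; apply/good_Tb => //; last by rewrite TT.
- by split=> // i; rewrite inE bs orbT.
by case: gb.
Qed.

Lemma low_uni S u : low S u -> uni (u :: S) /\ uni S.
Proof. by move=> [us [b gb [p [pt ET Eu]]]]; have [] := low_good us gb pt ET Eu. Qed.

Lemma tab_inj D p q : uniq (lows D ++ ups D) -> p \in tab D -> q \in tab D ->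
  (p.1 = q.1 \/ ins p.2 p.1 = ins q.2 q.1) -> p = q.
Proof.
rewrite cat_uniq => /and3P[u1 _ u2] /(nthP p)[i isz <-] /(nthP p)[j jsz <-] H.
suff -> : i = j by [].
case: H => /eqP.
  by rewrite -!(nth_map p [::] (fun p => p.1)) // nth_uniq ?size_map // => /eqP.
by rewrite -!(nth_map p [::] (fun p => ins p.2 p.1)) // nth_uniq ?size_map // => /eqP.
Qed.

Lemma low_fun S u v : low S u -> low S v -> u = v.
Proof.
move=> [us [b gb [p [pt ET ->]]]] [_ [b' gb' [q [qt ET' ->]]]].
have E := good_uniq us gb gb'; rewrite -E in qt ET' *.
have /and4P[_ uq _ _] := good_check gb.
by rewrite (tab_inj uq pt qt) // -ET -ET'; left.
Qed.

Lemma up_fun S S' u v : perm_eq (u :: S) (v :: S') -> low S u -> low S' v -> u = v.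
Proof.
move=> P [us [b gb [p [pt ET Eu]]]] [us' [b' gb' [q [qt ET' Ev]]]].
have [U g TT _] := low_good us gb pt ET Eu; have [U' g' TT' _] := low_good us' gb' qt ET' Ev.
rewrite perm_sym in P; have g2 := good_perm P g'; have E := good_uniq U g g2.
rewrite -E in qt TT' Ev *; rewrite Eu Ev; have /and4P[_ uq _ _] := good_check gb.
by rewrite (tab_inj uq pt qt) // -TT -TT'; right; apply: Tb_perm; rewrite perm_sym.
Qed.

Lemma low_cover S : uni S -> (exists u, low S u) \/
  (exists u S', perm_eq S (u :: S') /\ low S' u) \/ perm_eq S critical_cell.
Proof.
move=> us; have [b gb] := good_exists us; have db := good_det gb; have bs := good_basis gb.
have sb : sortedb b by case: gb.
have /and4P[/allP H1 _ /allP H3 _] := good_check gb.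
have TF : Tb b S \in facesD faces (Db b).
  by rewrite mem_filter Tb_faces // andbT; apply/good_Tb.
have /or3P[/mapP[p pt ET]|/mapP[p pt ET]|/andP[/eqP E0 /eqP ET]] := H3 _ TF.
- by left; exists (vert b p.2); split => //; exists b => //; exists p.
- right; left; set u := vert b p.2; exists u, (rem u S).
  have /and4P[] := H1 p pt; rewrite mem_filter mem_filter => /andP[nD /andP[_ psub]] pn pp _.
  have uS : u \in S by rewrite -mem_Tb // ET mem_filter eqxx mem_iota.
  have ER : Tb b (rem u S) = p.1 by apply: Tb_rem => //; apply: uni_uniq.
  have bR : basis_in b (rem u S).
    split => // j; rewrite mem_rem_uniq ?uni_uniq // inE (proj1 bs) andbT.
    by apply/eqP => E; apply: (vert_std db (j := j) pn).
  have uR : uni (rem u S).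
    apply: (@uni_sub _ _ u); first by exists b; [case: bR|].
    by apply: uni_perm us; apply: perm_to_rem.
  split; first exact: perm_to_rem.
  split => //; exists b; last by exists p.
  by apply/good_Tb => //; rewrite ER.
(* The exceptional face is allowed only when no vector improves b; then b is [b0], so that a single
   cell remains unmatched. *)
right; right; rewrite /critical_cell -(Db_nil db sb E0) -ET.
exact: chart.
Qed.

(** The basis b of S is still available in v :: S. Either the minimal basis has changed, and its
    total weight is smaller, or it is still b; then both pairs belong to the same table, whose order
    has been checked. *)
Lemma rank_dec S S' u v u' : low S u -> v <> u -> perm_eq (v :: S) (u' :: S') -> low S' u' ->
  ltA (rank S') (rank S).
Proof.
move=> [us [b gb [p [pt ET Eu]]]] vu P [us' [b' gb' [q [qt ET' Eu']]]].
have [U' g' TT' qn] := low_good us' gb' qt ET' Eu'.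
have db := good_det gb; have bs := good_basis gb; have sb : sortedb b by case: gb.
rewrite (rankE us gb) (rankE us' gb'); split; first by move=> i; apply: sumwt_ge0.
have P' : perm_eq (u' :: S') (v :: S) by rewrite perm_sym.
have UX : uni (v :: S) by apply: uni_perm U'.
have gX : good b' (v :: S) by apply: good_perm g'.
have bX : basis_in b (v :: S) by split => // i; rewrite inE (proj1 bs) orbT.
have [E|lt] := good_lt UX gX bX sb; last by left.
rewrite -{b'}E in gb' g' gX qt ET' Eu' TT' *; right; split => //=.
have vS : v \notin S by case: UX => /andP[].
have [[j E]|[i iln Ev]] := uni_coverb db UX bX (mem_head _ _).
  by case/negP: vS; rewrite E (proj1 bs).
have ip : i \notin p.1 by rewrite -ET mem_Tb // -Ev.
have ine : i != p.2 by apply/eqP => E; apply: vu; rewrite Ev Eu E.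
have EX : ins i p.1 = ins q.2 q.1 by rewrite -TT' (Tb_perm _ P') Ev Tb_cons // ET.
have /and4P[_ uq _ /allP/(_ p pt)/allP/(_ i)] := good_check gb.
rewrite mem_iota iln => /(_ isT); rewrite (negbTE ine) (negbTE ip) /= -/(ups (Db b)) -/(lows (Db b)).
have upq : ins q.2 q.1 \in ups (Db b) by apply: map_f.
rewrite EX upq /= ET ET'; suff -> : index (ins q.2 q.1) (ups (Db b)) = index q.1 (lows (Db b)) by [].
move: uq; rewrite cat_uniq => /and3P[u1 _ u2].
have jt : (index q (tab (Db b)) < size (tab (Db b)))%N by rewrite index_mem.
rewrite -{1 2 3}(nth_index q qt) -(nth_map q [::] (fun p => ins p.2 p.1) jt) -(nth_map q [::] (fun p => p.1) jt).
by rewrite !index_uniq ?size_map.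
Qed.

Lemma uni_size S : uni S -> (size S <= N)%N.
Proof.
move=> us; have [b gb] := good_exists us.
rewrite (perm_size (chart (good_det gb) us (good_basis gb))) size_cat size_codom card_ord size_map.
exact: (allP faces_size _ (Tb_faces (good_det gb) us (good_basis gb))).
Qed.

Lemma critical_size : size critical_cell = N.
Proof. by rewrite size_cat size_codom card_ord size_map crit_size. Qed.

Theorem cell_exact (V : lmodType rat) p (f : seq (line m) -> V) : alt N p.+1 f -> dd f = (fun _ => 0) ->
  exists f', alt N p f' /\ dd f' = f.
Proof.
exact: (morse_exact (@wf_ltA m) low_uni low_perm low_fun up_fun low_cover rank_dec critical_size).
Qed.

Theorem cell_H0 (V : lmodType rat) (f : seq (line m) -> V) : alt N 0 f -> dd f = (fun _ => 0) ->
  f critical_cell = 0 -> f = fun _ => 0.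
Proof.
exact: (morse_H0 (@wf_ltA m) low_uni low_cover rank_dec uni_size critical_size).
Qed.

End Chart.

(** * Reduced bases and constraints on the improving vectors *)

Section Reduced.
Local Open Scope ring_scope.
Variable k : nat.
Notation m := k.+1.
Implicit Types (b : 'I_m -> line m).

Lemma increasing_id (g : 'I_m -> 'I_m) : (forall i j : 'I_m, (i < j)%N -> (g i < g j)%N) -> forall i, g i = i.
Proof.
move=> H.
have gi : injective g.
  move=> i j E; apply: val_inj; case: (ltngtP i j) => // /H; by rewrite E ltnn.
have L : sorted (fun i j : 'I_m => (i < j)%N) (enum 'I_m).
  by have := iota_ltn_sorted 0 m; rewrite -val_enum_ord sorted_map.
have S : map g (enum 'I_m) = enum 'I_m.
  apply: (@irr_sorted_eq _ (fun i j : 'I_m => (i < j)%N)).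
  - by move=> x y z; apply: ltn_trans.
  - by move=> x /=; rewrite ltnn.
  - by rewrite sorted_map; apply: sub_sorted L => i j /H.
  - exact: L.
  move=> x; rewrite mem_enum inE; have [h _ Kh] := injF_bij gi.
  by apply/mapP; exists (h x); rewrite ?mem_enum ?Kh.
move=> i; move: S; rewrite -[RHS]map_id => /eq_in_map; apply.
by rewrite mem_enum.
Qed.

(* A sorted basis that no [b_j +- b_i] improves is triangular with unit pivots, hence the reversed standard basis. *)
Lemma reduced_std b : `|\det (lmx b)| = 1 -> sortedb b ->
  (forall (i j : 'I_m) (e : bool), (i < j)%N ->
     ~~ lpos (sqv (val (b j)) - sqv (val (b j) + (-1) ^+ e *: val (b i)))) ->
  b = fun j => lstd (rev_ord j).
Proof.
move=> db sb red.
have /fin_all_exists[f Hf] j : exists r, 0 < (val (b j)) r 0 /\ forall r' : 'I_m, (r' < r)%N -> (val (b j)) r' 0 = 0.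
  by have /lposP[r rp Hr] : lpos (val (b j)) by [exact: valP]; exists r.
(* Leading positions decrease along b: if b_i and b_j had the same one, with b_i the lighter, then
   b_j - b_i would improve b_j. *)
have fdec (i j : 'I_m) : (i < j)%N -> (f j < f i)%N.
  move=> ij; have lt := sortedbP sb ij; have [ui Hi] := Hf i; have [uj Hj] := Hf j.
  rewrite ltnNge; apply/negP; rewrite leq_eqVlt => /orP[/eqP/val_inj E|ff].
    rewrite -E in uj Hj; have /negP := red i j true ij; apply.
    apply/lposP; exists (f i) => [|r ri]; last first.
      by rewrite !mxE Hi // Hj // mulr0 addr0 subrr.
    have /lposP[r] := lt; rewrite !mxE => r0 Hr.
    have : (val (b i)) (f i) 0 <= (val (b j)) (f i) 0.
      case: (ltngtP r (f i)) => [ri|ri|/val_inj Er].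
      - by move: r0; rewrite Hi // Hj // subrr ltxx.
      - have := Hr _ ri; rewrite !mxE; move: ui uj; clear.
        by move: ((val (b i)) _ _) ((val (b j)) _ _) => x y; nia.
      move: r0; rewrite Er; move: ui uj; clear.
      by move: ((val (b i)) _ _) ((val (b j)) _ _) => x y; nia.
    rewrite ?mxE expr1 mulN1r; move: ui uj; clear.
    by move: ((val (b i)) _ _) ((val (b j)) _ _) => x y; nia.
  have /lposP[r] := lt; rewrite !mxE => r0 Hr.
  case: (ltngtP r (f i)) => [ri|ri|/val_inj Er].
  - by move: r0; rewrite Hi // Hj ?subrr ?ltxx //; apply: ltn_trans ff.
  - have := Hr _ ri; rewrite !mxE Hj // expr0n sub0r => /eqP.
    by rewrite oppr_eq0 sqrf_eq0 => /eqP E; rewrite E ltxx in ui.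
  by move: r0; rewrite Er Hj // expr0n sub0r oppr_gt0 ltNge sqr_ge0.
have fE j : f j = rev_ord j.
  have := @increasing_id (fun i => f (rev_ord i)) _ (rev_ord j); rewrite rev_ordK; apply.
  by move=> a c ac; apply: fdec => /=; have := ltn_ord c; have := ltn_ord a; lia.
(* After reversal of the columns the matrix is triangular; its diagonal entries are positive
   integers of product 1. *)
have piv j : (val (b j)) (rev_ord j) 0 = 1.
  have D : `|\det (lmx (fun j => b (rev_ord j)))| = 1.
    have -> : lmx (fun j => b (rev_ord j)) = col_perm (perm rev_ord_inj) (lmx b).
      by apply/matrixP => a c; rewrite !mxE permE.
    by rewrite col_permE det_mulmx det_perm normrM normrX normrN1 expr1n mulr1.
  rewrite det_trig in D; last first.
    apply/is_trig_mxP => a c ac; rewrite mxE; have [_] := Hf (rev_ord c).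
    by rewrite fE rev_ordK; apply.
  have pos a : 0 < (val (b (rev_ord a))) a 0 by have [] := Hf (rev_ord a); rewrite fE rev_ordK.
  have := D; rewrite (bigD1 (rev_ord j)) //= normrM mxE rev_ordK.
  have := pos (rev_ord j); rewrite rev_ordK.
  set x := (val (b j)) _ _; set y := `|\prod_(_ | _) _|; clearbody x y; clear => x0 E.
  have : x * y = 1 by rewrite -E ger0_norm // ltW.
  move=> xy; have y0 : 0 < y by rewrite -(pmulr_rgt0 _ x0) xy.
  have y1 : 1 <= y by lia.
  have : x <= x * y by apply: ler_peMr => //; apply: ltW.
  by rewrite xy; lia.
apply: funext => j; apply: val_inj; apply/matrixP => r q.
rewrite (ord1 q) /= [RHS]mxE andbT; have [->|ne] := eqVneq r (rev_ord j); first exact: piv.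
case: (ltngtP r (rev_ord j)) => [rj|rj|/val_inj E]; last by rewrite E eqxx in ne.
  by have [_] := Hf j; rewrite fE; apply.
(* b_i is the member with pivot 1 in row r. Adding or subtracting it brings a nonzero entry of b_j
   in that row closer to 0, and leaves the rows above unchanged. *)
set i := rev_ord r; have ri : r = rev_ord i by rewrite rev_ordK.
have ij : (i < j)%N by move: rj; rewrite /i /=; have := ltn_ord r; have := ltn_ord j; lia.
apply/eqP; apply: contraT => v0.
have pi := piv i; rewrite -ri in pi.
have := red i j (0 < (val (b j)) r 0) ij => /negP; case; apply/lposP; exists r.
  rewrite !mxE pi; move: v0; move: (val (b j) r 0) => v v0.
  by case: (boolP (0 < v)) => v1; rewrite ?expr0 ?expr1; nia.
move=> r' rr; rewrite !mxE; have [_] := Hf i; rewrite fE -ri => -> //.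
by rewrite mulr0 addr0 subrr.
Qed.

Variable vs : seq (seq int).
Notation n := (size vs).
Hypothesis vs_ok : codes_ok k (stdc k ++ vs).

Definition comb (c : seq int) (x : 'I_m -> int) : int := \sum_(j < m) c`_j * x j.

Lemma wt_vert b i : `|\det (lmx b)| = 1 -> (i < n)%N ->
  wt (vert vs b i) = \col_r (comb (nth [::] vs i) (fun j => (val (b j)) r 0)) ^+ 2.
Proof.
move=> db iln; rewrite /wt /vert; have [e ->] := lact_sign (GLb b) (vl k vs i).
rewrite sqv_sign val_GLb // val_lineof ?vs_codeok //.
apply/matrixP => r q; rewrite !mxE; congr (_ ^+ 2); apply: eq_bigr => j _.
by rewrite !mxE mulrC.
Qed.

Definition lnn (v : 'cV[int]_m) : Prop := v = 0 \/ lpos v.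

Lemma lnn_sum (A : eqType) (r : seq A) (F : A -> 'cV[int]_m) :
  (forall i, i \in r -> lnn (F i)) -> lnn (\sum_(i <- r) F i).
Proof.
by move=> H; have [Z|P] := lpos_sum H; [left; rewrite big_seq big1|right].
Qed.

Lemma lpos_lnn v w : lpos v -> lnn w -> lpos (v + w).
Proof. by move=> vp [->|wp]; rewrite ?addr0 //; apply: lposD. Qed.

Lemma lnnD v w : lnn v -> lnn w -> lnn (v + w).
Proof.
by move=> [->|vp]; rewrite ?add0r // => -[->|wp]; right; rewrite ?addr0 //; apply: lposD.
Qed.

Lemma lpos_nonpos (v : 'cV[int]_m) : (forall r, v r 0 <= 0) -> ~~ lpos v.
Proof. by move=> H; apply/negP => /lposP[r] ; rewrite ltNge H. Qed.

Variable top : nat -> 'I_m.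
Hypothesis top_supp : forall i, (i < n)%N -> (nth [::] vs i)`_(top i) != 0 /\
  forall j : 'I_m, (top i < j)%N -> (nth [::] vs i)`_j = 0.

Section ClauseBasis.
Variables (b : 'I_m -> line m) (db : `|\det (lmx b)| = 1) (sb : sortedb b).

(** In a sorted basis the last member of a support is the heaviest, so a vector that beats some
    member of its support beats the last one. *)
Lemma mem_Db i : (i < n)%N -> (i \in Db vs b) = ltv (wt (vert vs b i)) (wt (b (top i))).
Proof.
move=> iln; rewrite mem_filter mem_iota /= iln andbT; have [t0 Ht] := top_supp iln.
apply/existsP/idP => [[j /andP[cj lt]]|lt]; last by exists (top i); rewrite t0.
case: (ltngtP j (top i)) => [jt|/Ht E|/val_inj <- //]; last by rewrite E eqxx in cj.
by apply: ltv_trans lt _; apply: sortedbP.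
Qed.

Definition gap i (x : 'I_m -> int) : int := x (top i) ^+ 2 - comb (nth [::] vs i) x ^+ 2.

Lemma gapE i : (i < n)%N -> wt (b (top i)) - wt (vert vs b i) = \col_r gap i (fun j => (val (b j)) r 0).
Proof. by move=> iln; rewrite wt_vert //; apply/matrixP => r q; rewrite !mxE. Qed.

Definition clause := (nat * seq nat * seq nat * seq ('I_m * 'I_m))%type.
(* For c = (i, P, Q, O): if i and P lie in [Db b] and Q does not meet it, then [clause_sum c] is lexicographically
   positive, since O lists increasing pairs; so a nonpositive [clause_sum c] excludes this. *)
Definition clause_ok (D : seq nat) (c : clause) : bool :=
  ~~ [&& c.1.1.1 \in D, all (fun i => i \in D) c.1.1.2 & all (fun i => i \notin D) c.1.2].

Definition clause_sum (c : clause) (x : 'I_m -> int) : int :=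
  gap c.1.1.1 x + \sum_(i <- c.1.1.2) gap i x - \sum_(i <- c.1.2) gap i x
  + \sum_(p <- c.2) (x p.2 ^+ 2 - x p.1 ^+ 2).

Lemma clauseP (c : clause) : (c.1.1.1 < n)%N -> all (fun i => i < n)%N c.1.1.2 -> all (fun i => i < n)%N c.1.2 ->
  all (fun p : 'I_m * 'I_m => p.1 < p.2)%N c.2 ->
  (forall x, clause_sum c x <= 0) -> clause_ok (Db vs b) c.
Proof.
case: c => [[[i0 pos] neg] ex] /= i0n /allP posn /allP negn /allP exn H.
apply/negP => /= /and3P[i0D /allP posD /allP negD].
have gp i : (i < n)%N -> i \in Db vs b -> lpos (\col_r gap i (fun j => (val (b j)) r 0)).
  by move=> iln; rewrite mem_Db // -gapE.
have gn i : (i < n)%N -> i \notin Db vs b -> lnn (- \col_r gap i (fun j => (val (b j)) r 0)).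
  move=> iln; rewrite mem_Db // -gapE // opprB => nlt.
  have [E|ne] := eqVneq (wt (vert vs b i)) (wt (b (top i))); first by left; rewrite E subrr.
  by right; rewrite -/(ltv _ _) ltvNge.
suff : lpos (\col_r clause_sum (i0, pos, neg, ex) (fun j => (val (b j)) r 0)).
  by apply/negP/lpos_nonpos => r; rewrite mxE.
have -> : \col_r clause_sum (i0, pos, neg, ex) (fun j => (val (b j)) r 0) =
    \col_r gap i0 (fun j => (val (b j)) r 0) + (\sum_(i <- pos) \col_r gap i (fun j => (val (b j)) r 0)
    + (\sum_(i <- neg) - \col_r gap i (fun j => (val (b j)) r 0)
    + \sum_(p <- ex) (wt (b p.2) - wt (b p.1)))).
  apply/matrixP => r q; rewrite (ord1 q) !(mxE, summxE) /clause_sum /= !addrA -sumrN.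
  congr (_ + _ + _ + _); apply: eq_bigr => i _; by rewrite !mxE.
apply: lpos_lnn; first exact: gp.
apply: lnnD; first by apply: lnn_sum => i ip; right; apply: gp; [apply: posn|apply: posD].
apply: lnnD; first by apply: lnn_sum => i ip; apply: gn; [apply: negn|apply: negD].
by apply: lnn_sum => p pe; right; apply: (sortedbP sb); apply: exn.
Qed.

Lemma Db_nil_std (pr : 'I_m -> 'I_m -> bool -> nat) :
  (forall (i j : 'I_m) (e : bool), (i < j)%N -> (pr i j e < n)%N /\
    forall x : 'I_m -> int, (comb (nth [::] vs (pr i j e)) x) ^+ 2 = (x j + (-1) ^+ e * x i) ^+ 2) ->
  (forall (i j : 'I_m) (e : bool), (i < j)%N -> top (pr i j e) = j) ->
  Db vs b = [::] -> b = fun j => lstd (rev_ord j).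
Proof.
move=> Hpr Htop D0; apply: reduced_std => // i j e ij.
have [pn Ep] := Hpr i j e ij.
have : pr i j e \notin Db vs b by rewrite D0.
rewrite mem_Db // Htop // /ltv (wt_vert db pn); congr (~~ lpos (_ - _)).
by apply/matrixP => r q; rewrite !mxE Ep.
Qed.

End ClauseBasis.
End Reduced.

Section Greedy.
Variable n : nat.
Notation insn i T := ([seq j <- iota 0 n | (j == i) || (j \in T)]).

Definition cofaces (rem : seq (seq nat)) (T : seq nat) : seq nat :=
  [seq i <- iota 0 n | (i \notin T) && (insn i T \in rem)].

(* Nothing is proved about this search: its output is validated by [check_table]. *)
Fixpoint find_free (rem todo : seq (seq nat)) : option (seq nat * nat) :=
  if todo is T :: todo' then
    if cofaces rem T is [:: i] then Some (T, i) else find_free rem todo'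
  else None.

Fixpoint collapse (fuel : nat) (rem : seq (seq nat)) : seq (seq nat * nat) :=
  if fuel is f.+1 then
    if find_free rem rem is Some (T, i) then
      (T, i) :: collapse f [seq U <- rem | (U != T) && (U != insn i T)]
    else [::]
  else [::].

Definition greedy (F : seq (seq nat)) (crit : seq nat) (D : seq nat) : seq (seq nat * nat) :=
  let FD := [seq T <- F | all (fun i => i \notin D) T] in
  collapse (size FD) (if D is [::] then [seq T <- FD | T != crit] else FD).
End Greedy.

(** * Exactness for m = 2 and m = 3 *)

Section Instances.
Local Open Scope ring_scope.

(** Reversed because a sorted basis starts with the lightest vector, and among the standard vectors
    the last has the lexicographically smallest weight. *)
Definition b0 k : 'I_k.+1 -> line k.+1 := fun j => lstd (rev_ord j).

Definition clauses_hold k (cls : seq (clause k)) (D : seq nat) : bool := all (clause_ok D) cls.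

(** The clauses discard sets D that no sorted basis realises; the greedy search has to succeed on
    every set that survives them. *)
Definition tables_ok k (vs : seq (seq int)) (N : nat) (crit : seq nat) (cls : seq (clause k)) : bool :=
  let F := faces k vs in
  [&& all (fun D => clauses_hold cls D ==> check_table vs (greedy (size vs) F crit) crit F D)
        (sublists (iota 0 (size vs))) & all (fun T => (k.+1 + size T <= N)%N) F].

Section Complex.
Variables (k : nat) (vs : seq (seq int)) (N : nat) (crit : seq nat) (cls : seq (clause k)).
Variables (top : nat -> 'I_k.+1) (pr : 'I_k.+1 -> 'I_k.+1 -> bool -> nat).
Hypothesis vs_ok : codes_ok k (stdc k ++ vs).
Hypothesis vs_cover : all (fun c => lposl c ==> (c \in stdc k ++ vs)) (lists_of k.+1 [:: -1; 0; 1]).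
Hypothesis tabs : tables_ok vs N crit cls.
Hypothesis crit_size : (k.+1 + size crit = N)%N.
Hypothesis top_supp : forall i, (i < size vs)%N -> (nth [::] vs i)`_(top i) != 0 /\
  forall j : 'I_k.+1, (top i < j)%N -> (nth [::] vs i)`_j = 0.
Hypothesis prP : forall (i j : 'I_k.+1) (e : bool), (i < j)%N -> (pr i j e < size vs)%N /\
    forall x : 'I_k.+1 -> int, (comb (nth [::] vs (pr i j e)) x) ^+ 2 = (x j + (-1) ^+ e * x i) ^+ 2.
Hypothesis pr_top : forall (i j : 'I_k.+1) (e : bool), (i < j)%N -> top (pr i j e) = j.
Hypothesis cls_wf : all (fun c : clause k => [&& (c.1.1.1 < size vs)%N, all (fun i => (i < size vs)%N) c.1.1.2,
  all (fun i => (i < size vs)%N) c.1.2 & all (fun p : 'I_k.+1 * 'I_k.+1 => (p.1 < p.2)%N) c.2]) cls.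
Hypothesis cls_neg : forall c, c \in cls -> forall x, clause_sum vs top c x <= 0.

Lemma tables_checked (b : 'I_k.+1 -> line k.+1) : `|\det (lmx b)| = 1 -> sortedb b ->
  check_table vs (greedy (size vs) (faces k vs) crit) crit (faces k vs) (Db vs b).
Proof.
move=> db sb; have /andP[/allP/(_ (Db vs b)) H _] := tabs.
have := H (filter_sublists _ _) => /implyP; apply.
apply/allP => c cc; have /and4P[c1 c2 c3 c4] := allP cls_wf c cc.
by apply: (clauseP vs_ok top_supp db sb c1 c2 c3 c4); apply: cls_neg.
Qed.

Lemma standard_min (b : 'I_k.+1 -> line k.+1) : `|\det (lmx b)| = 1 -> sortedb b -> Db vs b = [::] -> b = b0 (k := k).
Proof. by move=> db sb; apply: (Db_nil_std vs_ok top_supp db sb prP pr_top). Qed.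

Lemma exact_pos (V : lmodType rat) p (f : seq (line k.+1) -> V) : alt N p.+1 f -> dd f = (fun _ => 0) ->
  exists f', alt N p f' /\ dd f' = f.
Proof. exact: (cell_exact vs_ok vs_cover tables_checked standard_min crit_size). Qed.

Lemma exact_zero (V : lmodType rat) (f : seq (line k.+1) -> V) : alt N 0 f -> dd f = (fun _ => 0) ->
  f (critical_cell vs crit (b0 (k := k))) = 0 -> f = fun _ => 0.
Proof.
have /andP[_ fs] := tabs.
exact: (cell_H0 vs_ok vs_cover tables_checked standard_min fs crit_size).
Qed.
End Complex.

Definition vs2 : seq (seq int) := [:: [:: 1; 1]; [:: 1; -1]].
Definition cls2 : seq (clause 1) := [:: (0%N, [:: 1%N], [::], [::])].
Definition crit2 : seq nat := [:: 1%N].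
Definition vs3 : seq (seq int) :=
  [:: [:: 1; 1; 0]; [:: 1; -1; 0]; [:: 1; 0; 1]; [:: 1; 0; -1]; [:: 0; 1; 1]; [:: 0; 1; -1];
      [:: 1; 1; 1]; [:: 1; 1; -1]; [:: 1; -1; 1]; [:: 1; -1; -1]].
Definition o0 : 'I_3 := @Ordinal 3 0 isT.
Definition o1 : 'I_3 := @Ordinal 3 1 isT.
Definition o2 : 'I_3 := @Ordinal 3 2 isT.
(* Consequences of the parallelogram identity, one for each clause. *)
Definition cls3 : seq (clause 2) := [seq (c.1.1.1, c.1.1.2, c.1.2, if c.2 then [:: (o0, o1)] else [::]) | c <-
 [:: (0,[::1],[::],false); (2,[::3],[::],false); (4,[::5],[::],false);
  (6,[::7],[::],false); (8,[::9],[::],false);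
  (6,[::8],[::2;2],false); (7,[::9],[::3;3],false);
  (6,[::9],[::4;4],false); (8,[::7],[::5;5],false);
  (6,[::1],[::2;4],false); (6,[::3],[::0;4],false); (6,[::5],[::0;2],true);
  (7,[::1],[::3;5],false); (7,[::2],[::0;5],false); (7,[::4],[::0;3],true);
  (8,[::0],[::2;5],false); (8,[::3],[::1;5],false); (8,[::4],[::1;2],true);
  (9,[::0],[::3;4],false); (9,[::2],[::1;4],false); (9,[::5],[::1;3],true);
  (0,[::2;4],[::6],false); (0,[::3;5],[::7],false); (1,[::2;5],[::8],false); (1,[::3;4],[::9],false)]%N].
(** Together with the basis, e_1 + e_2, e_1 + e_3 and e_2 - e_3 form the roots of A_3 up to sign:
    the minimal vectors of the perfect ternary form. *)
Definition crit3 : seq nat := [:: 0; 2; 5]%N.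
Definition top3 (i : nat) : 'I_3 := if (i < 2)%N then o1 else o2.
(** The position in [vs3] of e_j + (-1)^e e_i, up to sign. *)
Definition pr3 (i j : 'I_3) (e : bool) : nat :=
  ((if val i == 0 then if val j == 1 then 0 else 2 else 4) + e)%N.
Definition pr2 (i j : 'I_2) (e : bool) : nat := e.

Lemma vs3_ok : codes_ok 2 (stdc 2 ++ vs3). Proof. by vm_compute. Qed.
Lemma vs3_cover : all (fun c => lposl c ==> (c \in stdc 2 ++ vs3)) (lists_of 3 [:: -1; 0; 1]).
Proof. by vm_compute. Qed.
Lemma vs2_ok : codes_ok 1 (stdc 1 ++ vs2). Proof. by vm_compute. Qed.
Lemma vs2_cover : all (fun c => lposl c ==> (c \in stdc 1 ++ vs2)) (lists_of 2 [:: -1; 0; 1]).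
Proof. by vm_compute. Qed.
Lemma tables3 : tables_ok vs3 6 crit3 cls3. Proof. vm_cast_no_check (erefl true). Qed.
Lemma tables2 : tables_ok vs2 3 crit2 cls2. Proof. by vm_compute. Qed.

Lemma comb3 c (x : 'I_3 -> int) : comb c x = c`_0 * x o0 + c`_1 * x o1 + c`_2 * x o2.
Proof.
rewrite /comb !big_ord_recl big_ord0 addr0 addrA.
by congr (_ * x _ + _ * x _ + _ * x _); apply: val_inj.
Qed.

Lemma comb2 c (x : 'I_2 -> int) : comb c x = c`_0 * x ord0 + c`_1 * x ord_max.
Proof.
by rewrite /comb !big_ord_recl big_ord0 addr0; congr (_ * x _ + _ * x _); apply: val_inj.
Qed.

Lemma cls3_neg c : c \in cls3 -> forall x, clause_sum vs3 top3 c x <= 0.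
Proof.
move=> cc x; suff : all (fun c => clause_sum vs3 top3 c x <= 0) cls3 by move/allP/(_ c cc).
rewrite /cls3 /clause_sum /gap /= !(big_cons, big_nil) !comb3 /top3 /=.
move: (x o0) (x o1) (x o2) => a b c0; clear.
(* Every clause sum is minus a nonnegative combination of these four squares. *)
have ha := sqr_ge0 a; have hb := sqr_ge0 b; have h1 := sqr_ge0 (a + b); have h2 := sqr_ge0 (a - b).
by do 25! [apply/andP; split; first by lra].
Qed.

Lemma cls2_neg c : c \in cls2 -> forall x, clause_sum vs2 (fun _ => ord_max) c x <= 0.
Proof.
rewrite inE => /eqP -> x; rewrite /clause_sum /gap /= !(big_cons, big_nil) !comb2 /=.
move: (x ord0) (x ord_max) => a b; have ha := sqr_ge0 a; lra.
Qed.

Lemma ord3P (i : 'I_3) : [\/ i = o0, i = o1 | i = o2].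
Proof.
by case: i => [[|[|[|i]]]] // p; [apply: Or31|apply: Or32|apply: Or33]; apply: val_inj.
Qed.

Lemma top3_supp i : (i < size vs3)%N -> (nth [::] vs3 i)`_(top3 i) != 0 /\
  forall j : 'I_3, (top3 i < j)%N -> (nth [::] vs3 i)`_j = 0.
Proof. by do 10! [case: i => [|i]; first by split => // -[[|[|[|j]]]]]. Qed.

Lemma pr3P (i j : 'I_3) (e : bool) : (i < j)%N -> (pr3 i j e < size vs3)%N /\
  forall x : 'I_3 -> int, (comb (nth [::] vs3 (pr3 i j e)) x) ^+ 2 = (x j + (-1) ^+ e * x i) ^+ 2.
Proof.
move=> ij; split; first by move: ij; case: (ord3P i) => ->; case: (ord3P j) => ->; case: e.
move=> x; rewrite comb3; move: ij; case: (ord3P i) => ->; case: (ord3P j) => -> //= _; rewrite /pr3 /=;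
  by case: e => /=; rewrite ?expr1 ?expr0; ring.
Qed.

Lemma pr3_top (i j : 'I_3) (e : bool) : (i < j)%N -> top3 (pr3 i j e) = j.
Proof. by case: (ord3P i) => ->; case: (ord3P j) => ->; case: e. Qed.

Lemma top2_supp i : (i < size vs2)%N -> (nth [::] vs2 i)`_(ord_max : 'I_2) != 0 /\
  forall j : 'I_2, ((ord_max : 'I_2) < j)%N -> (nth [::] vs2 i)`_j = 0.
Proof. by do 2! [case: i => [|i]; first by split => // -[[|[|j]]]]. Qed.

Lemma pr2P (i j : 'I_2) (e : bool) : (i < j)%N -> (pr2 i j e < size vs2)%N /\
  forall x : 'I_2 -> int, (comb (nth [::] vs2 (pr2 i j e)) x) ^+ 2 = (x j + (-1) ^+ e * x i) ^+ 2.
Proof.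
move=> ij; split; first by case: e.
have -> : i = ord0 by apply: val_inj; have := ltn_ord j; rewrite /=; lia.
have -> : j = ord_max by apply: val_inj; have := ltn_ord j; rewrite /=; lia.
by move=> x; rewrite comb2 /pr2; case: e => /=; rewrite ?expr1 ?expr0; ring.
Qed.

Lemma pr2_top (i j : 'I_2) (e : bool) : (i < j)%N -> ord_max = j.
Proof. by move=> ij; apply: val_inj; have := ltn_ord j; rewrite /=; lia. Qed.

Theorem exact_pos3 (V : lmodType rat) p (f : seq (line 3) -> V) : alt 6 p.+1 f -> dd f = (fun _ => 0) ->
  exists f', alt 6 p f' /\ dd f' = f.
Proof. exact: (exact_pos vs3_ok vs3_cover tables3 erefl top3_supp pr3P pr3_top isT cls3_neg). Qed.

Theorem exact_zero3 (V : lmodType rat) (f : seq (line 3) -> V) : alt 6 0 f -> dd f = (fun _ => 0) ->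
  f (critical_cell vs3 crit3 (b0 (k := 2))) = 0 -> f = fun _ => 0.
Proof. exact: (exact_zero vs3_ok vs3_cover tables3 erefl top3_supp pr3P pr3_top isT cls3_neg). Qed.

Theorem exact_pos2 (V : lmodType rat) p (f : seq (line 2) -> V) : alt 3 p.+1 f -> dd f = (fun _ => 0) ->
  exists f', alt 3 p f' /\ dd f' = f.
Proof. exact: (exact_pos vs2_ok vs2_cover tables2 erefl top2_supp pr2P pr2_top isT cls2_neg). Qed.

Theorem exact_zero2 (V : lmodType rat) (f : seq (line 2) -> V) : alt 3 0 f -> dd f = (fun _ => 0) ->
  f (critical_cell vs2 crit2 (b0 (k := 1))) = 0 -> f = fun _ => 0.
Proof. exact: (exact_zero vs2_ok vs2_cover tables2 erefl top2_supp pr2P pr2_top isT cls2_neg). Qed.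

End Instances.

(** * Dimensions of quotients of spaces of functions *)

Section QuotientDimension.
Local Open Scope ring_scope.
Variable V : lmodType rat.

(** The shape of [hdim] for arbitrary cocycles Z and coboundaries B. They are predicates because the
    cochain spaces have infinite dimension and only the quotients are finite. *)
Definition dimq (X : Type) (Z B : (X -> V) -> Prop) (r : nat) : Prop :=
  exists z : 'I_r -> (X -> V),
    (forall k, Z (z k)) /\
    (forall f, Z f -> exists c : 'I_r -> rat, B (fun x => f x - \sum_(k < r) c k *: z k x)) /\
    (forall c : 'I_r -> rat, B (fun x => \sum_(k < r) c k *: z k x) -> forall k, c k = 0).

Definition lin (X Y : Type) (F : (X -> V) -> (Y -> V)) : Prop :=
  forall a f g, F (fun x => a *: f x + g x) = fun y => a *: F f y + F g y.

Definition subspace (X : Type) (K : (X -> V) -> Prop) : Prop :=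
  K (fun _ => 0) /\ forall a f g, K f -> K g -> K (fun x => a *: f x + g x).

Section Lin.
Variables (X Y : Type) (F : (X -> V) -> (Y -> V)) (linF : lin F).

Lemma lin0 : F (fun _ => 0) = fun _ => 0.
Proof.
have := linF (-1) (fun _ => 0) (fun _ => 0); rewrite (_ : (fun _ => _) = fun _ : X => 0).
  by move=> E; apply: funext => y; rewrite {1}E scaleN1r addNr.
by apply: funext => x; rewrite scaler0 addr0.
Qed.

Lemma linB f g : F (fun x => f x - g x) = fun y => F f y - F g y.
Proof.
have := linF (-1) g f; rewrite (_ : (fun _ => _) = fun x => f x - g x) => [->|].
  by apply: funext => y; rewrite scaleN1r addrC.
by apply: funext => x; rewrite scaleN1r addrC.
Qed.

Lemma lin_sum r (c : 'I_r -> rat) (z : 'I_r -> X -> V) :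
  F (fun x => \sum_k c k *: z k x) = fun y => \sum_k c k *: F (z k) y.
Proof.
elim: r c z => [|r IH] c z.
  rewrite (_ : (fun _ => _) = fun _ : X => 0); last by apply: funext => x; rewrite big_ord0.
  by rewrite lin0; apply: funext => y; rewrite big_ord0.
rewrite (_ : (fun _ => _) = fun x => c ord0 *: z ord0 x + \sum_k c (lift ord0 k) *: z (lift ord0 k) x).
  by rewrite linF IH; apply: funext => y; rewrite big_ord_recl.
by apply: funext => x; rewrite big_ord_recl.
Qed.
Lemma linB_sum f r (c : 'I_r -> rat) (z : 'I_r -> X -> V) :
  (fun y => F f y - \sum_k c k *: F (z k) y) = F (fun x => f x - \sum_k c k *: z k x).
Proof. by rewrite linB lin_sum. Qed.
End Lin.

Lemma subspaceB X (K : (X -> V) -> Prop) f g : subspace K -> K f -> K g -> K (fun x => f x - g x).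
Proof.
move=> [_ H] Kf Kg; have := H (-1) g f Kg Kf.
by rewrite (_ : (fun _ => _) = fun x => f x - g x) //;
  apply: funext => x; rewrite scaleN1r addrC.
Qed.

Lemma subspace_sum X (K : (X -> V) -> Prop) r (c : 'I_r -> rat) z : subspace K ->
  (forall k, K (z k)) -> K (fun x => \sum_k c k *: z k x).
Proof.
move=> [K0 KD]; elim: r c z => [|r IH] c z Kz.
  by rewrite (_ : (fun _ => _) = fun _ : X => 0) //; apply: funext => x; rewrite big_ord0.
rewrite (_ : (fun _ => _) = fun x => c ord0 *: z ord0 x + \sum_k c (lift ord0 k) *: z (lift ord0 k) x).
  by apply: KD => //; apply: IH.
by apply: funext => x; rewrite big_ord_recl.
Qed.

Lemma dimq_ext X (Z B Z' B' : (X -> V) -> Prop) r : (forall f, Z f <-> Z' f) -> (forall f, B f <-> B' f) ->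
  dimq Z B r -> dimq Z' B' r.
Proof.
move=> EZ EB [z [H1 [H2 H3]]]; exists z; split; first by move=> k; apply/EZ.
split=> [f /EZ/H2[c /EB Hc]|c /EB]; first by exists c.
exact: H3.
Qed.

Lemma dimq_iso X Y (F : (X -> V) -> (Y -> V)) (Z B : (X -> V) -> Prop) (Z' B' : (Y -> V) -> Prop) r :
  lin F -> (forall f g, F f = F g -> f = g) ->
  (forall f, Z' f <-> exists2 h, Z h & f = F h) -> (forall f, B' f <-> exists2 h, B h & f = F h) ->
  dimq Z B r <-> dimq Z' B' r.
Proof.
move=> linF injF EZ EB; split=> -[z [H1 [H2 H3]]].
  exists (fun k => F (z k)); split; first by move=> k; apply/EZ; exists (z k).
  split=> [f /EZ[h Zh ->]|c].
    have [c Bc] := H2 h Zh; exists c; apply/EB; eexists; first exact: Bc.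
    by rewrite linB // lin_sum.
  by rewrite -lin_sum // => /EB[h Bh /injF E]; apply: H3; rewrite E.
have /choice[y Hy] k : exists h, Z h /\ z k = F h by have /EZ[h] := H1 k; exists h.
have Ez : z = fun k => F (y k) by apply: funext => k; case: (Hy k).
exists y; split; first by move=> k; case: (Hy k).
split=> [f Zf|c Bc].
  have [|c] := H2 (F f); first by apply/EZ; exists f.
  rewrite Ez (linB_sum linF) => /EB[h Bh /injF E]; exists c; by rewrite E.
by apply: H3; rewrite Ez -lin_sum //; apply/EB; eexists; first exact: Bc.
Qed.

(* The zigzag step: both quotients are K1 modulo ker dl + ker d. *)
Lemma dimq_zigzag X X1 X2 (dl : (X -> V) -> (X1 -> V)) (d : (X -> V) -> (X2 -> V))
    (K K1 : (X -> V) -> Prop) Z1 B1 Z2 B2 r :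
  lin dl -> lin d -> subspace K -> subspace K1 -> (forall f, K1 f -> K f) ->
  (forall f, Z1 f <-> exists2 h, K1 h & f = dl h) -> (forall f, Z2 f <-> exists2 h, K1 h & f = d h) ->
  (forall f, B1 f <-> exists h, [/\ K h, d h = (fun _ => 0) & f = dl h]) ->
  (forall f, B2 f <-> exists h, [/\ K h, dl h = (fun _ => 0) & f = d h]) ->
  dimq Z2 B2 r -> dimq Z1 B1 r.
Proof.
move=> ldl ld sK sK1 K1K E1 E2 EB1 EB2 [z [H1 [H2 H3]]].
have /choice[y Hy] k : exists h, K1 h /\ z k = d h by have /E2[h] := H1 k; exists h.
have Ez : z = fun k => d (y k) by apply: funext => k; case: (Hy k).
have Ky k : K1 (y k) by case: (Hy k).
have Ksum c : K1 (fun x => \sum_k c k *: y k x) by apply: subspace_sum.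
exists (fun k => dl (y k)); split; first by move=> k; apply/E1; exists (y k).
split=> [f /E1[h K1h ->]|c].
  have [|c] := H2 (d h); first by apply/E2; exists h.
  rewrite Ez (linB_sum ld) => /EB2[e [Ke e0 Ee]]; exists c.
  apply/EB1; rewrite (linB_sum ldl).
  exists (fun x => (h x - \sum_k c k *: y k x) - e x); split.
  - by apply: subspaceB => //; apply: K1K; apply: subspaceB.
  - by rewrite (linB ld) Ee; apply: funext => x; rewrite subrr.
  by rewrite [RHS](linB ldl) e0; apply: funext => x; rewrite subr0.
rewrite -lin_sum // => /EB1[e [Ke e0 Ee]]; apply: H3; rewrite Ez -lin_sum //; apply/EB2.
exists (fun x => \sum_k c k *: y k x - e x); split.
- by apply: subspaceB => //; apply: K1K.
- by rewrite (linB ldl) Ee; apply: funext => x; rewrite subrr.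
by rewrite [RHS](linB ld) e0; apply: funext => x; rewrite subr0.
Qed.

End QuotientDimension.

Section AlternatingFaceSum.
Local Open Scope ring_scope.
Variables (G : Type) (V : lmodType rat).

Definition faced q (x : 'I_q.+2 -> G) (j : 'I_q.+2) : 'I_q.+1 -> G := fun i => x (lift j i).

Lemma bump_bump i j l : (i <= j)%N -> bump i (bump j l) = bump j.+1 (bump i l).
Proof. rewrite /bump; lia. Qed.

(** The terms with i <= j cancel those with j < i through (i, j) -> (j + 1, i): the simplicial
    identity behind delta delta = 0. *)
Lemma alternating_cancel n (F : nat -> nat -> V) :
  (forall i j, (i <= j)%N -> F i j = - F j.+1 i) ->
  \sum_(i < n.+1) \sum_(j < n) F i j = 0.
Proof.
move=> H.
have E : \sum_(i < n.+1) \sum_(j < n) F i j =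
   \sum_(i < n.+1) (\sum_(j < n | (j < i)%N) F i j + \sum_(j < n | (i <= j)%N) F i j).
  apply: eq_bigr => i _; rewrite (bigID (fun j : 'I_n => (j < i)%N)) /=; congr (_ + _).
  by apply: eq_bigl => j; rewrite -leqNgt.
rewrite E big_split /=.
have -> : \sum_(i < n.+1) \sum_(j < n | (j < i)%N) F i j = \sum_(j < n) \sum_(i < n | (j <= i)%N) F i.+1 j.
  rewrite (exchange_big_dep xpredT) //=; apply: eq_bigr => j _.
  by rewrite big_mkcond big_ord_recl /= add0r [RHS]big_mkcond; apply: eq_bigr => i _.
have -> : \sum_(i < n.+1) \sum_(j < n | (i <= j)%N) F i j = \sum_(i < n) \sum_(j < n | (i <= j)%N) F i j.
  rewrite big_ord_recr /= [X in _ + X]big1 ?addr0 // => j; rewrite leqNgt ltn_ord //.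
rewrite -big_split big1 //= => i _; rewrite -big_split big1 //= => j ij.
by rewrite [F i j]H // subrr.
Qed.

End AlternatingFaceSum.

(** * Comparison with the standard complex *)

Section DoubleComplex.
Local Open Scope ring_scope.
Variables (m N : nat) (V : lmodType rat) (rho : GLZ m -> {linear V -> V}).
Hypothesis rhoM : forall g h v, rho (GLZmul m g h) v = rho g (rho h v).
Variables (chi : GLZ m -> rat) (o : seq (line m) -> rat) (s0 : seq (line m)).
Hypothesis chiM : forall g h, chi (GLZmul m g h) = chi g * chi h.
Hypothesis chi1 : chi (GL1 m) = 1.
Hypothesis o_alt : alt N (V := rat^o) 0 o.
Hypothesis o_closed : dd (V := rat^o) o = fun _ => 0.
Hypothesis o_act : forall g s, o (map (lact g) s) = chi g * o s.
Hypothesis o_s0 : o s0 != 0.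
Hypothesis ex_pos : forall p (f : seq (line m) -> V), alt N p.+1 f -> dd f = (fun _ => 0) ->
  exists f', alt N p f' /\ dd f' = f.
Hypothesis ex_zero : forall f : seq (line m) -> V, alt N 0 f -> dd f = (fun _ => 0) ->
  f s0 = 0 -> f = fun _ => 0.

Local Notation tr g x := (fun i => GLZmul m g (x i)).
Local Notation act_seq g s := (map (lact g) s).
Definition cell q := (('I_q.+1 -> GLZ m) * seq (line m))%type.
Implicit Types (g : GLZ m) (s t : seq (line m)).

Lemma chi_neq0 g : chi g != 0.
Proof.
by apply: contraTneq (oner_neq0 rat) => E; rewrite -chi1 -(GLmulrV g) chiM E mul0r eqxx.
Qed.

(* B is the complex of equivariant cochains on the cells, A the standard complex, K the double complex; [o] spans H^0. *)
Definition InB p (b : seq (line m) -> V) : Prop :=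
  alt N p b /\ forall g s, b (act_seq g s) = chi g *: rho g (b s).
Definition ZB p b := InB p b /\ dd b = fun _ => 0.
Definition BB p : (seq (line m) -> V) -> Prop :=
  if p is p'.+1 then fun b => exists2 h, InB p' h & b = dd h else fun b => b = fun _ => 0.

Definition InA i (f : ('I_i.+1 -> GLZ m) -> V) : Prop := forall g x, f (tr g x) = rho g (f x).
Definition dA i (f : ('I_i.+1 -> GLZ m) -> V) : ('I_i.+2 -> GLZ m) -> V :=
  fun x => \sum_(j < i.+2) (-1) ^+ j *: f (faced x j).
Definition ZA i f := @InA i f /\ dA f = fun _ => 0.
Definition BA i : (('I_i.+1 -> GLZ m) -> V) -> Prop :=
  if i is i'.+1 then fun f => exists2 h, @InA i' h & f = dA h else fun f => f = fun _ => 0.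

Definition InK q p (f : cell q -> V) : Prop :=
  (forall x, alt N p (fun s => f (x, s))) /\
  (forall g x s, f (tr g x, act_seq g s) = chi g *: rho g (f (x, s))).
Definition dK q (f : cell q -> V) : cell q -> V := fun y => dd (fun s => f (y.1, s)) y.2.
Definition deltaK q (f : cell q -> V) : cell q.+1 -> V :=
  fun y => \sum_(j < q.+2) (-1) ^+ j *: f (faced y.1 j, y.2).

Lemma lin_dd : lin (@dd m V).
Proof.
move=> a f g; apply: funext => s.
by rewrite /dd big_split /= scaler_sumr.
Qed.
Lemma lin_dK q : lin (@dK q).
Proof.
move=> a f g; apply: funext => -[x s].
exact: (congr1 (fun F => F s) (lin_dd a (fun s => f (x, s)) (fun s => g (x, s)))).
Qed.
Lemma lin_deltaK q : lin (@deltaK q).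
Proof.
move=> a f g; apply: funext => -[x s].
rewrite /deltaK scaler_sumr -big_split; apply: eq_bigr => j _ /=.
by rewrite scalerDr !scalerA [_ * a]mulrC.
Qed.

Lemma alt_lin p a (f g : seq (line m) -> V) : alt N p f -> alt N p g -> alt N p (fun s => a *: f s + g s).
Proof.
move=> [f1 f2] [g1 g2]; split=> [s|s t st]; last first.
  by rewrite (f2 _ _ st) (g2 _ _ st) scalerDr !scalerA [a * _]mulrC.
have [E|/f1 //] := eqVneq (f s) 0; have [E'|/g1 //] := eqVneq (g s) 0.
by rewrite E E' scaler0 addr0 eqxx.
Qed.

Lemma alt_comp p g (L : {linear V -> V}) f : alt N p f -> alt N p (fun s => L (f (act_seq g s))).
Proof.
move=> [f1 f2]; split=> [s|s t st].
  have [->|/f1[us sz _]] := eqVneq (f (act_seq g s)) 0; first by rewrite linear0 eqxx.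
  by move: us sz; rewrite uni_act size_map.
rewrite (f2 _ _ (perm_map _ st)) linearZ /=.
have [us|nus] := boolP (uniq s); first by rewrite eps_map //; apply: lact_inj.
suff -> : f (act_seq g s) = 0 by rewrite linear0 !scaler0.
apply/eqP; apply: contraNT nus => /f1[/uni_uniq].
by rewrite map_inj_uniq //; apply: lact_inj.
Qed.

Lemma dd_comp g (L : {linear V -> V}) f s :
  dd (fun s => L (f (act_seq g s))) s = L (dd f (act_seq g s)).
Proof. by rewrite /dd linear_sum (perm_big _ (ext_act g s)) big_map. Qed.

Lemma subspace_InK q p : subspace (@InK q p).
Proof.
split=> [|a f g [f1 f2] [g1 g2]].
  by split=> [x|g x s]; [exact: alt0|rewrite linear0 scaler0].
split=> [x|h x s]; first exact: alt_lin.
by rewrite f2 g2 linearD [rho h (a *: _)]linearZ /= scalerDr !scalerA [a * _]mulrC.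
Qed.

Lemma InK_dK q p f : @InK q p f -> @InK q p.+1 (dK f).
Proof.
move=> [f1 f2]; split=> [x|g x s]; first exact: alt_dd (f1 x).
rewrite /dK /= /dd (perm_big _ (ext_act g s)) big_map linear_sum scaler_sumr.
by apply: eq_bigr => v _; rewrite -f2.
Qed.

Lemma faced_tr q g (x : 'I_q.+2 -> GLZ m) j : faced (tr g x) j = tr g (faced x j).
Proof. by []. Qed.

Lemma InK_deltaK q p f : @InK q p f -> @InK q.+1 p (deltaK f).
Proof.
move=> Kf; have [f1 f2] := Kf; split=> [x|g x s].
  have : forall r (js : 'I_r -> 'I_q.+2), alt N p (fun s => \sum_(k < r) (-1) ^+ js k *: f (faced x (js k), s)).
    elim=> [|r IH] js.
      rewrite (_ : (fun _ => _) = fun _ => 0); first exact: alt0.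
      by apply: funext => s; rewrite big_ord0.
    rewrite (_ : (fun _ => _) = fun s => (-1) ^+ js ord0 *: f (faced x (js ord0), s) +
       \sum_(k < r) (-1) ^+ js (lift ord0 k) *: f (faced x (js (lift ord0 k)), s)).
      by apply: alt_lin => //; apply: (IH (fun k => js (lift ord0 k))).
    by apply: funext => s; rewrite big_ord_recl.
  exact.
rewrite /deltaK /= linear_sum scaler_sumr; apply: eq_bigr => j _.
by rewrite faced_tr f2 [in RHS]linearZ /= !scalerA; congr (_ *: _); apply: mulrC.
Qed.

Lemma dK_deltaK q f : dK (@deltaK q f) = deltaK (dK f).
Proof.
apply: funext => -[x s]; rewrite /dK /deltaK /dd /=.
by rewrite exchange_big; apply: eq_bigr => j _; rewrite scaler_sumr.
Qed.

Lemma dK_dK q p f : @InK q p f -> dK (dK f) = fun _ => 0.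
Proof.
move=> [f1 _]; apply: funext => -[x s].
exact: (congr1 (fun F => F s) (dd_dd (f1 x))).
Qed.

Lemma deltaK_deltaK q f : deltaK (@deltaK q f) = fun _ => 0.
Proof.
apply: funext => -[x s]; rewrite /deltaK /=.
pose F (i j : nat) : V := (-1) ^+ (i + j) *: f (fun k : 'I_q.+1 => x (inord (bump i (bump j k))), s).
rewrite -[RHS](@alternating_cancel V q.+2 F).
  apply: eq_bigr => i _; rewrite scaler_sumr; apply: eq_bigr => j _.
  rewrite scalerA -exprD /F; congr (_ *: f (_, s)); apply: funext => k.
  by rewrite /faced; congr x; apply: val_inj; rewrite /= inordK //; apply: ltn_ord (lift i (lift j k)).
move=> i j ij; rewrite /F addSn exprS mulN1r scaleNr opprK addnC; congr (_ *: f (_, s)).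
by apply: funext => k; rewrite bump_bump.
Qed.

Definition cons_pt q g (x : 'I_q -> GLZ m) : 'I_q.+1 -> GLZ m :=
  fun i => if unlift ord0 i is Some j then x j else g.

Lemma faced_cons0 q g (x : 'I_q.+1 -> GLZ m) : faced (cons_pt g x) ord0 = x.
Proof. by apply: funext => i; rewrite /faced /cons_pt liftK. Qed.

Lemma faced_consS q g (x : 'I_q.+2 -> GLZ m) j : faced (cons_pt g x) (lift ord0 j) = cons_pt g (faced x j).
Proof.
apply: funext => i; rewrite /faced /cons_pt.
case: (unliftP ord0 i) => [k ->|->].
  have -> : lift (lift ord0 j) (lift ord0 k) = lift ord0 (lift j k) by apply: val_inj; rewrite /= /bump /=; lia.
  by rewrite !liftK.
have -> : lift (lift ord0 j) ord0 = ord0 by apply: val_inj.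
by rewrite unlift_none.
Qed.

Lemma cons_tr q g h (x : 'I_q -> GLZ m) : tr g (cons_pt h x) = cons_pt (GLZmul m g h) (tr g x).
Proof. by apply: funext => i; rewrite /cons_pt; case: unlift. Qed.

Lemma frames_size_act g s : size (frames (act_seq g s)) = size (frames s).
Proof. by rewrite (perm_size (frames_act g s)) size_map. Qed.

(** Inserting a first vertex g contracts the complex but is not equivariant for a fixed g. Averaging
    over the frames of s, a finite nonempty set that moves with s, makes it so; the division uses
    rational coefficients. *)
Lemma delta_exact q p f : @InK q.+1 p f -> deltaK f = (fun _ => 0) ->
  exists2 h, @InK q p h & deltaK h = f.
Proof.
move=> [f1 f2] df.
pose h (y : cell q) : V := ((size (frames y.2))%:R)^-1 *: \sum_(g <- frames y.2) f (cons_pt g y.1, y.2).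
have f0 x s : ~ uni s -> f (x, s) = 0.
  by move=> nus; apply/eqP; apply: contraT => /(proj1 (f1 x))[].
exists h; first split=> [x|g x s]; first split=> [s hs|s t st].
- have /hasP[g _ /(proj1 (f1 _)) //] : has (fun g => f (cons_pt g x, s) != 0) (frames s).
  apply: contraNT hs => /hasPn H; rewrite /h /= big_seq big1 ?scaler0 // => g /H.
  by rewrite negbK => /eqP.
- rewrite /h /= -(perm_size (frames_perm st)) -(perm_big _ (frames_perm st)).
  rewrite scalerA [_ * _^-1]mulrC -scalerA; congr (_ *: _); rewrite scaler_sumr.
  by apply: eq_bigr => g _; rewrite (proj2 (f1 _) _ _ st).
- rewrite /h /= frames_size_act (perm_big _ (frames_act g s)) big_map linearZ scalerA [chi g * _]mulrC -scalerA.
  congr (_ *: _); rewrite linear_sum scaler_sumr; apply: eq_bigr => h' _.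
  by rewrite -f2 cons_tr.
apply: funext => -[x s]; rewrite /deltaK /h /=.
have [us|nus] := excluded_middle_informative (uni s); last first.
  rewrite f0 // big1 // => j _; rewrite big1 ?scaler0 // => g _; exact: f0.
under eq_bigr do rewrite scalerA mulrC -scalerA scaler_sumr.
rewrite -scaler_sumr exchange_big /=.
have E g : \sum_(j < q.+2) (-1) ^+ j *: f (cons_pt g (faced x j), s) = f (x, s).
  have := congr1 (fun F => F (cons_pt g x, s)) df; rewrite /deltaK /= big_ord_recl expr0 scale1r faced_cons0.
  move=> /eqP; rewrite addr_eq0 => /eqP ->; rewrite -sumrN; apply: eq_bigr => j _.
  by rewrite faced_consS -scaleNr /= -[bump 0 j]/(j.+1) exprS mulN1r opprK.
rewrite (eq_bigr (fun _ => f (x, s))) => [|g _]; last exact: E.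
rewrite big_const_seq count_predT iter_addr_0 -scaler_nat scalerA mulVf ?scale1r //.
by rewrite pnatr_eq0 size_eq0 frames_uni.
Qed.

(** The group acts freely on first vertices. So primitives, chosen without regard to equivariance,
    are used only at tuples translated to first vertex 1, and are carried to the other tuples by the
    twisted action. *)
Lemma d_exact q p f : @InK q p.+1 f -> dK f = (fun _ => 0) -> exists2 h, @InK q p h & dK h = f.
Proof.
move=> [f1 f2] df.
have /choice[c Hc] x : exists h : seq (line m) -> V, alt N p h /\ dd h = fun s => f (x, s).
  apply: ex_pos; first exact: f1.
  by apply: funext => s; apply: (congr1 (fun F => F (x, s)) df).
pose h (y : cell q) : V := chi (y.1 ord0) *: rho (y.1 ord0)
   (c (tr (GLinv (y.1 ord0)) y.1) (act_seq (GLinv (y.1 ord0)) y.2)).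
exists h; first split=> [x|g x s].
- rewrite /h /=; set g := x ord0; have := alt_comp (GLinv g) (rho g) (proj1 (Hc (tr (GLinv g) x))).
  move=> H; have := alt_lin (chi g) H (@alt0 m N V p); congr (alt _ _ _).
  by apply: funext => s; rewrite addr0.
- rewrite /h /= rhoM chiM linearZ !scalerA; congr (_ *: rho g (rho _ (c _ _))).
    apply: funext => i;
    apply: (@GLmul_inj _ (GLZmul m g (x ord0))).
    by rewrite GLmulVK -GLmulA GLmulVK.
  rewrite -map_comp; apply: eq_map => l /=; apply: (@lact_inj _ (GLZmul m g (x ord0))).
  by rewrite lactVK lactM lactVK.
apply: funext => -[x s]; rewrite /dK /h /=; set g := x ord0.
have -> : dd (fun s => chi g *: rho g (c (tr (GLinv g) x) (act_seq (GLinv g) s))) s =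
    chi g *: dd (fun s => rho g (c (tr (GLinv g) x) (act_seq (GLinv g) s))) s by rewrite /dd scaler_sumr.
rewrite dd_comp (proj2 (Hc _)) -f2; congr f; congr pair.
  by apply: funext => i; rewrite GLmulVK.
by rewrite -map_comp (eq_map (lactVK g)) map_id.
Qed.

Definition ZK p q f := [/\ @InK q p f, dK f = (fun _ => 0) & deltaK f = (fun _ => 0)].
Definition B1 p q : (cell q -> V) -> Prop :=
  if q is q'.+1 then fun f => exists h, [/\ @InK q' p h, dK h = (fun _ => 0) & f = deltaK h]
  else fun f => f = fun _ => 0.
Definition B2 p q : (cell q -> V) -> Prop :=
  if p is p'.+1 then fun f => exists h, [/\ @InK q p' h, deltaK h = (fun _ => 0) & f = dK h]
  else fun f => f = fun _ => 0.

(** By exactness in the other direction, each side consists of the images of [dK] composed with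
    [deltaK]. *)
Lemma B1_B2 p q (f : cell q.+1 -> V) : @B1 p.+1 q.+1 f <-> @B2 p.+1 q.+1 f.
Proof.
split=> -[h [Kh h0 ->]].
  have [e Ke Ee] := d_exact Kh h0; exists (deltaK e); split; first exact: InK_deltaK.
    exact: deltaK_deltaK.
  by rewrite dK_deltaK Ee.
have [e Ke Ee] := delta_exact Kh h0; exists (dK e); split; first exact: InK_dK.
  exact: dK_dK Ke.
by rewrite -dK_deltaK Ee.
Qed.

Lemma zigzag p q r : dimq (ZK p.+1 (q := q)) (@B2 p.+1 q) r -> dimq (ZK p (q := q.+1)) (@B1 p q.+1) r.
Proof.
apply: (dimq_zigzag (dl := @deltaK q) (d := @dK q) (K := @InK q p)
   (K1 := fun f => @InK q p f /\ dK (deltaK f) = fun _ => 0)).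
- exact: lin_deltaK.
- exact: lin_dK.
- exact: subspace_InK.
- have [K0 KD] := subspace_InK q p; split.
    split=> //; rewrite (lin0 (@lin_deltaK q)) (lin0 (@lin_dK q.+1)); by [].
  move=> a f g [Kf f0] [Kg g0]; split; first exact: KD.
  rewrite lin_deltaK lin_dK f0 g0; apply: funext => y.
  by rewrite scaler0 addr0.
- by move=> f [].
- move=> f; split=> [[Kf df lf]|[h [Kh h0] ->]].
    by have [h Kh E] := delta_exact Kf lf; exists h; rewrite ?E.
  by split=> //; [apply: InK_deltaK|apply: deltaK_deltaK].
- move=> f; split=> [[Kf df lf]|[h [Kh h0] ->]].
    have [h Kh E] := d_exact Kf df; exists h => //; split => //.
    by rewrite dK_deltaK E.
  by split=> //; [apply: InK_dK|apply: dK_dK Kh|rewrite -dK_deltaK].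
- by [].
by [].
Qed.

(** The steps stay on the antidiagonal of total degree p + q, and start from the edge q = 0, where
    the cell complex sits. With p = 0 they end at the standard complex. *)
Lemma zigzag_all p q r : dimq (ZK (p + q) (q := 0)) (@B2 (p + q) 0) r ->
  dimq (ZK p (q := q)) (if q is _.+1 then @B1 p q else @B2 p q) r.
Proof.
elim: q p => [|q IH] p; first by rewrite addn0.
rewrite addnS -addSn => /IH H; apply: zigzag; move: H; case: q IH => // q IH.
by apply: dimq_ext => // f; apply: B1_B2.
Qed.

Definition const_pt (b : seq (line m) -> V) : cell 0 -> V := fun y => b y.2.

Lemma delta_const (f : cell 0 -> V) : deltaK f = (fun _ => 0) -> forall x y s, f (x, s) = f (y, s) :> V.
Proof.
move=> df x y s; pose z : 'I_2 -> GLZ m := fun i => if i == ord0 then x ord0 else y ord0.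
have := congr1 (fun F => F (z, s)) df.
rewrite /deltaK /= big_ord_recl big_ord1 expr0 scale1r expr1 scaleN1r => /eqP.
rewrite subr_eq0 => /eqP E; symmetry; move: E; congr (f (_, s) = f (_, s));
  by apply: funext => i; rewrite (ord1 i).
Qed.

Lemma InB_const p b : InB p b <-> @InK 0 p (const_pt b).
Proof.
split=> [[b1 b2]|[b1 b2]]; split.
- by move=> x; apply: b1.
- by move=> g x s; apply: b2.
- exact: (b1 (fun _ => GL1 m)).
by move=> g s; apply: (b2 g (fun _ => GL1 m) s).
Qed.

Lemma const_ptE p f : @InK 0 p f -> deltaK f = (fun _ => 0) ->
  f = const_pt (fun s => f (fun _ => GL1 m, s)).
Proof.
by move=> Kf df; apply: funext => -[x s]; apply: delta_const.
Qed.

Lemma delta_const_pt b : deltaK (const_pt b) = fun _ => 0.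
Proof.
apply: funext => -[x s].
by rewrite /deltaK big_ord_recl big_ord1 expr0 scale1r expr1 scaleN1r subrr.
Qed.

Lemma dimq_B i r : dimq (@ZB i) (@BB i) r <-> dimq (ZK i (q := 0)) (@B2 i 0) r.
Proof.
apply: (dimq_iso (F := const_pt)).
- by move=> a f g.
- move=> f g E; apply: funext => s.
  exact: (congr1 (fun F => F (fun _ => GL1 m, s)) E).
- move=> f; split=> [[Kf df lf]|[h [/InB_const Kh h0] ->]].
    have E := const_ptE Kf lf; rewrite E in Kf df.
    exists (fun s => f (fun _ => GL1 m, s)) => //; split; first exact/InB_const.
    by apply: funext => s; apply: (congr1 (fun F => F (fun _ => GL1 m, s)) df).
  split => //; last exact: delta_const_pt.
  apply: funext => -[x s]; exact: (congr1 (fun F => F s) h0).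
case: i => [|i] f /=.
  split=> [->|[h -> ->] //]; by exists (fun _ => 0).
split=> [[h [Kh lh ->]]|[h [h' /InB_const Kh' ->] ->]].
  have E := const_ptE Kh lh; exists (dd (fun s => h (fun _ => GL1 m, s))); last by rewrite {1}E.
  by eexists; last reflexivity; apply/InB_const; rewrite -E.
exists (const_pt h'); split => //; exact: delta_const_pt.
Qed.

(** Multiplication by the class o absorbs the twist, since o (g s) = chi g o (s): untwisted standard
    cochains become the twisted ones of cell degree 0 killed by [dK]. That all of these arise so is
    [scale_oE]. *)
Definition scale_o i (f : ('I_i.+1 -> GLZ m) -> V) : cell i -> V := fun y => o y.2 *: f y.1.

Lemma scale_o_inj i (f g : ('I_i.+1 -> GLZ m) -> V) : scale_o f = scale_o g -> f = g.
Proof.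
move=> E; apply: funext => x.
have := congr1 (fun F => F (x, s0)) E; rewrite /scale_o /= => /eqP.
by rewrite -subr_eq0 -scalerBr scaler_eq0 (negbTE o_s0) /= subr_eq0 => /eqP.
Qed.

Lemma dK_scale_o i (f : ('I_i.+1 -> GLZ m) -> V) : dK (scale_o f) = fun _ => 0.
Proof.
apply: funext => -[x s]; rewrite /dK /dd /scale_o /= -scaler_suml.
by have := congr1 (fun F => F s) o_closed; rewrite /dd => ->; rewrite scale0r.
Qed.

Lemma InA_scale i (f : ('I_i.+1 -> GLZ m) -> V) : @InA i f <-> @InK i 0 (scale_o f).
Proof.
have [o1 o2] := o_alt; split=> [Af|[f1 f2] g x].
  split=> [x|g x s]; last by rewrite /scale_o /= o_act Af linearZ scalerA.
  split=> [s|s t st]; rewrite /scale_o /=.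
    by rewrite scaler_eq0 negb_or => /andP[/o1].
  by rewrite (o2 _ _ st) scalerA.
have := f2 g x s0; rewrite /scale_o /= o_act linearZ /= !scalerA => /eqP.
rewrite -subr_eq0 -scalerBr scaler_eq0 mulf_eq0 (negbTE (chi_neq0 g)) (negbTE o_s0) /=.
by rewrite subr_eq0 => /eqP.
Qed.

Lemma scale_oE i f : @InK i 0 f -> dK f = (fun _ => 0) ->
  f = scale_o (fun x => (o s0)^-1 *: f (x, s0)).
Proof.
move=> [f1 f2] df; apply: funext => -[x s]; rewrite /scale_o /=.
set w := _ *: f (x, s0).
have H : alt N 0 (fun s => f (x, s) - o s *: w).
  apply: altB => //; have [o1 o2] := o_alt; split=> [t|t u tu].
    by rewrite scaler_eq0 negb_or => /andP[/o1].
  rewrite (o2 _ _ tu) ; apply/esym/scalerA.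
have /(congr1 (fun F => F s))/eqP : (fun s => f (x, s) - o s *: w) = fun _ => 0.
  apply: (ex_zero H); last by rewrite /w scalerA divff // scale1r subrr.
  apply: funext => t; rewrite /dd sumrB -scaler_suml.
  have := congr1 (fun F => F t) o_closed; rewrite /dd => ->; rewrite scale0r subr0.
  exact: (congr1 (fun F => F (x, t)) df).
by rewrite subr_eq0 => /eqP.
Qed.

Lemma delta_scale_o i (f : ('I_i.+1 -> GLZ m) -> V) : deltaK (scale_o f) = scale_o (dA f).
Proof.
apply: funext => -[x s]; rewrite /deltaK /scale_o /dA scaler_sumr.
by apply: eq_bigr => j _; rewrite !scalerA mulrC.
Qed.

Lemma dimq_A i r : dimq (@ZA i) (@BA i) r <->
  dimq (ZK 0 (q := i)) (if i is _.+1 then @B1 0 i else @B2 0 i) r.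
Proof.
apply: (dimq_iso (F := @scale_o i)).
- move=> a f g; apply: funext => y.
  by rewrite /scale_o scalerDr !scalerA mulrC.
- exact: scale_o_inj.
- move=> f; split=> [[Kf df lf]|[h [/InA_scale Kh h0] ->]].
    have E := scale_oE Kf df; rewrite E in Kf lf.
    eexists; last exact: E; split; first exact/InA_scale.
    apply: scale_o_inj; rewrite -delta_scale_o lf.
    by apply: funext => y; rewrite /scale_o scaler0.
  split => //; first exact: dK_scale_o.
  by rewrite delta_scale_o h0; apply: funext => y; rewrite /scale_o scaler0.
case: i => [|i] f /=.
  have Z : scale_o (fun _ : 'I_1 -> GLZ m => 0 : V) = fun _ => 0.
    by apply: funext => y; rewrite /scale_o scaler0.
  split=> [->|[h -> ->] //]; by exists (fun _ => 0).
split=> [[h [Kh dh ->]]|[h [h' /InA_scale Kh' ->] ->]].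
  have E := scale_oE Kh dh; rewrite E in Kh *; rewrite delta_scale_o.
  eexists; last reflexivity; eexists; last reflexivity; exact/InA_scale.
by exists (scale_o h'); split => //; [apply: dK_scale_o|rewrite delta_scale_o].
Qed.

Theorem dimq_compare i r : dimq (@ZB i) (@BB i) r -> dimq (@ZA i) (@BA i) r.
Proof. by move=> /dimq_B H; apply/dimq_A; apply: zigzag_all. Qed.

End DoubleComplex.

(** * Euler characteristic of a complex of finite-dimensional spaces *)

Lemma dep_choice (I : Type) (T : I -> Type) (P : forall p, T p -> Prop) :
  (forall p, exists x, P p x) -> exists f : forall p, T p, forall p, P p (f p).
Proof.
move=> H; exists (fun p => projT1 (constructive_indefinite_description _ (H p))) => p.
by case: constructive_indefinite_description.
Qed.

Section EulerCharacteristic.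
Local Open Scope ring_scope.
Variables (X : Type) (V : lmodType rat).
Notation zero := (fun _ : X => 0 : V).
Notation is_zero := (fun f : X -> V => f = zero).

Definition comb_of r (e : 'I_r -> X -> V) (u : 'rV[rat]_r) : X -> V := fun x => \sum_k u 0 k *: e k x.

Lemma comb_ofD r (e : 'I_r -> X -> V) u w : comb_of e (u + w) = fun x => comb_of e u x + comb_of e w x.
Proof.
apply: funext => x; rewrite -big_split; apply: eq_bigr => k _.
by rewrite mxE scalerDl.
Qed.

Lemma comb_of_mul r r' (e : 'I_r -> X -> V) (u : 'rV[rat]_r') (A : 'M[rat]_(r', r)) :
  comb_of e (u *m A) = fun x => \sum_k u 0 k *: comb_of e (row k A) x.
Proof.
apply: funext => x; rewrite /comb_of.
under eq_bigr do rewrite mxE scaler_suml.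
rewrite exchange_big; apply: eq_bigr => k _; rewrite scaler_sumr; apply: eq_bigr => j _.
by rewrite scalerA mxE.
Qed.

(* The subspaces [comb_of e @ ker M] and [comb_of e @ im A], with [im A] inside [ker M]. *)
Lemma dimq_mx r a c (e : 'I_r -> X -> V) (A : 'M[rat]_(a, r)) (M : 'M[rat]_(r, c)) (Z B : (X -> V) -> Prop) :
  injective (comb_of e) -> A *m M = 0 ->
  (forall f, Z f <-> exists2 u, u *m M = 0 & f = comb_of e u) ->
  (forall f, B f <-> exists u, f = comb_of e (u *m A)) ->
  dimq Z B (r - \rank M - \rank A).
Proof.
move=> inj AM EZ EB; pose C := (kermx M :\: A)%MS.
have Aker : (A <= kermx M)%MS by apply/sub_kermxP.
have rC : \rank C = (r - \rank M - \rank A)%N.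
  have := mxrank_cap_compl (kermx M) A; rewrite -/C mxrank_ker.
  have -> : \rank (kermx M :&: A)%MS = \rank A by rewrite (capmx_idPr Aker).
  lia.
rewrite -rC; exists (fun k => comb_of e (row k (row_base C))); split.
  move=> k; apply/EZ; exists (row k (row_base C)) => //; apply/sub_kermxP.
  apply: submx_trans (row_sub _ _) _; rewrite eq_row_base; exact: diffmxSl.
split=> [f /EZ[u /sub_kermxP uk ->]|c0 /EB[u]].
  have : (u <= C + A)%MS.
    apply: submx_trans uk _; rewrite -(addsmx_diff_cap_eq (kermx M) A); exact: addsmxS (submx_refl _) (capmxSr _ _).
  case/sub_addsmxP=> -[y1 y2] /= Eu.
  have /submxP[y Ey] : (y1 *m C <= row_base C)%MS by rewrite eq_row_base submxMl.
  exists (fun k => y 0 k); apply/EB; exists y2.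
  rewrite Eu Ey comb_ofD; apply: funext => x.
  by rewrite (comb_of_mul e y) /= addrAC subrr add0r.
rewrite (_ : (fun x => _) = comb_of e ((\row_k c0 k) *m row_base C)); last first.
  by rewrite comb_of_mul; apply: funext => x; apply: eq_bigr => k _; rewrite mxE.
move=> /inj E.
have : ((\row_k c0 k) *m row_base C <= C :&: A)%MS.
  rewrite sub_capmx; apply/andP; split; last by rewrite E submxMl.
  by apply: submx_trans (submxMl _ _) _; rewrite eq_row_base.
rewrite capmx_diff submx0 => /eqP E0 k.
have := row_free_inj (row_base_free C) (etrans E0 (esym (mul0mx _ _))).
by move/matrixP/(_ 0 k); rewrite !mxE.
Qed.

Variables (K : nat -> (X -> V) -> Prop) (d : (X -> V) -> (X -> V)) (n : nat -> nat).
Hypothesis lin_d : lin d.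
Hypothesis K_sub : forall p, subspace (K p).
Hypothesis K_d : forall p f, K p f -> K p.+1 (d f).
Hypothesis d_d : forall p f, K p f -> d (d f) = zero.
Hypothesis K_dim : forall p, dimq (K p) is_zero (n p).

Definition cocyc p f := K p f /\ d f = zero.
Definition cobd p : (X -> V) -> Prop :=
  if p is p'.+1 then fun f => exists2 h, K p' h & f = d h else is_zero.

(** In bases of the spaces [K p] the differential becomes a sequence of matrices. The dimension of
    cohomology is n p minus the outgoing and incoming ranks, and the ranks cancel in the alternating
    sum. *)
Lemma euler_char P : (forall p, (P <= p)%N -> n p = 0%N) -> exists h : nat -> nat,
  [/\ forall p, dimq (cocyc p) (cobd p) (h p), forall p, (P <= p)%N -> h p = 0%N &
    \sum_(p < P) (-1) ^+ p * (h p)%:Z = \sum_(p < P) (-1) ^+ p * (n p)%:Z].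
Proof.
move=> nP.
have /dep_choice[e He] p : exists e : 'I_(n p) -> X -> V, [/\ forall k, K p (e k), injective (comb_of e) &
   forall f, K p f -> exists u, f = comb_of e u].
  have [e [e1 [e2 e3]]] := K_dim p; exists e; split => // [u w E|f /e2[c E]].
    apply/rowP => k; apply/eqP; rewrite -subr_eq0; apply/eqP.
    apply: (e3 (fun k => u 0 k - w 0 k)); apply: funext => x.
    under eq_bigr do rewrite scalerBl.
    by rewrite sumrB; apply/eqP; rewrite subr_eq0; apply/eqP; apply: (congr1 (fun F => F x) E).
  exists (\row_k c k); apply: funext => x.
  have /eqP := congr1 (fun F => F x) E; rewrite subr_eq0 => /eqP ->.
  by apply: eq_bigr => k _; rewrite mxE.
have Kc p u : K p (comb_of (e p) u) by apply: subspace_sum => // k; have [H _ _] := He p; apply: H.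
have /dep_choice[M HM] p : exists M : 'M[rat]_(n p, n p.+1), forall k, d (e p k) = comb_of (e p.+1) (row k M).
  have [e1 _ _] := He p; have [_ _ e3] := He p.+1.
  have /fin_all_exists[r Hr] k : exists u, d (e p k) = comb_of (e p.+1) u by apply: e3; apply: K_d.
  exists (\matrix_k r k) => k; by rewrite rowK.
have dM p u : d (comb_of (e p) u) = comb_of (e p.+1) (u *m M p).
  rewrite comb_of_mul [LHS](lin_sum lin_d); apply: funext => x.
  by apply: eq_bigr => k _; rewrite HM.
have MM p : M p *m M p.+1 = 0.
  apply/row_matrixP => k; rewrite row_mul row0; have [_ inj _] := He p.+2; apply: inj.
  have K1 : K p (e p k) by have [H _ _] := He p; apply: H.
  rewrite -dM -HM (d_d K1); apply: funext => x.
  by rewrite /comb_of big1 // => j _; rewrite mxE scale0r.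
have comb0 p : comb_of (e p) 0 = zero.
  by apply: funext => x; rewrite /comb_of big1 // => j _; rewrite mxE scale0r.
pose rk p := \rank (M p).
pose rk' p := if p is p'.+1 then rk p' else 0%N.
have Z p f : cocyc p f <-> exists2 u, u *m M p = 0 & f = comb_of (e p) u.
  have [e1 inj e3] := He p; split=> [[Kf df]|[u u0 ->]].
    have [u Eu] := e3 f Kf; exists u => //; have [_ inj' _] := He p.+1; apply: inj'.
    by rewrite -dM -Eu df comb0.
  by split => //; rewrite dM u0 comb0.
exists (fun p => n p - rk p - rk' p)%N; split.
- case=> [|p].
    have [_ inj _] := He 0%N; have := @dimq_mx _ 0 _ (e 0%N) 0 (M 0%N) (cocyc 0) (cobd 0) inj (mul0mx _ _) (Z 0%N).
    rewrite mxrank0; apply=> f /=; split=> [->|[u ->]]; first by exists 0; rewrite mul0mx comb0.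
    by rewrite mulmx0 comb0.
  have [_ inj _] := He p.+1; apply: (dimq_mx inj (MM p) (Z p.+1)) => f /=.
  split=> [[h Kh ->]|[u ->]].
    by have [_ _ e3] := He p; have [u ->] := e3 h Kh; exists u; rewrite dM.
  by exists (comb_of (e p) u); rewrite ?dM.
- by move=> p Pp; rewrite nP.
have le p : (rk p + rk' p <= n p)%N.
  case: p => [|p] /=; first by rewrite addn0 rank_leq_row.
  have /sub_kermxP/mxrankS := MM p; rewrite mxrank_ker => H.
  have := rank_leq_row (M p.+1); rewrite /rk; lia.
have rkP p : (P <= p.+1)%N -> rk p = 0%N.
  by move=> Pp; have := rank_leq_col (M p); have := nP _ Pp; rewrite /rk; lia.
(* The sum truncated at Q lacks the cancellation of the last outgoing rank. At Q = P that rank is 0,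
   since its target has dimension 0. *)
suff H Q : \sum_(p < Q) (-1) ^+ p * (n p - rk p - rk' p)%N%:Z + (if Q is Q'.+1 then (-1) ^+ Q' * (rk Q')%:Z else 0)
    = \sum_(p < Q) (-1) ^+ p * (n p)%:Z.
  rewrite -H; case: P nP rkP H => [|P] nP rkP _; first by rewrite addr0.
  by rewrite rkP // mulr0 addr0.
elim: Q => [|Q IH]; first by rewrite !big_ord0 addr0.
rewrite !big_ord_recr /= -IH.
have -> : (n Q - rk Q - rk' Q)%N%:Z = (n Q)%:Z - (rk Q)%:Z - (rk' Q)%:Z by have := le Q; lia.
case: Q IH => [|Q] IH /=; rewrite ?subr0 ?addr0 ?exprS; ring.
Qed.

End EulerCharacteristic.

Section DirectSum.
Local Open Scope ring_scope.
Variables (X : Type) (V : lmodType rat).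

Lemma dimq_direct (K K1 K2 : (X -> V) -> Prop) r1 r2 :
  (forall f, K1 f -> K f) -> (forall f, K2 f -> K f) ->
  (forall f, K f -> exists f1 f2, [/\ K1 f1, K2 f2 & f = fun x => f1 x + f2 x]) ->
  (forall f1 f2, K1 f1 -> K2 f2 -> (fun x => f1 x + f2 x) = (fun _ => 0) -> f1 = (fun _ => 0) /\ f2 = fun _ => 0) ->
  subspace K1 -> subspace K2 ->
  dimq K1 (fun f => f = fun _ => 0) r1 -> dimq K2 (fun f => f = fun _ => 0) r2 ->
  dimq K (fun f => f = fun _ => 0) (r1 + r2).
Proof.
move=> K1K K2K dec ind s1 s2 [z1 [a1 [b1 c1]]] [z2 [a2 [b2 c2]]].
exists (fun k => match split k with inl i => z1 i | inr i => z2 i end); split.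
  by move=> k; case: split => i; [apply: K1K|apply: K2K].
have S (c : 'I_(r1 + r2) -> rat) x : \sum_k c k *: (match split k with inl i => z1 i | inr i => z2 i end) x =
    \sum_i c (lshift r2 i) *: z1 i x + \sum_i c (rshift r1 i) *: z2 i x.
  rewrite big_split_ord /=; congr (_ + _); apply: eq_bigr => i _.
    by rewrite -[lshift r2 i]/(unsplit (inl i)) unsplitK.
  by rewrite -[rshift r1 i]/(unsplit (inr i)) unsplitK.
split=> [f /dec[f1 [f2 [/b1[u E1] /b2[w E2] ->]]]|c E].
  exists (fun k => match split k with inl i => u i | inr i => w i end).
  apply: funext => x; rewrite S.
  have := congr1 (fun F => F x) E1; have := congr1 (fun F => F x) E2 => /= e2 e1.
  rewrite (eq_bigr (fun i => u i *: z1 i x)) => [|i _]; last by rewrite -[lshift r2 i]/(unsplit (inl i)) unsplitK.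
  rewrite [X in _ - (_ + X)](eq_bigr (fun i => w i *: z2 i x)) => [|i _]; last first.
    by rewrite -[rshift r1 i]/(unsplit (inr i)) unsplitK.
  by rewrite opprD addrACA e1 e2 addr0.
have [|||E1 E2] := ind (fun x => \sum_i c (lshift r2 i) *: z1 i x) (fun x => \sum_i c (rshift r1 i) *: z2 i x).
- exact: subspace_sum.
- exact: subspace_sum.
- by rewrite -E; apply: funext => x; rewrite S.
move=> k; rewrite -(splitK k); case: (split k) => i /=; [exact: (c1 _ E1)|exact: (c2 _ E2)].
Qed.
End DirectSum.

Section Idempotent.
Local Open Scope ring_scope.

(** P factors through its rank as [col_base P] times [row_base P]; cancelling the full-rank factors
    in P P = P shows that the opposite product is the identity, whose trace is the rank. *)
Lemma rank_idempotent (F : fieldType) n (P : 'M[F]_n) : P *m P = P -> (\rank P)%:R = \tr P.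
Proof.
move=> PP; have E := mulmx_base P.
suff H : row_base P *m col_base P = 1%:M by rewrite -[in RHS]E mxtrace_mulC H mxtrace1.
apply: (row_full_inj (col_base_full P)); apply: (row_free_inj (row_base_free P)).
by rewrite mulmx1 E -mulmxA -mulmxA E mulmxA E.
Qed.
End Idempotent.

(** * Equivariant cochains on an orbit of cells *)

Section Orbits.
Local Open Scope ring_scope.
Variables (m N D : nat) (R : GLZ m -> 'M[rat]_D).
Hypothesis RM : forall g h, R (GLZmul m g h) = R h *m R g.
Variables (chi : GLZ m -> rat).
Hypothesis chiM : forall g h, chi (GLZmul m g h) = chi g * chi h.

Definition rho g : {linear 'rV[rat]_D -> 'rV[rat]_D} := mulmxr (R g).
Lemma rhoE g v : rho g v = v *m R g. Proof. by []. Qed.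
Lemma rhoM g h v : rho (GLZmul m g h) v = rho g (rho h v).
Proof. by rewrite !rhoE RM mulmxA. Qed.

Local Notation InBp := (InB N rho chi).
Local Notation zero := (fun _ => 0).
Implicit Types (g h : GLZ m) (s t r : seq (line m)) (b : seq (line m) -> 'rV[rat]_D).

(* An equivariant cochain on the orbit of r is determined by its value at r, an arbitrary vector of the image of [proj r]. *)
Definition transporters r s := [seq g <- frames s | perm_eq (map (lact g) r) s].
Definition twist r g s : rat := eps s * eps (map (lact g) r) * chi g.
Definition spread r v s : 'rV[rat]_D := \sum_(g <- transporters r s) twist r g s *: (v *m R g).
Definition stab_sum r : 'M[rat]_D := \sum_(h <- transporters r r) twist r h r *: R h.
Definition proj r : 'M[rat]_D := (size (transporters r r))%:R^-1 *: stab_sum r.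

Lemma perm_eqR (T : eqType) (a b c : seq T) : perm_eq b c -> perm_eq a b = perm_eq a c.
Proof. by move/permPr => ->. Qed.

Lemma spread_self r v : spread r v r = v *m stab_sum r.
Proof.
rewrite /spread /stab_sum mulmx_sumr; apply: eq_bigr => g _.
by rewrite -scalemxAr.
Qed.

Lemma InB_orbit p b r g s : InBp p b -> perm_eq (map (lact g) r) s ->
  b s = twist r g s *: (b r *m R g).
Proof.
move=> [[_ b2] b3] P; rewrite (b2 _ _ P) b3 rhoE scalerA.
by rewrite /twist [eps s * _]mulrC.
Qed.

Definition same_orbit r s := exists g, perm_eq (map (lact g) r) s.
Definition InBorb r p b := InBp p b /\ forall s, b s != 0 -> same_orbit r s.

Section OneOrbit.
Variables (p : nat) (r : seq (line m)).
Hypothesis r_std : forall j, lstd j \in r.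
Hypothesis r_uni : uni r.
Hypothesis r_size : (size r + p = N)%N.

Lemma transP g s : g \in transporters r s = perm_eq (map (lact g) r) s.
Proof.
rewrite mem_filter; case P : perm_eq => //=; apply/framesP => j.
by rewrite -(perm_mem P) map_f.
Qed.

Lemma transporters_perm s t : perm_eq s t -> perm_eq (transporters r s) (transporters r t).
Proof.
move=> st; apply: uniq_perm; rewrite ?filter_uniq ?frames_uniq // => g.
by rewrite !transP (perm_eqR _ st).
Qed.

Lemma transporters_act h s :
  perm_eq (transporters r (map (lact h) s)) (map (GLZmul m h) (transporters r s)).
Proof.
apply: uniq_perm; rewrite ?map_inj_uniq ?filter_uniq ?frames_uniq //; try exact: GLmul_inj.
have E g : map (lact (GLZmul m h g)) r = map (lact h) (map (lact g) r).
  by rewrite -map_comp; apply: eq_map => l; rewrite lactM.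
move=> g; rewrite transP; apply/idP/mapP => [P|[k]].
  exists (GLZmul m (GLinv h) g); last by rewrite GLmulVK.
  rewrite transP; apply: (@perm_map_inj _ _ (lact h) (@lact_inj _ h)).
  by rewrite -E GLmulVK.
by rewrite transP => P ->; rewrite E; apply: perm_map.
Qed.

Lemma twist_act h g s : perm_eq (map (lact g) r) s ->
  twist r (GLZmul m h g) (map (lact h) s) = chi h * twist r g s.
Proof.
move=> P; rewrite /twist chiM.
have -> : map (lact (GLZmul m h g)) r = map (lact h) (map (lact g) r).
  by rewrite -map_comp; apply: eq_map => l; rewrite lactM.
have us : uniq s by rewrite -(perm_uniq P) map_inj_uniq ?uni_uniq //; apply: lact_inj.
rewrite eps_map; [ring|exact: lact_inj|exact: us|by rewrite perm_sym].
Qed.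

Lemma spread_InB v : InBp p (spread r v).
Proof.
split; first split=> [s|s t st].
- rewrite /spread; case E : (transporters r s) => [|g l]; first by rewrite big_nil eqxx.
  move=> _.
  have : g \in transporters r s by rewrite E mem_head.
  rewrite transP => P; split; last by rewrite -(perm_size P) size_map.
  by apply: uni_perm P _; apply/uni_act.
- rewrite /spread -(perm_big _ (transporters_perm st)) scaler_sumr; apply: eq_bigr => g _.
  rewrite scalerA /twist; congr (_ *: _).
  transitivity (eps s * eps s * (eps t * eps (map (lact g) r) * chi g)); last by ring.
  by rewrite epsK mul1r.
move=> h s; rewrite /spread (perm_big _ (transporters_act h s)) big_map rhoE mulmx_suml scaler_sumr.
rewrite big_seq [RHS]big_seq; apply: eq_bigr => g; rewrite transP => P.
by rewrite twist_act // RM mulmxA -scalemxAl scalerA.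
Qed.

Lemma spread_InBorb v : InBorb r p (spread r v).
Proof.
split=> [|s]; first exact: spread_InB.
rewrite /spread; case E : (transporters r s) => [|g l]; first by rewrite big_nil eqxx.
move=> _; exists g.
by rewrite -transP E mem_head.
Qed.

Lemma stab_size : (size (transporters r r))%:R != 0 :> rat.
Proof.
rewrite pnatr_eq0 size_eq0; apply/eqP => E.
have : GL1 m \in transporters r r by rewrite transP (eq_map (@lact1 m)) map_id.
by rewrite E.
Qed.

(** Each element of the stabiliser recovers b r from b r by its twisted action; the average of these
    equalities is the claim. *)
Lemma InB_proj b : InBp p b -> b r *m proj r = b r.
Proof.
move=> Ib; rewrite /proj -scalemxAr -spread_self /spread big_seq.
rewrite (eq_bigr (fun _ => b r)) => [|g]; last first.
  by rewrite transP => P; rewrite -(InB_orbit Ib P).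
rewrite -big_seq big_const_seq count_predT iter_addr_0 -scaler_nat scalerA mulVf ?scale1r //.
exact: stab_size.
Qed.

(** The rows of [proj r] are values at r of equivariant cochains, namely spreads of multiples of
    unit vectors, and such values are fixed by [InB_proj]. *)
Lemma proj_idem : proj r *m proj r = proj r.
Proof.
apply/row_matrixP => k; rewrite row_mul.
have -> : row k (proj r) = spread r ((size (transporters r r))%:R^-1 *: delta_mx 0 k) r.
  by rewrite spread_self rowE -scalemxAl -scalemxAr.
exact: InB_proj (spread_InB _).
Qed.

Lemma InBorb_det b : InBorb r p b -> b r = 0 -> b = zero.
Proof.
move=> [Ib bo] b0; apply: funext => s; apply/eqP; apply: contraT => /[dup] /bo[g P].
by rewrite (InB_orbit Ib P) b0 mul0mx scaler0 eqxx.
Qed.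

Lemma subspace_InBorb : subspace (InBorb r p).
Proof.
split=> [|a f g [[f1 f2] f3] [[g1 g2] g3]]; first split=> [|s].
- split=> [|g s]; first exact: alt0.
  by rewrite linear0 scaler0.
- by rewrite eqxx.
split=> [|s fg]; first split.
- exact: alt_lin.
- by move=> h s; rewrite f2 g2 linearD [rho h (a *: _)]linearZ /= scalerDr !scalerA [a * _]mulrC.
have [E|/f3 //] := eqVneq (f s) 0; have [E'|/g3 //] := eqVneq (g s) 0.
by rewrite E E' scaler0 addr0 eqxx in fg.
Qed.

Lemma dimq_orbit : dimq (InBorb r p) (fun b => b = zero) (\rank (proj r)).
Proof.
have P0 := stab_size; set c0 := (size _)%:R in P0.
(* On the image of the projector, spreading and then evaluating at r multiplies by the order of the
   stabiliser. *)
have sp k : spread r (row k (row_base (proj r))) r = c0 *: row k (row_base (proj r)).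
  have /submxP[w Ew] : (row k (row_base (proj r)) <= proj r)%MS.
    by apply: submx_trans (row_sub _ _) _; rewrite eq_row_base.
  rewrite spread_self Ew -[stab_sum r]scale1r -(divff P0) -scalerA -/(proj r) -scalemxAr.
  by rewrite -mulmxA proj_idem.
have lcr (c : 'I_(\rank (proj r)) -> rat) : \sum_k c k *: spread r (row k (row_base (proj r))) r =
    c0 *: ((\row_k c k) *m row_base (proj r)).
  rewrite mulmx_sum_row scaler_sumr; apply: eq_bigr => k _.
  by rewrite sp mxE !scalerA mulrC.
exists (fun k => spread r (row k (row_base (proj r)))); split; first by move=> k; apply: spread_InBorb.
split=> [b Ib|c E k].
  have /submxP[w Ew] : (b r <= row_base (proj r))%MS.
    by rewrite eq_row_base -(InB_proj (proj1 Ib)) submxMl.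
  exists (fun k => c0^-1 * w 0 k); apply: InBorb_det.
    apply: subspaceB => //; first exact: subspace_InBorb.
    by apply: subspace_sum => [|k]; [apply: subspace_InBorb|apply: spread_InBorb].
  rewrite lcr Ew (_ : \row_k _ = c0^-1 *: w); last by apply/rowP => k; rewrite !mxE.
  by rewrite -scalemxAl scalerA divff // scale1r subrr.
have := congr1 (fun F => F r) E; rewrite lcr => /eqP; rewrite scaler_eq0 (negbTE P0) /= => /eqP E0.
have := row_free_inj (row_base_free _) (etrans E0 (esym (mul0mx _ _))).
by move/matrixP/(_ 0 k); rewrite !mxE.
Qed.

Lemma proj_trace : (\rank (proj r))%:R =
  (size (transporters r r))%:R^-1 * \sum_(h <- transporters r r) twist r h r * \tr (R h) :> rat.
Proof.
rewrite (rank_idempotent proj_idem) /proj mxtraceZ /stab_sum; congr (_ * _).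
by rewrite linear_sum; apply: eq_bigr => h _; rewrite /= mxtraceZ.
Qed.

End OneOrbit.

Lemma dimq_one p r : (forall j, lstd j \in r) -> uni r -> (size r + p = N)%N ->
  (forall s, uni s -> (size s + p = N)%N -> same_orbit r s) ->
  dimq (InBp p) (fun b => b = zero) (\rank (proj r)).
Proof.
move=> h1 h2 h3 H; apply: dimq_ext (dimq_orbit h1 h2 h3) => [b|//]; split=> [[]//|Ib].
by split=> // s /(proj1 (proj1 Ib))[us sz]; apply: H.
Qed.

Lemma same_orbit_perm r s t : perm_eq s t -> same_orbit r s -> same_orbit r t.
Proof. by move=> st [g P]; exists g; apply: perm_trans st. Qed.

Lemma same_orbit_act r s g : same_orbit r (map (lact g) s) -> same_orbit r s.
Proof.
move=> [h P]; exists (GLZmul m (GLinv g) h).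
have -> : map (lact (GLZmul m (GLinv g) h)) r = map (lact (GLinv g)) (map (lact h) r).
  by rewrite -map_comp; apply: eq_map => l; rewrite lactM.
by have := perm_map (lact (GLinv g)) P; rewrite -[map _ (map (lact g) s)]map_comp (eq_map (lactK g)) map_id.
Qed.

Definition restrict r b s := if asb (same_orbit r s) then b s else 0 : 'rV[rat]_D.

Lemma restrict_InBorb r p b : InBp p b -> InBorb r p (restrict r b).
Proof.
move=> [[b1 b2] b3]; split; last first.
  by move=> s; rewrite /restrict; case: asbP => // _; rewrite eqxx.
split; first split=> [s|s t st].
- by rewrite /restrict; case: asbP => [_ /b1 //|_]; rewrite eqxx.
- rewrite /restrict; case: asbP => [ot|no]; case: asbP => [os|no'].
  + exact: b2.
  + by case: no'; apply: same_orbit_perm ot; rewrite perm_sym.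
  + by case: no; apply: same_orbit_perm os.
  by rewrite scaler0.
move=> g s; rewrite /restrict; case: asbP => [o1|no]; case: asbP => [os|no'].
- exact: b3.
- by case: no'; apply: same_orbit_act o1.
- by case: no; apply: (@same_orbit_act _ _ (GLinv g)); rewrite -map_comp (eq_map (lactK g)) map_id.
by rewrite linear0 scaler0.
Qed.

(** Restriction to the two orbits splits every cochain. The case occurs for m = 3 in codimension 2,
    where lists of four lines fall into two orbits. *)
Lemma dimq_two p r r' : (forall j, lstd j \in r) -> uni r -> (size r + p = N)%N ->
  (forall j, lstd j \in r') -> uni r' -> (size r' + p = N)%N ->
  (forall s, uni s -> (size s + p = N)%N -> same_orbit r s \/ same_orbit r' s) ->
  (forall s, same_orbit r s -> same_orbit r' s -> False) ->
  dimq (InBp p) (fun b => b = zero) (\rank (proj r) + \rank (proj r')).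
Proof.
move=> h1 h2 h3 h1' h2' h3' cov dis; have d1 := dimq_orbit h1 h2 h3; have d2 := dimq_orbit h1' h2' h3'.
apply: (dimq_direct _ _ _ _ _ _ d1 d2).
- by move=> f [].
- by move=> f [].
- move=> f If; exists (restrict r f), (restrict r' f); split; try exact: restrict_InBorb.
  apply: funext => s; rewrite /restrict.
  case: asbP => [os|no]; case: asbP => [os'|no'].
  + by case: (dis s).
  + by rewrite addr0.
  + by rewrite add0r.
  rewrite addr0; apply/eqP; apply: contraT => /(proj1 (proj1 If))[us sz].
  by case: (cov s us sz).
- move=> f1 f2 [_ s1] [_ s2] E; split; apply: funext => s; apply/eqP;
    apply: contraT => n; have := congr1 (fun F => F s) E.
    have [->|n2] := eqVneq (f2 s) 0; last by case: (dis s); [apply: s1|apply: s2].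
    by rewrite addr0 => /eqP; rewrite (negbTE n).
  have [->|n2] := eqVneq (f1 s) 0; last by case: (dis s); [apply: s1|apply: s2].
  by rewrite add0r => /eqP; rewrite (negbTE n).
- exact: subspace_InBorb.
exact: subspace_InBorb.
Qed.

End Orbits.

Section SwapAlternating.
Local Open Scope ring_scope.
Variables (A : countType) (f : seq A -> rat).
Hypothesis f_swap : forall a x y b, f (a ++ x :: y :: b) = - f (a ++ y :: x :: b).

Lemma swap_move c a x b : f (c ++ a ++ x :: b) = (-1) ^+ size a * f (c ++ x :: a ++ b).
Proof.
elim: a c => [|y a IH] c /=; first by rewrite mul1r.
rewrite -cat_rcons IH cat_rcons f_swap exprS; ring.
Qed.

Lemma swap_alternating s t : uniq s -> perm_eq s t -> f t = eps s * eps t * f s.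
Proof.
suff H c : uniq s -> perm_eq s t -> f (c ++ t) = eps s * eps t * f (c ++ s) by apply: (H [::]).
elim: s t c => [|x s IH] t c us st.
  by move: st; rewrite perm_sym => /perm_nilP ->; rewrite epsK mul1r.
have xt : x \in t by rewrite -(perm_mem st) mem_head.
case/splitPr: xt st => a b st.
have ut : uniq (a ++ x :: b) by rewrite -(perm_uniq st).
have xa : x \notin a by move: ut; rewrite cat_uniq /= => /and3P[_ /norP[]].
have st' : perm_eq s (a ++ b).
  by rewrite -(perm_cons x) (perm_trans st) // -cat1s perm_catCA.
rewrite swap_move -cat_rcons (IH (a ++ b)) //; last by case/andP: us.
by rewrite cat_rcons eps_move // mulrA -(eps_cons2 x st'); ring.
Qed.
End SwapAlternating.

(** * The orientation character *)

Section Orientation.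
Local Open Scope ring_scope.

Definition pairs (m : nat) : seq (nat * nat) :=
  [seq p <- [seq (c, d) | c <- iota 0 m, d <- iota 0 m] | (p.1 <= p.2)%N].
Definition sq2 m (c : seq int) : seq int := [seq c`_p.1 * c`_p.2 | p <- pairs m].

Lemma pairs_lt m p : p \in pairs m -> (p.1 < m)%N /\ (p.2 < m)%N.
Proof.
rewrite mem_filter => /andP[_ /allpairsP[[c d] /= [cm dm ->]]].
by move: cm dm; rewrite !mem_iota.
Qed.

(** Folds a square of indices onto its upper triangle, as when a product of two linear forms is
    expanded in coordinates of Sym^2. *)
Lemma sum_pairs m (X : nat -> nat -> int) :
  \sum_(c <- iota 0 m) \sum_(d <- iota 0 m) X c d =
  \sum_(p <- pairs m) (X p.1 p.2 + if p.1 == p.2 then 0 else X p.2 p.1).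
Proof.
rewrite /pairs big_filter [RHS]big_mkcond [RHS]big_allpairs_dep /=.
have -> : \sum_(c <- iota 0 m) \sum_(d <- iota 0 m) (if (c <= d)%N then X c d + (if c == d then 0 else X d c) else 0)
  = \sum_(c <- iota 0 m) \sum_(d <- iota 0 m) ((if (c <= d)%N then X c d else 0) + (if (c < d)%N then X d c else 0)).
  apply: eq_bigr => c _; apply: eq_bigr => d _.
  by case: ltngtP => // _; rewrite ?addr0.
under [RHS]eq_bigr do rewrite big_split.
rewrite big_split /= [X in _ = _ + X]exchange_big /= -big_split; apply: eq_bigr => c _ /=.
rewrite -big_split; apply: eq_bigr => d _ /=.
by case: ltnP => _; rewrite ?addr0 ?add0r.
Qed.

Variable k : nat.
Notation m := k.+1.
Variable N : nat.
Hypothesis NE : size (pairs m) = N.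
Implicit Types (g : GLZ m) (s t : seq (line m)).

Lemma nth_codeof_nat (l : line m) i : (i < m)%N -> (codeof l)`_i = (val l) (inord i) 0.
Proof. by move=> im; rewrite -(nth_codeof l (inord i)) inordK. Qed.

(* The fundamental class of the retract: the determinant of the rank one forms v v^T, v in s, in coordinates of Sym^2. *)
Definition sqmx s : 'M[int]_N := \matrix_(i, j) (nth [::] (map (fun l => sq2 m (codeof l)) s) i)`_j.
Definition sqdet s : rat := if size s == N then (\det (sqmx s))%:~R else 0.
Definition orient s : rat := if asb (uni s) then sqdet s else 0.

Lemma sqdet_swap a x y b : sqdet (a ++ x :: y :: b) = - sqdet (a ++ y :: x :: b).
Proof.
rewrite /sqdet !size_cat /=; case: eqP => [E|_]; last by rewrite oppr0.
have ia : (size a < N)%N by rewrite -E; lia.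
have ja : ((size a).+1 < N)%N by rewrite -E; lia.
pose i := Ordinal ia; pose j := Ordinal ja.
have -> : sqmx (a ++ x :: y :: b) = row_perm (tperm i j) (sqmx (a ++ y :: x :: b)).
  apply/matrixP => r q; rewrite !mxE !map_cat /= !nth_cat !size_map.
  case: tpermP => [->|->|ri rj] /=.
  - by rewrite ltnn subnn ltnNge leqnSn /= subSnn.
  - by rewrite ltnn subnn ltnNge leqnSn /= subSnn.
  case: ltnP => // ar; have := ri; have := rj.
  have -> : (r - size a = (r - size a).-2.+2)%N.
    have r1 : nat_of_ord r <> size a by move=> H; apply: ri; apply: val_inj.
    have r2 : nat_of_ord r <> (size a).+1 by move=> H; apply: rj; apply: val_inj.
    lia.
  by [].
rewrite row_permE det_mulmx det_perm odd_tperm.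
have -> : i != j by apply/eqP => /(congr1 val) /=; lia.
by rewrite expr1 mulN1r rmorphN.
Qed.

Lemma orient_alt : alt N (V := rat^o) 0 orient.
Proof.
split=> [s|s t st]; rewrite /orient.
  case: asbP => [us|]; last by rewrite eqxx.
  by rewrite /sqdet; case: ifP => [/eqP -> _|_]; rewrite ?addn0 // eqxx.
have -> : asb (uni t) = asb (uni s).
  by apply/asbP/asbP; apply: uni_perm; rewrite // perm_sym.
case: asbP => [us|_]; last by rewrite scaler0.
exact: (swap_alternating sqdet_swap (uni_uniq us) st).
Qed.

(** The entries of (g v)(g v)^T are linear in those of v v^T, and the sign by which a line is
    normalised disappears in the square. S is the matrix of this action on Sym^2. *)
Lemma sqmx_act g : exists S : 'M[int]_N, forall s, size s = N ->
  sqmx (map (lact g) s) = sqmx s *m S.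
Proof.
pose ge a c : int := (val g) (inord a) (inord c).
pose pr i := nth (0%N, 0%N) (pairs m) i.
exists (\matrix_(i, j) (ge (pr j).1 (pr i).1 * ge (pr j).2 (pr i).2 +
   if (pr i).1 == (pr i).2 then 0 else ge (pr j).1 (pr i).2 * ge (pr j).2 (pr i).1)).
move=> s sN; apply/matrixP => r j; rewrite !mxE -map_comp.
have rs : (r < size s)%N by rewrite sN.
case: s sN rs => [//|l0 s'] sN rs; set s := l0 :: s' in sN rs *; set v := nth l0 s r.
rewrite (nth_map l0) //= -/v /sq2 (nth_map (0%N, 0%N)) ?NE // -/(pr j).
have [j1 j2] : ((pr j).1 < m)%N /\ ((pr j).2 < m)%N by apply: pairs_lt; apply: mem_nth; rewrite NE.
have [e Ee] := lact_sign g v.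
pose w c : int := (val v) (inord c) 0.
have gw a : (a < m)%N -> (val g *m val v) (inord a) 0 = \sum_(c <- iota 0 m) ge a c * w c.
  move=> am; rewrite mxE -[iota 0 m]/(index_iota 0 m) big_mkord; apply: eq_bigr => c _.
  by rewrite /ge /w inord_val.
rewrite !nth_codeof_nat //.
have -> : (val (lact g v)) (inord (pr j).1) 0 * (val (lact g v)) (inord (pr j).2) 0 =
    (val g *m val v) (inord (pr j).1) 0 * (val g *m val v) (inord (pr j).2) 0.
  rewrite Ee [_ (inord (pr j).1) 0]mxE [_ (inord (pr j).2) 0]mxE mulrACA -expr2 -exprM muln2 -addnn.
  by rewrite addnn -signr_odd odd_double mul1r.
rewrite !gw // big_distrlr sum_pairs (big_nth (0%N, 0%N)) NE big_mkord; apply: eq_bigr => i _.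
rewrite !mxE (nth_map l0) // -/v (nth_map (0%N, 0%N)) ?NE // -/(pr i).
have [i1 i2] : ((pr i).1 < m)%N /\ ((pr i).2 < m)%N by apply: pairs_lt; apply: mem_nth; rewrite NE.
rewrite !nth_codeof_nat // /w /=; case: eqP => [->|_]; ring.
Qed.

Lemma orient_act_det g : exists S : rat, forall s, orient (map (lact g) s) = S * orient s.
Proof.
have [S HS] := sqmx_act g; exists ((\det S)%:~R) => s; rewrite /orient.
have -> : asb (uni (map (lact g) s)) = asb (uni s) by apply/asbP/asbP; rewrite uni_act.
case: asbP => _; last by rewrite mulr0.
rewrite /sqdet size_map; case: eqP => [sN|_]; last by rewrite mulr0.
by rewrite HS // det_mulmx rmorphM mulrC.
Qed.

Lemma orient_codes L : codes_ok k L -> size L = N -> uni (map (lineof k) L) ->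
  orient (map (lineof k) L) = (detr N (map (sq2 m) L))%:~R.
Proof.
move=> /andP[/allP ok _] sL uL; rewrite /orient /sqdet size_map sL eqxx.
case: asbP => // _; rewrite -det_list ?size_map //; last first.
  by move=> i iN; rewrite (nth_map [::]) ?sL // size_map NE.
congr ((\det _)%:~R); apply/matrixP => i j; rewrite !mxE -map_comp.
rewrite !(nth_map [::]) ?sL //=; congr ((sq2 m _)`_j).
apply: (@lineof_inj k); rewrite ?codeof_ok ?codeofK //.
by apply: ok; apply: mem_nth; rewrite sL.
Qed.

Variable vs : seq (seq int).
Notation n := (size vs).
Hypothesis vs_ok : codes_ok k (stdc k ++ vs).
Hypothesis vs_cover : all (fun c => lposl c ==> (c \in stdc k ++ vs)) (lists_of m [:: -1; 0; 1]).

(* A codimension one cell lies in top cells whose oriented volumes add up to 0. *)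
Definition closed_check : bool :=
  all (fun T => (m + size T + 1 == N)%N ==>
    (foldr (fun i acc => (if (i \notin T) && uniL k (nth [::] vs i :: codesT k vs T)
       then detr N (map (sq2 m) (nth [::] vs i :: codesT k vs T)) else 0) + acc) 0 (iota 0 n) == 0))
  (faces k vs).
Hypothesis closed_ok : closed_check.

Lemma std_basis_mx : lmx (@lstd m) = 1%:M.
Proof. by apply/matrixP => i j; rewrite !mxE andbT. Qed.

Lemma codes_cons_ok T i : T \in sublists (iota 0 n) -> (i < n)%N ->
  codes_ok k (nth [::] vs i :: codesT k vs T) = (i \notin T).
Proof.
move=> TL iln; have /andP[ok1 u1] := codesT_ok vs_ok TL.
have -> : codes_ok k (nth [::] vs i :: codesT k vs T) = (codeok k (nth [::] vs i) && all (codeok k) (codesT k vs T))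
  && ((nth [::] vs i \notin codesT k vs T) && uniq (codesT k vs T)) by [].
rewrite ok1 u1 vs_codeok // /= andbT /codesT mem_cat negb_or.
have Tlt j : j \in T -> (j < n)%N by rewrite (sublists_filter TL) mem_filter mem_iota => /andP[].
case/andP: vs_ok => _; rewrite cat_uniq => /and3P[_ /hasPn H u3].
rewrite (H (nth [::] vs i)) ?mem_nth //=; congr (~~ _); apply/mapP/idP => [[j jT]|iT]; last by exists i.
by move/eqP; rewrite (nth_uniq [::] iln (Tlt _ jT) u3) => /eqP ->.
Qed.

Lemma ext_codes T : T \in faces k vs ->
  perm_eq (ext (map (lineof k) (codesT k vs T)))
    [seq vl k vs i | i <- iota 0 n & (i \notin T) && uniL k (nth [::] vs i :: codesT k vs T)].
Proof.
rewrite mem_filter => /andP[uT TL].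
have us : uni (map (lineof k) (codesT k vs T)).
  by apply/uniL_P => //; [apply: codesT_ok|move=> c cs; rewrite mem_cat cs].
have stdin j : lstd j \in map (lineof k) (codesT k vs T).
  by rewrite -lineof_stdc map_f // mem_cat mem_nth // size_stdc.
have key i : (i < n)%N -> i \notin T ->
    uni (vl k vs i :: map (lineof k) (codesT k vs T)) <-> uniL k (nth [::] vs i :: codesT k vs T).
  move=> iln iT; apply: (@uniL_P k (nth [::] vs i :: codesT k vs T)); first by rewrite codes_cons_ok.
  by move=> c cs; rewrite inE mem_cat cs orbT.
apply: uniq_perm.
- exact: ext_uniq.
- rewrite map_inj_in_uniq ?filter_uniq ?iota_uniq // => i j.
  by rewrite !mem_filter !mem_iota => /andP[_ ?] /andP[_ ?]; apply: vl_inj.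
move=> v; apply/idP/mapP => [/extP[_ uv]|[i]].
  have bs : basis_in (@lstd m) (v :: map (lineof k) (codesT k vs T)).
    by split=> [j|]; [rewrite inE stdin orbT|rewrite std_basis_mx det1].
  have [|[j E]|[i iln E]] := @line_cover k vs vs_ok vs_cover v.
  - move=> i; have := uni_coord uv (proj1 bs) (proj2 bs) (mem_head _ _) i.
    by rewrite std_basis_mx invmx1 mul1mx.
  - by case/andP: (uni_uniq uv); rewrite E stdin.
  exists i => //; have iT : i \notin T.
    apply/negP => iT; case/andP: (uni_uniq uv) => /negP[].
    by rewrite E /vl map_f // mem_cat map_f ?orbT.
  have U : uniL k (nth [::] vs i :: codesT k vs T) by apply/(key i iln iT); rewrite -E.
  by rewrite mem_filter mem_iota iT U iln.
rewrite mem_filter mem_iota add0n => /andP[/andP[iT ui] /= iln] ->.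
by apply/extP; split; [exact: us|apply/(key i iln iT)].
Qed.

(** The inverse of [GLb b] moves any cell to one containing the standard basis, where completions
    are indices of [vs] and the finite check applies. Moving back only multiplies [orient] by a
    constant. *)
Lemma orient_closed : dd (V := rat^o) orient = fun _ => 0.
Proof.
have ao := alt_dd orient_alt.
apply: funext => s; apply/eqP; apply: contraT => ns.
have [us sz] := proj1 ao s ns; have [b gb] := good_exists us.
have bs : basis_in b s by case: gb => [[]].
have db := proj2 bs; have P := chart vs_ok vs_cover db us bs.
have TF := Tb_faces vs_ok vs_cover db us bs.
set T := Tb vs b s in P TF.
have sT : (m + size T + 1 == N)%N.
  by rewrite -sz (perm_size P) size_cat size_codom card_ord size_map.
have [S HS] := orient_act_det (GLb b).
have Z : dd (V := rat^o) orient (map (lineof k) (codesT k vs T)) = 0.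
  rewrite /dd (perm_big _ (ext_codes TF)) big_map big_filter.
  have /allP/(_ T TF)/implyP/(_ sT)/eqP E := closed_ok.
  transitivity ((foldr (fun i acc => (if (i \notin T) && uniL k (nth [::] vs i :: codesT k vs T)
       then detr N (map (sq2 m) (nth [::] vs i :: codesT k vs T)) else 0) + acc) 0 (iota 0 n))%:~R : rat); last by rewrite E.
  rewrite big_mkcond /=; have : {subset iota 0 n <= iota 0 n} by [].
  elim: {1 3 4}(iota 0 n) => [|i r IH] sub; first by rewrite big_nil.
  rewrite big_cons IH => [|j jr]; last by apply: sub; rewrite inE jr orbT.
  have iln : (i < n)%N by have := sub i (mem_head _ _); rewrite mem_iota.
  rewrite /= rmorphD /=; congr (_ + _); case: ifP => // /andP[iT ui].
  have TL : T \in sublists (iota 0 n) by apply: filter_sublists.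
  have ok : codes_ok k (nth [::] vs i :: codesT k vs T) by rewrite codes_cons_ok.
  apply: (orient_codes ok); first by rewrite -[size _]/((size (codesT k vs T)).+1) size_cat size_stdc size_map -(eqP sT) addn1.
  by apply/uniL_P => // c cs; rewrite inE mem_cat cs orbT.
case/eqP: ns; have P' := P; rewrite perm_sym (chart_codes vs db) in P'.
rewrite (proj2 ao _ _ P').
suff -> : dd (V := rat^o) orient (map (lact (GLb b)) (map (lineof k) (codesT k vs T))) = 0 by rewrite scaler0.
rewrite /dd (perm_big _ (ext_act _ _)) big_map.
rewrite (eq_bigr (fun v => S * orient (v :: map (lineof k) (codesT k vs T)))) => [|v _];
  last exact: (HS (v :: map (lineof k) (codesT k vs T))).
rewrite -mulr_sumr -[X in S * X]/(dd (V := rat^o) orient (map (lineof k) (codesT k vs T))) Z.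
exact: mulr0.
Qed.

Variable crit : seq nat.
Hypothesis crit_face : crit \in faces k vs.
Hypothesis crit_size : (m + size crit = N)%N.
Hypothesis crit_det : detr N (map (sq2 m) (codesT k vs crit)) != 0.
Definition top_cell : seq (line m) := map (lineof k) (codesT k vs crit).

Lemma crit_sub : crit \in sublists (iota 0 n).
Proof. by move: crit_face; rewrite mem_filter => /andP[]. Qed.

Lemma top_uni : uni top_cell.
Proof.
apply/uniL_P; first exact: codesT_ok crit_sub.
  by move=> c cs; rewrite mem_cat cs.
by move: crit_face; rewrite mem_filter => /andP[].
Qed.

Lemma orient_top : orient top_cell = (detr N (map (sq2 m) (codesT k vs crit)))%:~R.
Proof.
apply: orient_codes; [exact: codesT_ok crit_sub| |exact: top_uni].
by rewrite size_cat size_stdc size_map.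
Qed.

Lemma orient_top_neq0 : orient top_cell != 0.
Proof. by rewrite orient_top intr_eq0. Qed.

(** The determinant of g on Sym^2, read off from a single top cell. *)
Definition ochar g : rat := orient (map (lact g) top_cell) / orient top_cell.

Lemma orient_act g s : orient (map (lact g) s) = ochar g * orient s.
Proof.
have [S HS] := orient_act_det g; rewrite HS /ochar HS mulfK //; exact: orient_top_neq0.
Qed.

Lemma ocharM g h : ochar (GLZmul m g h) = ochar g * ochar h.
Proof.
have E := orient_act (GLZmul m g h) top_cell.
have F : map (lact (GLZmul m g h)) top_cell = map (lact g) (map (lact h) top_cell).
  by rewrite -map_comp; apply: eq_map => l; rewrite lactM.
have E1 := orient_act g (map (lact h) top_cell); have E2 := orient_act h top_cell.
apply: (mulIf orient_top_neq0); apply: etrans (esym E) _; rewrite F; apply: etrans E1 _.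
by apply: etrans (congr1 _ E2) _; apply: mulrA.
Qed.

Lemma ochar1 : ochar (GL1 m) = 1.
Proof. by rewrite /ochar (eq_map (@lact1 m)) map_id divff // orient_top_neq0. Qed.

Lemma orient_cell b : `|\det (lmx b)| = 1 -> orient (critical_cell vs crit b) != 0.
Proof.
move=> db; rewrite /critical_cell (chart_codes vs db) orient_act mulf_neq0 ?orient_top_neq0 //.
apply: contraTneq (oner_neq0 rat) => E.
by rewrite -ochar1 -(GLmulrV (GLb b)) ocharM E mul0r eqxx.
Qed.

End Orientation.

(** * Stabilisers and orbits by search among coded matrices *)

Section CodedMatrices.
Local Open Scope ring_scope.
Variable k : nat.
Notation m := k.+1.
Implicit Types (c : seq int) (C L : seq (seq int)) (g : GLZ m) (l : line m).

(* A coded matrix is the list of its columns. *)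
Definition mulc C c : seq int :=
  [seq foldr (fun j acc => c`_j * (nth [::] C j)`_i + acc) 0 (iota 0 m) | i <- iota 0 m].
Definition canonc c : seq int := if lposl c then c else [seq - x | x <- c].
Definition actc C c : seq int := canonc (mulc C c).
Definition wfc C : bool := [&& size C == m, all (fun c => size c == m) C & absz (detr m C) == 1%N].
Definition mxc C : 'M[int]_m := \matrix_(i, j) (nth [::] C j)`_i.
Definition GLc C : GLZ m := insubd (GL1 m) (mxc C).

Lemma det_mxc C : wfc C -> \det (mxc C) = detr m C.
Proof.
move=> /and3P[/eqP sC /allP cC _].
rewrite -det_tr -det_list //; last by move=> i im; apply/eqP/cC; rewrite mem_nth ?sC.
by congr (\det _); apply/matrixP => i j; rewrite !mxE.
Qed.

Lemma val_GLc C : wfc C -> val (GLc C) = mxc C.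
Proof.
move=> wC; rewrite val_insubd unitmxE unit_int det_mxc //; have /and3P[_ _ dC] := wC.
by have -> : `|detr m C| == 1 by lia.
Qed.

Lemma lpos_colof c : size c = m -> lpos (colof k c) = lposl c.
Proof.
move=> sc; apply/lposP/lposlP => [[i ci H]|[i ic [ci H]]].
  exists (nat_of_ord i); first by rewrite sc.
  split; first by rewrite mxE in ci.
  by move=> j ji; have := H (Ordinal (ltn_trans ji (ltn_ord i))) ji; rewrite mxE.
have im : (i < m)%N by rewrite -sc.
exists (Ordinal im); first by rewrite mxE.
by move=> j ji; rewrite mxE H.
Qed.

Lemma size_mulc C c : size (mulc C c) = m. Proof. by rewrite size_map size_iota. Qed.

Lemma colof_mulc C c : colof k (mulc C c) = mxc C *m colof k c.
Proof.
apply/matrixP => i j; rewrite !mxE (nth_map 0%N) ?size_iota // nth_iota // add0n.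
transitivity (\sum_(j <- iota 0 m) (c`_j * (nth [::] C j)`_i)).
  by elim: (iota 0 m) => [|q r IH]; rewrite ?big_nil // big_cons -IH.
rewrite -[iota 0 m]/(index_iota 0 m) big_mkord; apply: eq_bigr => q _.
by rewrite !mxE mulrC.
Qed.

Lemma codeof_lact C c : wfc C -> codeok k c -> codeof (lact (GLc C) (lineof k c)) = actc C c.
Proof.
move=> wC ok; have sz : size (actc C c) = m.
  by rewrite /actc /canonc; case: ifP => _; rewrite ?(size_map -%R) size_mulc.
apply: (@eq_from_nth _ 0); rewrite ?sz; first by rewrite size_map size_enum_ord.
move=> i; rewrite size_map size_enum_ord => im.
rewrite (nth_codeof _ (Ordinal im)) val_lact val_lineof // val_GLc // -colof_mulc.
rewrite /lnorm lpos_colof ?size_mulc // /actc /canonc; case: ifP => _; first by rewrite mxE.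
by rewrite (nth_map 0) ?size_mulc // !mxE.
Qed.

Lemma lact_lineof C c : wfc C -> codeok k c -> lact (GLc C) (lineof k c) = lineof k (actc C c).
Proof. by move=> wC ok; rewrite -codeof_lact // codeofK. Qed.

Lemma map_lact_lineof C L : wfc C -> all (codeok k) L ->
  map (lact (GLc C)) (map (lineof k) L) = map (lineof k) (map (actc C) L).
Proof.
move=> wC /allP ok; rewrite -!map_comp; apply/eq_in_map => c /ok H /=.
exact: lact_lineof.
Qed.

Lemma actc_ok C c : wfc C -> codeok k c -> codeok k (actc C c).
Proof. by move=> wC ok; rewrite -codeof_lact // codeof_ok. Qed.

Definition columns g : seq (seq int) := [seq [seq (val g) i j | i <- enum 'I_m] | j <- enum 'I_m].

Lemma nth_columns g (i j : 'I_m) : (nth [::] (columns g) j)`_i = (val g) i j.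
Proof.
rewrite (nth_map ord0) ?size_enum_ord // nth_ord_enum.
by rewrite (nth_map ord0) ?size_enum_ord // nth_ord_enum.
Qed.

Lemma mxc_columns g : mxc (columns g) = val g.
Proof. by apply/matrixP => i j; rewrite mxE nth_columns. Qed.

Lemma columns_wf g : wfc (columns g).
Proof.
have sC : size (columns g) = m by rewrite size_map size_enum_ord.
have cC i : (i < m)%N -> size (nth [::] (columns g) i) = m.
  by move=> im; rewrite (nth_map ord0) ?size_enum_ord // size_map size_enum_ord.
apply/and3P; split; first by rewrite sC.
  by apply/(all_nthP [::]) => i; rewrite sC => /cC ->.
rewrite -det_list // -det_tr.
have -> : (\matrix_(i < m, j < m) (nth [::] (columns g) i)`_j)^T = val g.
  by apply/matrixP => i j; rewrite !mxE nth_columns.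
by have := valP g; rewrite unitmxE unit_int => /eqP H; rewrite -eqz_nat abszE H.
Qed.

Lemma GLc_columns g : GLc (columns g) = g.
Proof. by apply: val_inj; rewrite val_GLc ?columns_wf // mxc_columns. Qed.

Definition frames_code L : seq (seq (seq int)) :=
  [seq C <- lists_of m (L ++ map (map -%R) L) | wfc C].

Lemma columns_frames L g : all (codeok k) L -> (forall j, lact g (lstd j) \in map (lineof k) L) ->
  columns g \in frames_code L.
Proof.
move=> /allP ok H; rewrite mem_filter columns_wf; apply/lists_ofP; split.
  by rewrite size_map size_enum_ord.
move=> c /mapP[j _ ->]; have /mapP[d dL E] := H j; rewrite mem_cat.
have [e Ee] := val_lact_std g j; rewrite E val_lineof ?ok // in Ee.
have sd : size d = m by have /andP[/eqP] := ok d dL.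
have Eq (i : 'I_m) : d`_i = (-1) ^+ e * (val g) i j.
  by have := congr1 (fun u : 'cV[int]_m => u i 0) Ee; rewrite !mxE.
have nc (i : 'I_m) : [seq (val g) i j | i <- enum 'I_m]`_i = (val g) i j.
  by rewrite (nth_map ord0) ?size_enum_ord // nth_ord_enum.
case: e {Ee} Eq => Eq; apply/orP; [right|left].
  apply/mapP; exists d => //; apply: (@eq_from_nth _ 0).
    by rewrite size_map size_enum_ord size_map sd.
  move=> i; rewrite size_map size_enum_ord => im.
  rewrite (nc (Ordinal im)) (nth_map 0) ?sd // (Eq (Ordinal im)) expr1 mulN1r.
  by rewrite opprK.
suff -> : [seq (val g) i j | i <- enum 'I_m] = d by [].
apply: (@eq_from_nth _ 0); first by rewrite size_map size_enum_ord sd.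
move=> i; rewrite size_map size_enum_ord => im.
by rewrite (nc (Ordinal im)) (Eq (Ordinal im)) expr0 mul1r.
Qed.

Definition moves_to L L' (C : seq (seq int)) : bool := perm_eq (map (actc C) L) L'.

Lemma moves_toP L L' C : wfc C -> all (codeok k) L -> all (codeok k) L' ->
  perm_eq (map (lact (GLc C)) (map (lineof k) L)) (map (lineof k) L') = moves_to L L' C.
Proof.
move=> wC ok ok'; rewrite map_lact_lineof //; apply/idP/idP; last exact: perm_map.
have inj : {in map (actc C) L ++ L' &, injective (lineof k)}.
  have H : {in map (actc C) L ++ L', forall c, codeok k c}.
    move=> c; rewrite mem_cat => /orP[/mapP[d dL ->]|/(allP ok') //].
    by apply: actc_ok => //; apply: (allP ok).
  by move=> c d /H ? /H ?; apply: lineof_inj.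
have K L1 : all (codeok k) L1 -> map (@codeof k) (map (lineof k) L1) = L1.
  move=> /allP o1; rewrite -map_comp -[RHS]map_id; apply/eq_in_map => c /o1 oc /=.
  by apply: (@lineof_inj k); rewrite ?codeof_ok ?codeofK.
move/(perm_map (@codeof k)); rewrite !K //.
apply/allP => c /mapP[d dL ->]; apply: actc_ok => //; exact: (allP ok).
Qed.

Definition stab_code L : seq (seq (seq int)) := [seq C <- frames_code L | moves_to L L C].

Definition inversion_sign (A : eqType) (L L' : seq A) : rat := eps (map (index^~ L) L').

(** Trades the arbitrary order of [pickle] for the order of L itself: the sign becomes that of a
    list of positions, which can be evaluated on codes. *)
Lemma eps_index (A : countType) (L L' : seq A) : uniq L -> perm_eq L L' ->
  eps L * eps L' = inversion_sign L L'.
Proof.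
move=> uL LL; case: L uL LL => [|x0 L0] uL LL.
  by move: LL; rewrite perm_sym => /perm_nilP ->; rewrite epsK.
set L := x0 :: L0 in uL LL *.
have E1 : L = map (nth x0 L) (iota 0 (size L)) by rewrite -[LHS](mkseq_nth x0).
have E2 : L' = map (nth x0 L) (map (index^~ L) L').
  rewrite -map_comp -[LHS]map_id; apply/eq_in_map => x xL /=.
  by rewrite nth_index // (perm_mem LL).
rewrite {1}E1 {1}E2 eps_map_in.
- rewrite /inversion_sign; suff -> : eps (iota 0 (size L)) = 1 by rewrite mul1r.
  elim: (size L) 0%N => //= n IH j; rewrite eps_cons IH mulr1.
  rewrite (_ : count _ _ = 0%N) //; apply/eqP; rewrite -leqn0 leqNgt -has_count.
  apply/hasPn => y; rewrite mem_iota => /andP[jy _]; rewrite -leqNgt.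
  exact: ltnW.
- by move=> i j; rewrite !mem_iota /= !add0n => iL jL /eqP; rewrite nth_uniq // => /eqP.
- exact: iota_uniq.
apply: uniq_perm; rewrite ?iota_uniq //.
  rewrite map_inj_in_uniq -?(perm_uniq LL) // => x y; rewrite -!(perm_mem LL) => xL yL E.
  by rewrite -(nth_index x0 xL) E nth_index.
move=> i; rewrite mem_iota add0n; apply/idP/mapP => [iL|[x]].
  by exists (nth x0 L i); rewrite ?index_uniq // -(perm_mem LL) mem_nth.
by rewrite -(perm_mem LL) -index_mem => xL ->.
Qed.

Section Twist.
Variables (N : nat) (NE : size (pairs m) = N).
Variables (vs : seq (seq int)) (crit : seq nat).
Hypothesis vs_ok : codes_ok k (stdc k ++ vs).
Hypothesis crit_face : crit \in faces k vs.
Hypothesis crit_size : (m + size crit = N)%N.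
Hypothesis crit_det : detr N (map (sq2 m) (codesT k vs crit)) != 0.

Definition odet C : int := detr N (map (sq2 m) (map (actc C) (codesT k vs crit))).
Definition odet1 : int := detr N (map (sq2 m) (codesT k vs crit)).

Lemma ochar_code C : wfc C -> ochar N vs crit (GLc C) = (odet C)%:~R / (odet1)%:~R.
Proof.
move=> wC; have ok := codesT_ok vs_ok (crit_sub crit_face).
rewrite /ochar orient_top //; congr (_ / _); rewrite /top_cell map_lact_lineof //; last by case/andP: ok.
have allok : all (codeok k) (map (actc C) (codesT k vs crit)).
  apply/allP => c /mapP[d dL ->]; apply: actc_ok => //; case/andP: ok => /allP H _; exact: H.
apply: orient_codes => //.
- apply/andP; split => //.
  have /(uni_act (GLc C))/uni_uniq := top_uni vs_ok crit_face.
  rewrite /top_cell map_lact_lineof //; last by case/andP: ok.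
  exact: map_uniq.
- by rewrite !size_map size_cat size_stdc size_map.
rewrite -map_lact_lineof //; last by case/andP: ok.
exact/uni_act/(top_uni vs_ok crit_face).
Qed.

(** The second factor is the quotient of [odet C] by [odet1], kept in the integers; [tw_ok] excludes
    the default 0. *)
Definition tw L C : int :=
  (if odd (inversions (map (index^~ L) (map (actc C) L))) then -1 else 1) *
  (if odet C == odet1 then 1 else if odet C == - odet1 then -1 else 0).
Definition tw_ok C : bool := (odet C == odet1) || (odet C == - odet1).

Lemma twist_code L C : wfc C -> codes_ok k L -> moves_to L L C -> tw_ok C ->
  twist (ochar N vs crit) (map (lineof k) L) (GLc C) (map (lineof k) L) = (tw L C)%:~R.
Proof.
move=> wC /andP[ok uL] mv tk; rewrite /twist ochar_code // map_lact_lineof //.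
have inj : {in L &, injective (lineof k)} by move=> c d cL dL; apply: lineof_inj; apply: (allP ok).
rewrite (@eps_map_in _ _ _ _ _ inj uL); last by rewrite perm_sym.
rewrite eps_index 1?perm_sym // /tw rmorphM; congr (_ * _).
  by rewrite /inversion_sign /eps -signr_odd; case: odd.
have d0 : (odet1)%:~R != 0 :> rat by rewrite intr_eq0.
case/orP: tk => /eqP ->; rewrite ?eqxx ?divff //.
have -> : (- odet1 == odet1) = false.
  by apply/negbTE; apply: contra crit_det; rewrite -/odet1 => /eqP; lia.
by rewrite rmorphN mulNr divff.
Qed.

Lemma transporters_code L : codes_ok k L -> {subset stdc k <= L} -> uniq (stab_code L) ->
  perm_eq (transporters (map (lineof k) L) (map (lineof k) L)) (map GLc (stab_code L)).
Proof.
move=> /andP[ok uL] sub us.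
have wfs C : C \in stab_code L -> wfc C by rewrite !mem_filter => /and3P[].
have stdin j : lstd j \in map (lineof k) L.
  by rewrite -lineof_stdc map_f // sub // mem_nth // size_stdc.
apply: uniq_perm.
- by rewrite filter_uniq // frames_uniq.
- rewrite map_inj_in_uniq // => C C' /wfs w /wfs w' E.
  have : mxc C = mxc C' by rewrite -!val_GLc // E.
  move=> EM; have /and3P[/eqP sC /allP cC _] := w; have /and3P[/eqP sC' /allP cC' _] := w'.
  apply: (@eq_from_nth _ [::]); rewrite sC // => j jm.
  have s1 : size (nth [::] C j) = m by apply/eqP/cC; rewrite mem_nth ?sC.
  have s2 : size (nth [::] C' j) = m by apply/eqP/cC'; rewrite mem_nth ?sC'.
  apply: (@eq_from_nth _ 0); rewrite s1 // => i im.
  by have := congr1 (fun A : 'M[int]_m => A (Ordinal im) (Ordinal jm)) EM; rewrite !mxE.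
move=> g; rewrite transP; last exact: stdin.
apply/idP/mapP => [P|[C CS ->]].
  exists (columns g); last by rewrite GLc_columns.
  rewrite mem_filter -moves_toP ?columns_wf // GLc_columns P /=.
  by apply: columns_frames => // j; rewrite -(perm_mem P) map_f.
have w := wfs C CS; rewrite moves_toP //; by move: CS; rewrite mem_filter => /andP[].
Qed.

Definition reaches L L' : bool := search wfc (moves_to L L') (lists_of m (L' ++ map (map -%R) L')).

Lemma reaches_orbit L L' : all (codeok k) L -> all (codeok k) L' -> {subset stdc k <= L} ->
  same_orbit (map (lineof k) L) (map (lineof k) L') <-> reaches L L'.
Proof.
move=> ok ok' sub.
have stdin j : lstd j \in map (lineof k) L.
  by rewrite -lineof_stdc map_f // sub // mem_nth // size_stdc.
rewrite /reaches searchE; split=> [[g P]|/hasP[C _ /andP[w mv]]]; last by exists (GLc C); rewrite moves_toP.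
have : columns g \in frames_code L' by apply: columns_frames => // j; rewrite -(perm_mem P) map_f.
rewrite mem_filter => /andP[w Cf]; apply/hasP; exists (columns g) => //.
by rewrite w -moves_toP // GLc_columns.
Qed.

End Twist.
End CodedMatrices.

(** * Traces on symmetric powers *)

Section MonomialLists.

Fixpoint mons (k n : nat) : seq (seq nat) :=
  if k is k'.+1 then [seq i :: s | i <- iota 0 n.+1, s <- mons k' (n - i)]
  else if n is 0 then [:: [::]] else [::].

Lemma monsS k n : mons k.+1 n = [seq i :: s | i <- iota 0 n.+1, s <- mons k (n - i)].
Proof. by []. Qed.

Lemma monsP k n s : reflect (size s = k /\ sumn s = n) (s \in mons k n).
Proof.
elim: k n s => [|k IH] n s.
  case: n => [|n] /=; [rewrite inE|rewrite in_nil].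
    by apply: (iffP eqP) => [->//|[/size0nil]].
  by constructor; case=> /size0nil ->.
rewrite monsS; apply: (iffP allpairsPdep) => [[i [t [iI /IH[st Et] ->]]]|[]].
  by move: iI; rewrite mem_iota => /andP[_ iln] /=; rewrite st Et; split; lia.
case: s => [//|i t] [st] Et; exists i, t; split => //.
  by rewrite mem_iota; move: Et => /=; lia.
by apply/IH; split => //; move: Et => /=; lia.
Qed.

Lemma mons_uniq k n : uniq (mons k n).
Proof.
elim: k n => [|k IH] n; first by case: n.
rewrite monsS; apply: allpairs_uniq_dep => [|i _|]; [exact: iota_uniq|exact: IH|].
by move=> [i s] [j t] _ _ /= [-> ->].
Qed.

Local Open Scope ring_scope.
Variable F : comNzRingType.

Fixpoint monv (ls : seq F) (s : seq nat) : F :=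
  if ls is x :: ls' then (if s is i :: s' then x ^+ i * monv ls' s' else 1) else 1.

Definition hsym (ls : seq F) (n : nat) : F := \sum_(s <- mons (size ls) n) monv ls s.

Lemma hsym_nil n : hsym [::] n = (n == 0%N)%:R.
Proof. by rewrite /hsym; case: n => [|n] /=; rewrite ?big_seq1 ?big_nil. Qed.

Lemma hsymE x ls n : hsym (x :: ls) n = \sum_(i <- iota 0 n.+1) x ^+ i * hsym ls (n - i).
Proof.
rewrite /hsym monsS big_allpairs_dep; apply: eq_bigr => i _.
by rewrite mulr_sumr; apply: eq_bigr => s _.
Qed.

Lemma monvE ls s : size s = size ls -> monv ls s = \prod_(0 <= i < size ls) (nth 0 ls i) ^+ (nth 0%N s i).
Proof.
elim: ls s => [|x ls IH] s; first by rewrite big_geq.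
by case: s => [|i s] //= [sz]; rewrite big_nat_recl //= IH.
Qed.

Lemma hsym0 x ls : hsym (x :: ls) 0 = hsym ls 0.
Proof. by rewrite hsymE /= big_seq1 expr0 mul1r. Qed.

(** Monomials are sorted according to whether x divides them. Iterated over the variables, this
    yields the linear recurrence satisfied by the traces. *)
Lemma hsymS x ls n : hsym (x :: ls) n.+1 = x * hsym (x :: ls) n + hsym ls n.+1.
Proof.
rewrite !hsymE -[iota 0 n.+2]/(0%N :: iota 1 n.+1) big_cons expr0 mul1r subn0 addrC; congr (_ + _).
rewrite -(addn0 1%N) iotaDl big_map mulr_sumr; apply: eq_bigr => i _.
by rewrite add1n exprS subSS mulrA.
Qed.

End MonomialLists.

Section SymmetricPower.
Local Open Scope ring_scope.

Section Ring.
Variables (F : comNzRingType) (m : nat).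
Implicit Types (g h : 'M[F]_m) (p : {mpoly F[m]}).

Definition lform h (j : 'I_m) : {mpoly F[m]} := \sum_(i < m) h i j *: 'X_i.
Definition msubst h p : {mpoly F[m]} := p \mPo [tuple lform h j | j < m].

Lemma msubstX h (a : 'X_{1..m}) : msubst h 'X_[a] = \prod_(i < m) lform h i ^+ a i.
Proof. by rewrite /msubst comp_mpolyX; apply: eq_bigr => i _; rewrite tnth_mktuple. Qed.

Lemma msubstE h p : msubst h p = \sum_(a <- msupp p) p@_a *: \prod_(i < m) lform h i ^+ a i.
Proof.
rewrite /msubst comp_mpolyE; apply: eq_bigr => a _; congr (_ *: _).
by apply: eq_bigr => i _; rewrite tnth_mktuple.
Qed.

Lemma msubst_linear_sum h (I : Type) (r : seq I) (c : I -> F) (q : I -> {mpoly F[m]}) :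
  msubst h (\sum_(i <- r) c i *: q i) = \sum_(i <- r) c i *: msubst h (q i).
Proof. rewrite /msubst raddf_sum; apply: eq_bigr => i _; exact: comp_mpolyZ. Qed.

Lemma msubst_lform g h j : msubst g (lform h j) = lform (g *m h) j.
Proof.
rewrite {1}/lform msubst_linear_sum /lform.
under eq_bigr => i _.
  rewrite msubstX (bigD1 i) //= mnm1E eqxx expr1 big1 ?mulr1 => [|l li]; last first.
    by rewrite mnm1E eq_sym (negbTE li) expr0.
  rewrite /lform scaler_sumr; over.
rewrite exchange_big /=; apply: eq_bigr => l _; rewrite !mxE scaler_suml.
by apply: eq_bigr => i _; rewrite scalerA mulrC.
Qed.

Lemma msubstM g h p : msubst (g *m h) p = msubst g (msubst h p).
Proof.
rewrite [in RHS](msubstE h) msubst_linear_sum msubstE; apply: eq_bigr => a _; congr (_ *: _).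
rewrite /msubst rmorph_prod; apply: eq_bigr => i _.
by rewrite rmorphXn -[X in _ = X ^+ _]/(msubst g (lform h i)) msubst_lform.
Qed.

Lemma msubst1 p : msubst 1%:M p = p.
Proof.
rewrite -[RHS]comp_mpoly_id /msubst; congr comp_mpoly; apply: eq_from_tnth => j.
rewrite !tnth_mktuple /lform (bigD1 j) //= mxE eqxx scale1r big1 ?addr0 // => i ij.
by rewrite mxE (negbTE ij) scale0r.
Qed.

Variable n : nat.
Notation D := (size (mons m n)).
Definition mn (s : seq nat) : 'X_{1..m} := [multinom nth 0%N s i | i < m].
Definition mon (i : 'I_D) : 'X_{1..m} := mn (nth [::] (mons m n) i).

Lemma mon_code (i : 'I_D) : size (nth [::] (mons m n) i) = m /\ sumn (nth [::] (mons m n) i) = n.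
Proof. by apply/monsP; apply: mem_nth. Qed.

Lemma mdeg_mon i : mdeg (mon i) = n.
Proof.
have [sz <-] := mon_code i; rewrite mdegE sumnE (big_nth 0%N) sz big_mkord.
by apply: eq_bigr => j _; rewrite mnmE.
Qed.

Lemma mon_inj : injective mon.
Proof.
move=> i j E; apply: val_inj; apply/eqP; rewrite -(nth_uniq [::] _ _ (mons_uniq m n)) ?ltn_ord //.
apply/eqP; have [si _] := mon_code i; have [sj _] := mon_code j.
apply: (@eq_from_nth _ 0%N); rewrite si ?sj // => l lm.
by have := congr1 (fun a : 'X_{1..m} => a (Ordinal lm)) E; rewrite !mnmE.
Qed.

Lemma mon_surj (a : 'X_{1..m}) : mdeg a = n -> exists i, mon i = a.
Proof.
move=> da; pose s : seq nat := [seq a i | i <- enum 'I_m].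
have sz : size s = m by rewrite size_map size_enum_ord.
have ns (i : 'I_m) : nth 0%N s i = a i by rewrite (nth_map i) ?size_enum_ord // nth_ord_enum.
have sI : s \in mons m n.
  apply/monsP; split => //; rewrite -da mdegE sumnE (big_nth 0%N) sz big_mkord.
  by apply: eq_bigr => i _; rewrite ns.
have lt : (index s (mons m n) < D)%N by rewrite index_mem.
exists (Ordinal lt); apply/mnmP => i; rewrite mnmE /= nth_index //.
Qed.

Definition topoly (v : 'rV[F]_D) : {mpoly F[m]} := \sum_i v 0 i *: 'X_[mon i].
Definition ofpoly p : 'rV[F]_D := \row_i p@_(mon i).

Lemma topoly_homog v : topoly v \is n.-homog.
Proof. by apply: rpred_sum => i _; apply: rpredZ; rewrite dhomogX /= mdeg_mon. Qed.

Lemma topolyK v : ofpoly (topoly v) = v.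
Proof.
apply/rowP => i; rewrite mxE raddf_sum (bigD1 i) //= mcoeffZ mcoeffX eqxx mulr1 big1 ?addr0 // => j ji.
by rewrite mcoeffZ mcoeffX (inj_eq mon_inj) (negbTE ji) mulr0.
Qed.

Lemma ofpolyK p : p \is n.-homog -> topoly (ofpoly p) = p.
Proof.
move=> hp; apply/mpolyP => a; have [/mon_surj[i <-]|da] := eqVneq (mdeg a) n.
  by have := congr1 (fun v : 'rV_D => v 0 i) (topolyK (ofpoly p)); rewrite !mxE.
rewrite (dhomog_nemf_coeff hp da); exact: (dhomog_nemf_coeff (topoly_homog _) da).
Qed.

Lemma topoly_inj : injective topoly. Proof. exact: can_inj topolyK. Qed.

(** Rows are images of monomials, so the matrix acts on row vectors from the right and products are
    reversed in [sympM]. *)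
Definition symp h : 'M[F]_D := \matrix_i ofpoly (msubst h 'X_[mon i]).

Lemma lform_homog h j : lform h j \is 1.-homog.
Proof. by apply: rpred_sum => i _; apply: rpredZ; rewrite dhomogX /= mdeg1. Qed.

Lemma msubst_homogX h i : msubst h 'X_[mon i] \is n.-homog.
Proof.
rewrite msubstX -(mdeg_mon i) mdegE.
elim: (index_enum 'I_m) => [|j r IH]; first by rewrite !big_nil dhomog1.
rewrite !big_cons; apply: dhomogM IH; rewrite -[X in _ \is X.-homog]mul1n.
exact: (dhomogMn (mon i j) (lform_homog h j)).
Qed.

Lemma msubst_topoly h v : msubst h (topoly v) = topoly (v *m symp h).
Proof.
rewrite /topoly msubst_linear_sum.
under [RHS]eq_bigr do rewrite mxE scaler_suml.
rewrite exchange_big; apply: eq_bigr => i _ /=.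
rewrite -{1}(ofpolyK (msubst_homogX h i)) /topoly scaler_sumr; apply: eq_bigr => j _.
by rewrite scalerA !mxE.
Qed.

Lemma sympM g h : symp (g *m h) = symp h *m symp g.
Proof.
apply/row_matrixP => i; apply: topoly_inj; rewrite 2!rowE.
rewrite -(msubst_topoly (g *m h)) msubstM (msubst_topoly h) (msubst_topoly g).
by rewrite mulmxA.
Qed.

Lemma symp1 : symp 1%:M = 1%:M.
Proof.
apply/row_matrixP => i; apply: topoly_inj; rewrite !rowE -msubst_topoly msubst1.
by rewrite mulmx1.
Qed.

(** A diagonal substitution has the monomials as eigenvectors, each with eigenvalue the same
    monomial in the diagonal entries. *)
Lemma symp_diag (d : 'rV[F]_m) : \tr (symp (diag_mx d)) = hsym [seq d 0 i | i <- enum 'I_m] n.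
Proof.
have mv (s : seq nat) : size s = m -> monv [seq d 0 i | i <- enum 'I_m] s = \prod_(j < m) d 0 j ^+ nth 0%N s j.
  move=> sz; rewrite (@monvE _ _ s) size_map size_enum_ord // big_mkord; apply: eq_bigr => j _.
  by rewrite (nth_map j) ?size_enum_ord // nth_ord_enum.
rewrite /hsym size_map size_enum_ord (big_nth [::]) big_mkord; apply: eq_bigr => i _.
have [sz _] := mon_code i; rewrite mv // !mxE msubstX.
have -> : \prod_(j < m) lform (diag_mx d) j ^+ mon i j = (\prod_(j < m) d 0 j ^+ mon i j) *: 'X_[mon i].
  rewrite -[X in _ *: X]comp_mpoly_id comp_mpolyX -mul_mpolyC rmorph_prod -big_split; apply: eq_bigr => j _ /=.
  rewrite tnth_mktuple rmorphXn -exprMn; congr (_ ^+ _); rewrite mul_mpolyC /lform (bigD1 j) //= mxE eqxx mulr1n.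
  by rewrite big1 ?addr0 // => l lj; rewrite mxE (negbTE lj) mulr0n scale0r.
rewrite mcoeffZ mcoeffX eqxx mulr1; apply: eq_bigr => j _; by rewrite mnmE.
Qed.

End Ring.

Lemma symp_conj (F : fieldType) m n (P h : 'M[F]_m) : P \in unitmx ->
  \tr (symp n (invmx P *m h *m P)) = \tr (symp n h).
Proof.
move=> uP.
rewrite (sympM n (invmx P *m h) P).
rewrite (mxtrace_mulC (symp n P)).
rewrite (sympM n (invmx P) h).
rewrite -(mulmxA (symp n h)).
have E : symp n (invmx P) *m symp n P = 1%:M by rewrite -symp1 -(mulmxV uP) [RHS]sympM.
by rewrite [X in _ *m X]E mulmx1.
Qed.

Lemma symp_map (F F' : comNzRingType) (f : {rmorphism F -> F'}) m n (h : 'M[F]_m) :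
  symp n (map_mx f h) = map_mx f (symp n h).
Proof.
apply/matrixP => i j; rewrite !mxE -mcoeff_map_mpoly !msubstX rmorph_prod; congr (_@__).
apply: eq_bigr => l _; rewrite rmorphXn; congr (_ ^+ _); rewrite /lform raddf_sum.
apply: eq_bigr => q _; by rewrite mxE; rewrite [RHS]map_mpolyZ map_mpolyX.
Qed.

End SymmetricPower.

Section Traces.
Local Open Scope ring_scope.

(** The minimal polynomial divides X^d - 1, which splits over [algC] with distinct roots. *)
Lemma finite_order_diag m (A : 'M[algC]_m.+1) d : (0 < d)%N -> A ^+ d = 1 ->
  exists2 P : 'M_m.+1, P \in unitmx & exists D : 'rV_m.+1, A = invmx P *m diag_mx D *m P.
Proof.
move=> d0 Ad; have [z pz] := C_prim_root_exists d0.
have [|P uP sP] := (diagonalizableP A).2.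
  exists [seq z ^+ i | i <- index_iota 0 d].
    rewrite map_inj_in_uniq ?iota_uniq // => i j; rewrite !mem_index_iota => /andP[_ id] /andP[_ jd] /eqP.
    by rewrite (eq_prim_root_expr pz) !modn_small // => /eqP.
  rewrite big_map (factor_Xn_sub_1 pz); apply: mxminpoly_min.
  by rewrite rmorphB rmorphXn /= horner_mx_X rmorph1 Ad subrr.
exists P => //; have [D E] := similar_diagLR uP sP; exists D.
by rewrite {1}E conjumx ?unitmx_inv // invmxK.
Qed.

Lemma enum3 : enum 'I_3 = [:: 0; 1; 2%:R].
Proof. by apply: (inj_map val_inj); rewrite val_enum_ord. Qed.

Lemma enum2 : enum 'I_2 = [:: 0; 1].
Proof. by apply: (inj_map val_inj); rewrite val_enum_ord. Qed.

(* The first entry of the n-th state is h_n(x, y, z), with e1, e2, e3 the elementary symmetric functions of x, y, z. *)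
Definition hstep (e s : int * int * int) : int * int * int :=
  let: (e1, e2, e3) := e in let: (a, b, c) := s in (b, c, e1 * c - e2 * b + e3 * a).
Definition hinit (e : int * int * int) : int * int * int :=
  let: (e1, e2, e3) := e in (1, e1, e1 * e1 - e2).
Definition hstate e n := iter n (hstep e) (hinit e).
Definition hseq e n : int := (hstate e n).1.1.

Lemma hseqP (F : comNzRingType) (t : nat -> F) (e1 e2 e3 : int) :
  t 0%N = 1 -> t 1%N = e1%:~R -> t 2%N = e1%:~R * e1%:~R - e2%:~R ->
  (forall n, t n.+3 = e1%:~R * t n.+2 - e2%:~R * t n.+1 + e3%:~R * t n) ->
  forall n, t n = (hseq (e1, e2, e3) n)%:~R.
Proof.
move=> t0 t1 t2 tS n; rewrite /hseq.
suff : [/\ t n = (hstate (e1, e2, e3) n).1.1%:~R, t n.+1 = (hstate (e1, e2, e3) n).1.2%:~R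
  & t n.+2 = (hstate (e1, e2, e3) n).2%:~R] by case.
elim: n => [|n]; first by split=> //=; rewrite t2 rmorphB rmorphM.
rewrite /hstate iterS; case: (iter _ _ _) => -[a b] c /= [Ea Eb Ec]; split => //.
by rewrite tS Ea Eb Ec rmorphD rmorphB !rmorphM.
Qed.

(** Both traces are images of the same integer, so the trace may be computed over [algC], where
    matrices of finite order are diagonalisable. *)
Lemma tr_symp_int m n (A : 'M[int]_m) (c : int) :
  \tr (symp n (map_mx (intr : int -> algC) A)) = c%:~R ->
  \tr (symp n (map_mx (intr : int -> rat) A)) = c%:~R.
Proof.
rewrite !(symp_map (intr : {rmorphism int -> _})) !trace_map_mx /= => /intr_inj ->.
by [].
Qed.

(** The trace is the complete symmetric polynomial of the eigenvalues, which obeys the recurrence of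
    order three given by their elementary symmetric functions. The second of these enters through
    Newton's identity, as the trace of A^2 is easy to evaluate. *)
Lemma tr_symp3 (A : 'M[int]_3) d e1 e2 e3 n : (0 < d)%N -> A ^+ d = 1 ->
  \tr A = e1 -> \tr (A *m A) = e1 * e1 - 2%:Z * e2 -> \det A = e3 ->
  \tr (symp n (map_mx (intr : int -> rat) A)) = (hseq (e1, e2, e3) n)%:~R.
Proof.
move=> d0 Ad T1 T2 T3; apply: tr_symp_int.
set B := map_mx _ A; have Bd : B ^+ d = 1 by rewrite /B -rmorphXn Ad rmorph1.
have [P uP [D E]] := finite_order_diag d0 Bd.
have tP (M : 'M_3) : \tr (invmx P *m M *m P) = \tr M.
  by rewrite mxtrace_mulC mulmxA mulmxV // mul1mx.
have t1 : \tr B = D 0 0 + D 0 1 + D 0 2%:R.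
  by rewrite E tP mxtrace_diag !big_ord_recr big_ord0 /= add0r; congr (D 0 _ + D 0 _ + D 0 _); apply: val_inj.
have t2 : \tr (B *m B) = D 0 0 ^+ 2 + D 0 1 ^+ 2 + D 0 2%:R ^+ 2.
  have -> : B *m B = invmx P *m (diag_mx D *m diag_mx D) *m P.
    by rewrite E !mulmxA; congr (_ *m _); rewrite -!mulmxA; congr (_ *m (_ *m _)); rewrite !mulmxA mulmxV // mul1mx.
  rewrite tP mulmx_diag mxtrace_diag !big_ord_recr big_ord0 /= add0r !mxE !expr2.
  by congr (D 0 _ * D 0 _ + D 0 _ * D 0 _ + D 0 _ * D 0 _); apply: val_inj.
have t3 : \det B = D 0 0 * D 0 1 * D 0 2%:R.
  rewrite E !det_mulmx mulrAC -det_mulmx mulVmx // det1 mul1r det_diag !big_ord_recr big_ord0 /= mul1r.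
  by congr (D 0 _ * D 0 _ * D 0 _); apply: val_inj.
have {}T1 : D 0 0 + D 0 1 + D 0 2%:R = e1%:~R by rewrite -t1 trace_map_mx T1.
have {}T3 : D 0 0 * D 0 1 * D 0 2%:R = e3%:~R by rewrite -t3 det_map_mx T3.
have {}T2 : D 0 0 * D 0 1 + D 0 0 * D 0 2%:R + D 0 1 * D 0 2%:R = e2%:~R.
  have : D 0 0 ^+ 2 + D 0 1 ^+ 2 + D 0 2%:R ^+ 2 = e1%:~R * e1%:~R - 2 * e2%:~R.
    by rewrite -t2 -map_mxM trace_map_mx T2 rmorphB !rmorphM.
  rewrite -T1 => H; apply: (@mulfI _ (2 : algC)); first by rewrite pnatr_eq0.
  transitivity ((D 0 0 + D 0 1 + D 0 2%:R) * (D 0 0 + D 0 1 + D 0 2%:R) - (D 0 0 ^+ 2 + D 0 1 ^+ 2 + D 0 2%:R ^+ 2)).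
    by ring.
  by rewrite H; ring.
have st k : \tr (symp k B) = hsym [:: D 0 0; D 0 1; D 0 2%:R] k.
  by rewrite E symp_conj // symp_diag enum3.
rewrite st -/B; apply: (hseqP (t := hsym _)) => [|||k].
- by rewrite !hsym0 hsym_nil.
- by rewrite !hsymS !hsym0 !hsym_nil -T1 /=; ring.
- by rewrite !hsymS !hsym0 !hsym_nil -T1 -T2 /=; ring.
by rewrite !hsymS !hsym_nil -T1 -T2 -T3 /=; ring.
Qed.

Lemma tr_symp2 (A : 'M[int]_2) d e1 e2 n : (0 < d)%N -> A ^+ d = 1 ->
  \tr A = e1 -> \tr (A *m A) = e1 * e1 - 2%:Z * e2 ->
  \tr (symp n (map_mx (intr : int -> rat) A)) = (hseq (e1, e2, 0) n)%:~R.
Proof.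
move=> d0 Ad T1 T2; apply: tr_symp_int.
set B := map_mx _ A; have Bd : B ^+ d = 1 by rewrite /B -rmorphXn Ad rmorph1.
have [P uP [D E]] := finite_order_diag d0 Bd.
have tP (M : 'M_2) : \tr (invmx P *m M *m P) = \tr M.
  by rewrite mxtrace_mulC mulmxA mulmxV // mul1mx.
have t1 : \tr B = D 0 0 + D 0 1.
  by rewrite E tP mxtrace_diag !big_ord_recr big_ord0 /= add0r; congr (D 0 _ + D 0 _); apply: val_inj.
have t2 : \tr (B *m B) = D 0 0 ^+ 2 + D 0 1 ^+ 2.
  have -> : B *m B = invmx P *m (diag_mx D *m diag_mx D) *m P.
    by rewrite E !mulmxA; congr (_ *m _); rewrite -!mulmxA; congr (_ *m (_ *m _)); rewrite !mulmxA mulmxV // mul1mx.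
  rewrite tP mulmx_diag mxtrace_diag !big_ord_recr big_ord0 /= add0r !mxE !expr2.
  by congr (D 0 _ * D 0 _ + D 0 _ * D 0 _); apply: val_inj.
have {}T1 : D 0 0 + D 0 1 = e1%:~R by rewrite -t1 trace_map_mx T1.
have {}T2 : D 0 0 * D 0 1 = e2%:~R.
  have : D 0 0 ^+ 2 + D 0 1 ^+ 2 = e1%:~R * e1%:~R - 2 * e2%:~R.
    by rewrite -t2 -map_mxM trace_map_mx T2 rmorphB !rmorphM.
  rewrite -T1 => H; apply: (@mulfI _ (2 : algC)); first by rewrite pnatr_eq0.
  transitivity ((D 0 0 + D 0 1) * (D 0 0 + D 0 1) - (D 0 0 ^+ 2 + D 0 1 ^+ 2)); first by ring.
  by rewrite H; ring.
have st k : \tr (symp k B) = hsym [:: D 0 0; D 0 1] k.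
  by rewrite E symp_conj // symp_diag enum2.
rewrite st -/B; apply: (hseqP (t := hsym _)) => [|||k].
- by rewrite !hsym0 hsym_nil.
- by rewrite !hsymS !hsym0 !hsym_nil -T1 /=; ring.
- by rewrite !hsymS !hsym0 !hsym_nil -T1 -T2 /=; ring.
by rewrite !hsymS !hsym_nil -T1 -T2 mul0r /=; ring.
Qed.

End Traces.

(** * Recurrent sequences that are quasi-polynomials of period 12 *)

Section QuasiPolynomials.
Local Open Scope ring_scope.

(** With f = 1 + u, the hypotheses say u s0 = s1, u s1 = s2 and u s2 = 0, so the binomial expansion
    of the q-th power stops after three terms. *)
Lemma iter_unipotent (V : zmodType) (f : V -> V) s0 s1 s2 q : {morph f : x y / x + y} ->
  f s0 = s0 + s1 -> f s1 = s1 + s2 -> f s2 = s2 ->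
  iter q f s0 = s0 + s1 *+ q + s2 *+ 'C(q, 2).
Proof.
move=> fD f0 f1 f2.
have f00 : f 0 = 0 by apply: (addrI (f 0)); rewrite -fD !addr0.
have fM x n : f (x *+ n) = f x *+ n by elim: n => [|n IH]; rewrite ?mulr0n // !mulrS fD IH.
elim: q => [|q IH]; first by rewrite /= bin0n !mulr0n !addr0.
rewrite iterS IH !fD !fM f0 f1 f2 binS bin1 mulrnDl mulrS mulrnDr.
rewrite -!addrA; congr (_ + (_ + (_ + _))); exact: addrC.
Qed.

Implicit Types (e s : int * int * int) (W : seq (int * (int * int * int))).

Lemma hstepD e : {morph hstep e : s t / s + t}.
Proof.
case: e => -[e1 e2] e3 [[a b] c] [[a' b'] c'].
rewrite -[LHS]/(b + b', c + c', e1 * (c + c') - e2 * (b + b') + e3 * (a + a')).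
rewrite -[RHS]/(b + b', c + c', e1 * c - e2 * b + e3 * a + (e1 * c' - e2 * b' + e3 * a')).
by congr (_, _); ring.
Qed.

Definition year e : (int * int * int) -> (int * int * int) := iter 12 (hstep e).
Definition drift e s := year e s - s.

Lemma iter_hstepD e k s t : iter k (hstep e) (s + t) = iter k (hstep e) s + iter k (hstep e) t.
Proof. by elim: k => //= k ->; rewrite hstepD. Qed.

Lemma iter_hstepMn e k s n : iter k (hstep e) (s *+ n) = iter k (hstep e) s *+ n.
Proof.
elim: n => [|n IH]; last by rewrite !mulrS iter_hstepD IH.
by apply: (addrI (iter k (hstep e) 0)); rewrite -iter_hstepD !addr0.
Qed.

(* Satisfied when x, y, z are 12th roots of unity. *)
Definition quasi e : bool := year e (drift e (drift e (hinit e))) == drift e (drift e (hinit e)).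

Definition coefs e k : int * int * int :=
  ((iter k (hstep e) (hinit e)).1.1, (iter k (hstep e) (drift e (hinit e))).1.1,
   (iter k (hstep e) (drift e (drift e (hinit e)))).1.1).

Lemma fst_fstMn s n : (s *+ n).1.1 = s.1.1 *+ n.
Proof. by elim: n => // n IH; rewrite !mulrS -IH. Qed.

(** The third difference under a shift by 12 vanishes, so along k + 12 q the sequence is quadratic
    in q. Binomial coefficients keep the expansion in the integers. *)
Lemma hseq_quasi e q k : quasi e ->
  hseq e (k + q * 12) = (coefs e k).1.1 + (coefs e k).1.2 *+ q + (coefs e k).2 *+ 'C(q, 2).
Proof.
move=> /eqP Q; rewrite /hseq /hstate iterD.
have -> : iter (q * 12) (hstep e) (hinit e) = iter q (year e) (hinit e).
  by elim: q => // q IH; rewrite mulSn iterD IH.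
have d s : year e s = s + drift e s by rewrite /drift addrCA subrr addr0.
rewrite (@iter_unipotent _ (year e) _ (drift e (hinit e)) (drift e (drift e (hinit e)))) //.
  by rewrite !iter_hstepD !iter_hstepMn -!fst_fstMn.
exact: iter_hstepD.
Qed.

Definition weighted W n : int := \sum_(x <- W) x.1 * hseq x.2 n.

Definition wcoefs W k : int * int * int :=
  foldr (fun x acc => let c := coefs x.2 k in
    (x.1 * c.1.1 + acc.1.1, x.1 * c.1.2 + acc.1.2, x.1 * c.2 + acc.2)) (0, 0, 0) W.

(** The factor 48 clears the orders of the stabilisers. For even k the announced value drops by 1
    whenever q grows by 1, whence the slope -48, and the quadratic terms have to cancel. *)
Definition balanced W : bool :=
  all (fun x => quasi x.2) W &&
  all (fun k => wcoefs W k == (48 * chi_value k, if odd k then 0 else - 48, 0)) (iota 0 12).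

Lemma weighted_quasi W q k : all (fun x => quasi x.2) W ->
  weighted W (k + q * 12) = (wcoefs W k).1.1 + (wcoefs W k).1.2 *+ q + (wcoefs W k).2 *+ 'C(q, 2).
Proof.
rewrite /weighted; elim: W => [|x W IH] /=; first by rewrite big_nil !mul0rn !addr0.
move=> /andP[Q /IH{}IH]; rewrite big_cons IH hseq_quasi //=.
by rewrite !mulrnDl !mulrDr !mulrnAr; ring.
Qed.

Lemma chi_value_add q k : (k < 12)%N -> chi_value (k + q * 12) = chi_value k - (if odd k then 0 else q%:Z).
Proof.
move=> k12; rewrite /chi_value addnC divnMDl // modnMDl.
rewrite (divn_small k12) (modn_small k12) addn0.
by case: ifP => // _; do 2! [case: ifP => _ //=]; lia.
Qed.

Lemma weighted_chi W n : balanced W -> weighted W n = 48 * chi_value n.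
Proof.
move=> /andP[Q /allP H]; have k12 := ltn_pmod n (isT : 0 < 12)%N.
rewrite (divn_eq n 12) addnC weighted_quasi // chi_value_add //.
have /eqP -> : wcoefs W (n %% 12) == (48 * chi_value (n %% 12), if odd (n %% 12) then 0 else - 48, 0).
  by apply: H; rewrite mem_iota.
by rewrite /= mul0rn addr0; case: odd; rewrite ?mul0rn; lia.
Qed.

End QuasiPolynomials.

(** * Dimensions of the cochain spaces *)

Section OrbitCodes.
Local Open Scope ring_scope.
Variable k : nat.
Notation m := k.+1.
Implicit Types (C L : seq (seq int)).

Definition matmul C C' : seq (seq int) := map (mulc k C) C'.
Definition trc C : int := foldr (fun i acc => (nth [::] C i)`_i + acc) 0 (iota 0 m).
(** Newton's identity; [torsion] checks that the division is exact. *)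
Definition esym2 C : int := ((trc C * trc C - trc (matmul C C)) %/ 2)%Z.
(** For 2 x 2 matrices the value 0 for e3 reduces the recurrence of order three to the one for two
    eigenvalues. *)
Definition char_coefs C : int * int * int := (trc C, esym2 C, if k is 1 then 0 else detr m C).
Definition torsion C : bool :=
  (iter 12 (matmul C) (stdc k) == stdc k) && (trc (matmul C C) == trc C * trc C - 2%:Z * esym2 C).

Lemma tr_mxc C : \tr (mxc k C) = trc C.
Proof.
rewrite /mxtrace; transitivity (\sum_(i <- iota 0 m) (nth [::] C i)`_i).
  by rewrite -[iota 0 m]/(index_iota 0 m) big_mkord; apply: eq_bigr => i _; rewrite mxE.
rewrite /trc; elim: (iota 0 m) => [|q r IH]; first by rewrite big_nil.
by rewrite big_cons IH.
Qed.

Lemma mxc_matmul C C' : size C' = m -> mxc k (matmul C C') = mxc k C *m mxc k C'.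
Proof.
move=> sz; apply/matrixP => i j; rewrite mxE (nth_map [::]) ?sz //.
have := congr1 (fun u : 'cV[int]_m => u i 0) (colof_mulc k C (nth [::] C' j)).
by rewrite !mxE => ->; apply: eq_bigr => q _; rewrite !mxE.
Qed.

Lemma mxc_iter C d : mxc k (iter d (matmul C) (stdc k)) = mxc k C ^+ d.
Proof.
elim: d => [|d IH]; first by apply/matrixP => i j; rewrite !mxE nth_stdc2 eq_sym.
rewrite iterS mxc_matmul ?IH ?exprS //.
by elim: d {IH} => [|d IH]; rewrite ?size_stdc // iterS size_map.
Qed.

Lemma tr_code C n : (k == 1%N) || (k == 2%N) -> wfc k C -> torsion C ->
  \tr (symp n (map_mx (intr : int -> rat) (mxc k C))) = (hseq (char_coefs C) n)%:~R.
Proof.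
move=> k12 wC /andP[/eqP o /eqP t2].
have E : mxc k C ^+ 12 = 1 by rewrite -mxc_iter o -[stdc k]/(iter 0 (matmul C) (stdc k)) mxc_iter.
have T1 := tr_mxc C; have T3 := det_mxc wC.
have T2 : \tr (mxc k C *m mxc k C) = trc C * trc C - 2%:Z * esym2 C.
  by rewrite -mxc_matmul ?tr_mxc //; have /and3P[/eqP] := wC.
rewrite /char_coefs; move: (mxc k C) (trc C) (esym2 C) (detr m C) T1 T2 T3 E.
case/orP: k12 => /eqP -> A e1 e2 e3 T1 T2 T3 E; first exact: (tr_symp2 n (isT : 0 < 12)%N).
exact: (tr_symp3 n (isT : 0 < 12)%N).
Qed.

Variable n : nat.
Definition sym_rep (g : GLZ m) : 'M[rat]_(size (mons m n)) := symp n (map_mx intr (val g)).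

Lemma sym_repM g h : sym_rep (GLZmul m g h) = sym_rep h *m sym_rep g.
Proof. by rewrite /sym_rep map_mxM sympM. Qed.

Variables (N : nat) (NE : size (pairs m) = N).
Variables (vs : seq (seq int)) (crit : seq nat).
Hypothesis vs_ok : codes_ok k (stdc k ++ vs).
Hypothesis vs_cover : all (fun c => lposl c ==> (c \in stdc k ++ vs)) (lists_of m [:: -1; 0; 1]).
Hypothesis crit_face : crit \in faces k vs.
Hypothesis crit_size : (m + size crit = N)%N.
Hypothesis crit_det : detr N (map (sq2 m) (codesT k vs crit)) != 0.
Hypothesis k12 : (k == 1%N) || (k == 2%N).

Local Notation och := (ochar N vs crit).
Local Notation cell U := (map (lineof k) (codesT k vs U)).
Definition orbit_dim U : nat := \rank (proj sym_rep och (cell U)).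
Definition stab_list U := stab_code k (codesT k vs U).
Definition contribution (w : int) U : seq (int * (int * int * int)) :=
  let L := codesT k vs U in [seq (w * tw k N vs crit L C, char_coefs C) | C <- stab_code k L].
Definition stab_ok U : bool :=
  let S := stab_list U in [&& uniq S, all (tw_ok k N vs crit) S & all torsion S].

(** The character formula with its denominator cleared; in [cells_ok] the weight w is such that w
    times the order of the stabiliser is 48 up to sign. *)
Lemma orbit_dim_trace U w : U \in faces k vs -> stab_ok U ->
  w * (size (stab_list U))%:Z * (orbit_dim U)%:Z = weighted (contribution w U) n.
Proof.
move=> UF /and3P[uS /allP tS /allP oS].
have UI : U \in sublists (iota 0 (size vs)) by move: UF; rewrite mem_filter => /andP[].
have ok : codes_ok k (codesT k vs U) by apply: codesT_ok.
have sub : {subset stdc k <= codesT k vs U} by move=> c cs; rewrite mem_cat cs.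
have stdin j : lstd j \in cell U.
  by rewrite -lineof_stdc map_f // sub // mem_nth // size_stdc.
have cM := ocharM NE vs_ok crit_face crit_size crit_det.
have uC : uni (cell U).
  by apply/uniL_P => //; move: UF; rewrite mem_filter => /andP[].
(* The projector does not involve the degree, so the formula is instantiated with p = 0 and N the
   size of the cell. *)
have T := proj_trace sym_repM cM stdin uC (addn0 _); rewrite -/(orbit_dim U) in T.
have P := transporters_code ok sub uS.
have s0 : (size (stab_list U))%:R != 0 :> rat.
  by have := stab_size stdin; rewrite (perm_size P) size_map.
rewrite (perm_size P) size_map (perm_big _ P) big_map in T.
apply: (@intr_inj rat); rewrite /weighted big_map rmorph_sum /=.
rewrite 2!intrM -mulrA -!pmulrn T mulVKf // mulr_sumr.
apply: eq_big_seq => C CS; have wC : wfc k C.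
  by move: CS; rewrite !mem_filter => /and3P[].
have mC : moves_to k (codesT k vs U) (codesT k vs U) C by move: CS; rewrite mem_filter => /andP[].
rewrite (twist_code NE vs_ok crit_face crit_size crit_det wC ok mC (tS C CS)).
by rewrite /sym_rep val_GLc // (tr_code n k12 wC (oS C CS)) 2!intrM mulrA.
Qed.

Definition weights (cells : seq (int * seq nat)) := flatten [seq contribution x.1 x.2 | x <- cells].
Definition cells_ok (cells : seq (int * seq nat)) : bool :=
  all (fun x => [&& stab_ok x.2 & absz x.1 * size (stab_list x.2) == 48]%N) cells && balanced (weights cells).

Lemma cells_chi (cells : seq (int * seq nat)) : {subset [seq x.2 | x <- cells] <= faces k vs} ->
  cells_ok cells -> \sum_(x <- cells) sgz x.1 * (orbit_dim x.2)%:Z = chi_value n.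
Proof.
move=> cF /andP[cok /(weighted_chi n) E]; apply: (@mulfI _ 48) => //; rewrite -E /weights.
elim: cells cok cF {E} => [|[w U] cells IH] /=; first by rewrite /weighted !big_nil mulr0.
move=> /andP[/andP[sU /eqP wU] ok] cF; rewrite /weighted big_cat -!/(weighted _ n) /=.
rewrite big_cons mulrDr IH //; last first.
  by move=> x xc; apply: cF; rewrite inE xc orbT.
rewrite -orbit_dim_trace //; last by apply: cF; rewrite inE eqxx.
have Z : w * (size (stab_list U))%:Z = 48 * sgz w by rewrite {1}(intEsg w) -mulrA -PoszM wU mulrC.
by rewrite Z mulrA.
Qed.

Definition reached (reps : seq (seq nat)) : bool :=
  all (fun T => search (fun U => size U == size T) (fun U => reaches k (codesT k vs U) (codesT k vs T)) reps)
    (faces k vs).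

(** The inverse of the matrix of the minimal basis of s brings s to a face in the standard chart,
    and each such face was found in the orbit of a representative of the same size. *)
Lemma orbit_reps reps s : {subset reps <= faces k vs} -> reached reps -> uni s ->
  exists U, [/\ U \in reps, (m + size U = size s)%N & same_orbit (cell U) s].
Proof.
move=> rF /allP R us; have [b gb] := good_exists us.
have bs : basis_in b s by case: gb => [[]].
have db := proj2 bs; have P := chart vs_ok vs_cover db us bs.
have TF := Tb_faces vs_ok vs_cover db us bs.
set T := Tb vs b s in P TF.
have := R T TF; rewrite searchE => /hasP[U UR /andP[/eqP sz re]]; exists U; split => //.
  by rewrite sz (perm_size P) size_cat size_codom card_ord size_map.
have FI V : V \in faces k vs -> all (codeok k) (codesT k vs V).
  rewrite mem_filter => /andP[_ VI].
  by have /andP[] := codesT_ok vs_ok VI.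
have sub : {subset stdc k <= codesT k vs U} by move=> c cs; rewrite mem_cat cs.
apply: (@same_orbit_act _ _ _ (GLinv (GLb b))).
apply: (@same_orbit_perm _ _ (cell T)); last first.
  exact: (proj2 (reaches_orbit (FI _ (rF _ UR)) (FI _ TF) sub)) re.
rewrite (chart_codes vs db) in P; rewrite perm_sym.
by have := perm_map (lact (GLinv (GLb b))) P; rewrite (mapK (@lactK _ (GLb b))).
Qed.

End OrbitCodes.

(** * From coordinate vectors back to homogeneous polynomials *)

Section Translation.
Local Open Scope ring_scope.
Variables (k n : nat).
Notation m := k.+1.
Local Notation V := 'rV[rat]_(size (mons m n)).
Local Notation R := (@sym_rep k n).
Local Notation T f := (fun x => topoly (f x)).

Lemma topolyD u v : topoly (u + v : V) = topoly u + topoly v.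
Proof. by rewrite /topoly -big_split; apply: eq_bigr => i _; rewrite mxE scalerDl. Qed.

Lemma topolyZ a v : topoly (a *: v : V) = a *: topoly v.
Proof. by rewrite /topoly scaler_sumr; apply: eq_bigr => i _; rewrite mxE scalerA. Qed.

Lemma topoly0 : topoly (0 : V) = 0.
Proof. by rewrite -(scale0r (0 : V)) topolyZ scale0r. Qed.

Lemma topoly_sum (I : Type) (r : seq I) (F : I -> V) :
  topoly (\sum_(i <- r) F i) = \sum_(i <- r) topoly (F i).
Proof. exact: (big_morph _ topolyD topoly0). Qed.

Lemma topoly_sign (j : nat) (v : V) : topoly ((-1) ^+ j *: v) = (-1) ^+ j * topoly v.
Proof. by rewrite topolyZ -mul_mpolyC rmorphXn rmorphN1. Qed.

Lemma act_topoly g (v : V) : Defs.act m g (topoly v) = topoly (rho R g v).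
Proof.
rewrite -msubst_topoly /Defs.act /msubst; congr comp_mpoly; apply: eq_from_tnth => j.
by rewrite !tnth_mktuple; apply: eq_bigr => i _; rewrite mxE.
Qed.

Lemma cochain_topoly i (f : ('I_i.+1 -> GLZ m) -> V) : cochain m n i (T f) <-> InA (rho R) f.
Proof.
split=> [[_ H] g x|H]; first by apply: topoly_inj; rewrite H act_topoly.
split=> [x|g x]; first exact: topoly_homog.
by rewrite act_topoly -H.
Qed.

Lemma cochainE i f : cochain m n i f -> f = T (fun x => ofpoly n (f x)).
Proof. by move=> [H _]; apply: funext => x; rewrite ofpolyK //; apply: H. Qed.

Lemma cobound_topoly i (f : ('I_i.+1 -> GLZ m) -> V) : cobound m i (T f) = T (dA f).
Proof.
apply: funext => x; rewrite /dA topoly_sum.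
by apply: eq_bigr => j _; rewrite topoly_sign.
Qed.

Lemma topoly_fun_inj (X : Type) (f h : X -> V) : T f = T h -> f = h.
Proof.
by move=> E; apply: funext => x; apply: topoly_inj; apply: (congr1 (fun F => F x) E).
Qed.

Lemma is_cocycle_topoly i (f : ('I_i.+1 -> GLZ m) -> V) : is_cocycle m n i (T f) <-> ZA (rho R) f.
Proof.
rewrite /is_cocycle /ZA cochain_topoly cobound_topoly.
have Z : (fun _ => 0) = T (fun _ : 'I_i.+2 -> GLZ m => 0 : V).
  by apply: funext => x; rewrite topoly0.
by rewrite Z; split=> -[H E]; split=> //; [apply: topoly_fun_inj|rewrite E].
Qed.

Lemma is_coboundary_topoly i (f : ('I_i.+1 -> GLZ m) -> V) :
  is_coboundary m n i (T f) <-> BA (rho R) f.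
Proof.
case: i f => [|i] f; rewrite /is_coboundary /BA.
  have Z : (fun _ => 0) = T (fun _ : 'I_1 -> GLZ m => 0 : V).
    by apply: funext => x; rewrite topoly0.
  by rewrite Z; split=> [/topoly_fun_inj|->].
split=> [[h [Ch E]]|[h Ih ->]]; last by exists (T h); rewrite cobound_topoly; split=> //; apply/cochain_topoly.
have Eh := cochainE Ch; rewrite Eh in Ch E; exists (fun x => ofpoly n (h x)); first exact/cochain_topoly.
by apply: topoly_fun_inj; rewrite E cobound_topoly.
Qed.

Lemma hdim_dimq i r : dimq (ZA (rho R) (i := i)) (BA (rho R) (i := i)) r -> hdim m n i r.
Proof.
have sumT (X : Type) (c : 'I_r -> rat) (z : 'I_r -> X -> V) x :
  \sum_(l < r) c l *: topoly (z l x) = topoly (\sum_(l < r) c l *: z l x).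
  by rewrite topoly_sum; apply: eq_bigr => l _; rewrite topolyZ.
move=> [z [H1 [H2 H3]]]; exists (fun l => T (z l)); split; first by move=> l; apply/is_cocycle_topoly.
split=> [f Zf|c].
  have Ef := cochainE (proj1 Zf); rewrite Ef in Zf *.
  have [c Bc] := H2 _ (proj1 (is_cocycle_topoly _) Zf); exists c.
  have := proj2 (is_coboundary_topoly _) Bc; congr is_coboundary.
  by apply: funext => x; rewrite sumT topolyD -scaleN1r topolyZ scaleN1r.
have -> : (fun x => \sum_(l < r) c l *: topoly (z l x)) = T (fun x => \sum_(l < r) c l *: z l x).
  by apply: funext => x; rewrite sumT.
by move/is_coboundary_topoly; apply: H3.
Qed.

End Translation.

(** * The Euler characteristic of the group from its orbits of cells *)

Section EulerFromCells.
Local Open Scope ring_scope.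
Variables (k N : nat) (NE : size (pairs k.+1) = N).
Notation m := k.+1.
Variables (vs : seq (seq int)) (crit : seq nat).
Hypothesis vs_ok : codes_ok k (stdc k ++ vs).
Hypothesis vs_cover : all (fun c => lposl c ==> (c \in stdc k ++ vs)) (lists_of m [:: -1; 0; 1]).
Hypothesis closed_ok : closed_check k N vs.
Hypothesis crit_face : crit \in faces k vs.
Hypothesis crit_size : (m + size crit = N)%N.
Hypothesis crit_det : detr N (map (sq2 m) (codesT k vs crit)) != 0.
Hypothesis ex_pos : forall (V : lmodType rat) p (f : seq (line m) -> V), alt N p.+1 f -> dd f = (fun _ => 0) ->
  exists f', alt N p f' /\ dd f' = f.
Hypothesis ex_zero : forall (V : lmodType rat) (f : seq (line m) -> V), alt N 0 f -> dd f = (fun _ => 0) ->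
  f (critical_cell vs crit (b0 (k := k))) = 0 -> f = fun _ => 0.
Variable reps : seq (seq nat).
Hypothesis reps_faces : {subset reps <= faces k vs}.
Hypothesis reps_reached : reached k vs reps.

Variable n : nat.
Local Notation och := (ochar N vs crit).
Local Notation rep := (rho (@sym_rep k n)).
Local Notation cell U := (map (lineof k) (codesT k vs U)).
Local Notation cochains p := (InB N rep och p).
Local Notation is_zero := (fun f : seq (line m) -> 'rV[rat]_(size (mons m n)) => f = fun _ => 0).

Lemma b0_det : `|\det (lmx (b0 (k := k)))| = 1.
Proof.
have E : lmx (b0 (k := k)) *m lmx (b0 (k := k)) = 1%:M.
  apply/matrixP => i j; rewrite !mxE (bigD1 (rev_ord j)) //= !mxE rev_ordK !eqxx !andbT mulr1 big1 ?addr0 // => q qj.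
  by rewrite !mxE !andbT [q == _](negbTE qj) mulr0.
have := congr1 (fun A => `|\det A|) E; rewrite det_mulmx det1 normrM normr1 => /eqP.
have := normr_ge0 (\det (lmx (b0 (k := k)))); move: (`|_|); clear => x x0 /eqP; nia.
Qed.

Lemma rep_cell U : U \in faces k vs -> [/\ forall j, lstd j \in cell U, uni (cell U) & size (cell U) = (m + size U)%N].
Proof.
move=> UF; have UI : U \in sublists (iota 0 (size vs)) by move: UF; rewrite mem_filter => /andP[].
have sub : {subset stdc k <= codesT k vs U} by move=> c cs; rewrite mem_cat cs.
split.
- by move=> j; rewrite -lineof_stdc map_f // sub // mem_nth // size_stdc.
- by apply/uniL_P => //; [apply: codesT_ok|move: UF; rewrite mem_filter => /andP[]].
by rewrite size_map size_cat size_stdc size_map.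
Qed.

Lemma cells_dim0 p : (N < m + p)%N -> dimq (cochains p) is_zero 0.
Proof.
move=> Np; exists (fun _ _ => 0); split; first by case.
split; last by move=> c _ [].
move=> f [[af _] _]; exists (fun _ => 0); apply: funext => s.
rewrite big_ord0 subr0; apply/eqP; apply: contraT => /af[us sz].
have [U [_ sU _]] := orbit_reps vs_ok vs_cover reps_faces reps_reached us.
by move: sU sz Np; clear; lia.
Qed.

Lemma cells_dim1 p U : U \in reps -> (m + size U + p = N)%N ->
  (forall U', U' \in reps -> size U' = size U -> U' = U) ->
  dimq (cochains p) is_zero (orbit_dim k n N vs crit U).
Proof.
move=> UR sU H; have [h1 h2 h3] := rep_cell (reps_faces UR).
apply: (dimq_one (@sym_repM k n) _ h1 h2); first exact: ocharM.
  by rewrite h3.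
move=> s us sz; have [U' [U'R sU' os]] := orbit_reps vs_ok vs_cover reps_faces reps_reached us.
by rewrite -(H U') //; move: sU sU' sz; clear; lia.
Qed.

Lemma cells_dim2 p U U' : U \in reps -> U' \in reps -> (m + size U + p = N)%N -> size U' = size U ->
  ~~ reaches k (codesT k vs U) (codesT k vs U') ->
  (forall T, T \in reps -> size T = size U -> T = U \/ T = U') ->
  dimq (cochains p) is_zero (orbit_dim k n N vs crit U + orbit_dim k n N vs crit U').
Proof.
move=> UR UR' sU sU' nr H; have [h1 h2 h3] := rep_cell (reps_faces UR).
have [h1' h2' h3'] := rep_cell (reps_faces UR').
apply: (dimq_two (@sym_repM k n) _ h1 h2 _ h1' h2'); first exact: ocharM.
- by rewrite h3.
- by rewrite h3' sU'.
- move=> s us sz; have [T [TR sT os]] := orbit_reps vs_ok vs_cover reps_faces reps_reached us.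
  by have [|E|E] := H T TR; [move: sU sT sz; clear; lia|left|right]; rewrite -E.
move=> s [g P] [h Q]; case/negP: nr.
have FI T : T \in reps -> all (codeok k) (codesT k vs T).
  by move=> /reps_faces; rewrite mem_filter => /andP[_ TI]; have /andP[] := codesT_ok vs_ok TI.
apply: (proj1 (reaches_orbit (FI _ UR) (FI _ UR') _)); first by move=> c cs; rewrite mem_cat cs.
apply: (@same_orbit_act _ _ _ h); exists g; apply: perm_trans P _; by rewrite perm_sym.
Qed.

Lemma subspace_cells p : subspace (cochains p).
Proof.
split=> [|a f h [f1 f2] [h1 h2]].
  by split=> [|g s]; [exact: alt0|rewrite linear0 scaler0].
split=> [|g s]; first exact: alt_lin.
by rewrite f2 h2 linearD [rep g (a *: _)]linearZ /= scalerDr !scalerA [a * _]mulrC.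
Qed.

Lemma cells_dd p f : cochains p f -> cochains p.+1 (dd f).
Proof.
move=> [f1 f2]; split=> [|g s]; first exact: alt_dd.
rewrite /dd (perm_big _ (ext_act g s)) big_map linear_sum scaler_sumr.
by apply: eq_bigr => v _; rewrite -f2.
Qed.

Theorem chi_h_cells (d : nat -> nat) P : (forall p, dimq (cochains p) is_zero (d p)) ->
  (forall p, (P <= p)%N -> d p = 0%N) -> chi_h m n (\sum_(p < P) (-1) ^+ p * (d p)%:Z).
Proof.
move=> dim dP.
have oM := ocharM NE vs_ok crit_face crit_size crit_det.
have o1 := ochar1 NE vs_ok crit_face crit_size crit_det.
have [||p f|h [H1 H2 <-]] := euler_char (@lin_dd m _) _ _ _ dim dP.
- exact: subspace_cells.
- exact: cells_dd.
- by case=> f1 _; apply: dd_dd f1.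
exists P, h; split; last by split.
move=> i; apply: hdim_dimq.
have c0 : orient N (critical_cell vs crit (b0 (k := k))) != 0.
  exact: (orient_cell NE vs_ok crit_face crit_size crit_det b0_det).
have D := dimq_compare (rhoM (@sym_repM k n)) oM o1 (orient_alt NE)
  (orient_closed NE vs_ok vs_cover closed_ok)
  (orient_act NE vs_ok crit_face crit_size crit_det) c0 (@ex_pos _) (@ex_zero _).
apply: D.
exact: H1.
Qed.

End EulerFromCells.

(** * Values *)

Section Values.
Local Open Scope ring_scope.

(* Cells up to GL_m(Z): each list gives the indices in [vs3], resp. [vs2], of the vectors added to the standard basis. *)
Definition reps3 : seq (seq nat) := [:: [:: 0; 2; 5]; [:: 0; 2]; [:: 0]; [:: 6]; [::]]%N.
Definition reps2 : seq (seq nat) := [:: [:: 1]; [::]]%N.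

Lemma faces_crit3 : let F := faces 2 vs3 in all (fun T => T \in F) reps3.
Proof. vm_cast_no_check (erefl true). Qed.
Lemma faces_crit2 : all (fun T => T \in faces 1 vs2) reps2. Proof. by vm_compute. Qed.
Lemma crit_det3 : detr 6 (map (sq2 3) (codesT 2 vs3 crit3)) != 0. Proof. vm_cast_no_check (erefl true). Qed.
Lemma crit_det2 : detr 3 (map (sq2 2) (codesT 1 vs2 crit2)) != 0. Proof. by vm_compute. Qed.
Lemma closed3 : closed_check 2 6 vs3. Proof. vm_cast_no_check (erefl true). Qed.
Lemma closed2 : closed_check 1 3 vs2. Proof. by vm_compute. Qed.
Lemma reached3 : reached 2 vs3 reps3. Proof. vm_cast_no_check (erefl true). Qed.
Lemma reached2 : reached 1 vs2 reps2. Proof. by vm_compute. Qed.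
(** The first cell contains the dependent triple e_1, e_2, e_1 + e_2, whereas any three of e_1, e_2,
    e_3, e_1 + e_2 + e_3 are independent. *)
Lemma two_orbits3 : ~~ reaches 2 (codesT 2 vs3 [:: 0%N]) (codesT 2 vs3 [:: 6%N]).
Proof. vm_cast_no_check (erefl true). Qed.

(* The integer attached to a cell of stabiliser H in degree p is (-1)^p 48 / |H|. *)
Definition cells3 : seq (int * seq nat) :=
  [:: (1, [:: 0; 2; 5]%N); (-3, [:: 0; 2]%N); (2, [:: 0%N]); (1, [:: 6%N]); (-1, [::])].
Definition cells2 : seq (int * seq nat) := [:: (4, [:: 1%N]); (-6, [::])].

Lemma cells_ok3 : cells_ok 2 6 vs3 crit3 cells3. Proof. vm_cast_no_check (erefl true). Qed.
Lemma cells_ok2 : cells_ok 1 3 vs2 crit2 cells2. Proof. by vm_compute. Qed.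

Theorem chi_h3 n : chi_h 3 n (chi_value n).
Proof.
have cf : crit3 \in faces 2 vs3 by apply: (allP faces_crit3).
pose od U := orbit_dim 2 n 6 vs3 crit3 U.
have E : \sum_(x <- cells3) sgz x.1 * (od x.2)%:Z = chi_value n :=
  cells_chi n erefl vs3_ok cf erefl crit_det3 isT
    (allP faces_crit3 : {subset [seq x.2 | x <- cells3] <= _}) cells_ok3.
pose d p := match p with
  0 => od [:: 0; 2; 5] | 1 => od [:: 0; 2] | 2 => od [:: 0] + od [:: 6] | 3 => od [::] | _ => 0 end%N.
have -> : chi_value n = \sum_(p < 4) (-1) ^+ p * (d p)%:Z.
  rewrite -E {E}; clearbody od; rewrite /d /cells3 !big_cons big_nil !big_ord_recr big_ord0 /= /sgz /=; lia.
have C := @chi_h_cells 2 6 erefl _ _ vs3_ok vs3_cover closed3 cf erefl crit_det3 exact_pos3 exact_zero3 n d 4.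
apply: C; last by clearbody od; case=> [|[|[|[|p]]]].
have R1 := @cells_dim1 2 6 erefl vs3 crit3 vs3_ok vs3_cover cf erefl crit_det3 reps3 (allP faces_crit3) reached3 n.
case=> [|[|[|[|p]]]]; rewrite /d {d E}.
- by apply: (R1 0%N [:: 0; 2; 5]%N isT erefl) => U'; rewrite !inE => /or4P[/eqP->|/eqP->|/eqP->|/orP[/eqP->|/eqP->]].
- by apply: (R1 1%N [:: 0; 2]%N isT erefl) => U'; rewrite !inE => /or4P[/eqP->|/eqP->|/eqP->|/orP[/eqP->|/eqP->]].
- apply: (@cells_dim2 2 6 erefl vs3 crit3 vs3_ok vs3_cover cf erefl crit_det3 reps3 (allP faces_crit3) reached3 n
    2%N [:: 0%N] [:: 6%N] isT isT erefl erefl two_orbits3).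
  move=> T; rewrite !inE => /or4P[/eqP->|/eqP->|/eqP->|/orP[/eqP->|/eqP->]] sT.
  - by have := sT.
  - by have := sT.
  - by left.
  - by right.
  by have := sT.
- by apply: (R1 3%N [::] isT erefl) => U'; rewrite !inE => /or4P[/eqP->|/eqP->|/eqP->|/orP[/eqP->|/eqP->]].
by apply: (@cells_dim0 2 6 vs3 crit3 vs3_ok vs3_cover reps3 (allP faces_crit3) reached3 n p.+4).
Qed.

Theorem chi_h2 n : chi_h 2 n (chi_value n).
Proof.
have cf : crit2 \in faces 1 vs2 by apply: (allP faces_crit2).
pose od U := orbit_dim 1 n 3 vs2 crit2 U.
have E : \sum_(x <- cells2) sgz x.1 * (od x.2)%:Z = chi_value n :=
  cells_chi n erefl vs2_ok cf erefl crit_det2 isT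
    (allP faces_crit2 : {subset [seq x.2 | x <- cells2] <= _}) cells_ok2.
pose d p := match p with 0 => od [:: 1] | 1 => od [::] | _ => 0 end%N.
have -> : chi_value n = \sum_(p < 2) (-1) ^+ p * (d p)%:Z.
  rewrite -E {E}; clearbody od; rewrite /d /cells2 !big_cons big_nil !big_ord_recr big_ord0 /= /sgz /=; lia.
have C := @chi_h_cells 1 3 erefl _ _ vs2_ok vs2_cover closed2 cf erefl crit_det2 exact_pos2 exact_zero2 n d 2.
apply: C; last by clearbody od; case=> [|[|p]].
have R1 := @cells_dim1 1 3 erefl vs2 crit2 vs2_ok vs2_cover cf erefl crit_det2 reps2 (allP faces_crit2) reached2 n.
case=> [|[|p]]; rewrite /d {d E}.
- by apply: (R1 0%N [:: 1%N] isT erefl) => U'; rewrite !inE => /orP[/eqP->|/eqP->].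
- by apply: (R1 1%N [::] isT erefl) => U'; rewrite !inE => /orP[/eqP->|/eqP->].
by apply: (@cells_dim0 1 3 vs2 crit2 vs2_ok vs2_cover reps2 (allP faces_crit2) reached2 n p.+2).
Qed.

End Values.

Theorem theorem5p6 (n : nat) :
  chi_h 3 n (chi_value n) /\ chi_h 2 n (chi_value n).
Proof. by split; [apply: chi_h3|apply: chi_h2]. Qed.
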